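(* (1) Let $G$ be a graph product of finite groups (over a finite simplicial graph). The coarse median structure on $G$ induced by the graph-product complex of $G$ is fixed by $\mathrm{Out}(G)$. (2) Let $W$ be a Coxeter group whose Niblo--Reeves cubulation is cocompact. The coarse median structure on $W$ induced by the Niblo--Reeves cubulation is fixed by $\mathrm{Out}(W)$.
   Context: Cocompact cubulations and coarse medians. A cocompact cubulation of a group $G$ is a proper cocompact action $G\curvearrowright X$ by cubical automorphisms on a CAT(0) cube complex $X$. Let $d_X$ be the combinatorial metric on $X^{(0)}$. The median $m(x,y,z)$ of vertices $x,y,z\in X$ is the unique vertex lying on a $1$-skeleton geodesic between any two of the three vertices. Fix a vertex $v\in X$. A cubical coarse median induced by $G\curvearrowright X$ is a map $\mu\colon G^3\to G$ with $\sup_{g_1,g_2,g_3\in G}d_X\big(\mu(g_1,g_2,g_3)v,\,m(g_1v,g_2v,g_3v)\big)<\infty$ (changing $v$ changes $\mu$ only by a bounded amount). Two such maps $\mu,\nu\colon G^3\to G$ represent the same coarse median structure $[\mu]=[\nu]$ if $\mu(a,b,c)$ and $\nu(a,b,c)$ are at uniformly bounded distance in a word metric on $G$. The group $\mathrm{Aut}(G)$ acts on coarse median structures by $(\varphi\cdot\mu)(a,b,c)=\varphi\big(\mu(\varphi^{-1}(a),\varphi^{-1}(b),\varphi^{-1}(c))\big)$; inner automorphisms act trivially, so this descends to an action of $\mathrm{Out}(G)$. Graph-product complex. Let $\Gamma$ be a finite simplicial graph and $\{F_v\}_{v\in\Gamma}$ finite groups indexed by its vertices. The graph product $G$ is the quotient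 of the free product of the $F_v$ by the normal subgroup generated by the commutator sets $[F_w,F_{w'}]$ for all edges $[w,w']$ of $\Gamma$. For $\Lambda\subseteq\Gamma$, $G_\Lambda\leq G$ is the subgroup generated by $\bigcup_{v\in\Lambda}F_v$ ($G_\emptyset=1$). The graph-product complex $\mathcal D$ is the cube complex whose vertices are the cosets $gG_c$ with $g\in G$ and $c\subseteq\Gamma$ a (possibly empty) clique; there is an edge $[gG_c,gG_{c'}]$ whenever $c\subseteq c'$ and $\#c=\#c'-1$; and for each $g\in G$ and cliques $c\subseteq c'$ with $\#c=\#c'-k$, a $k$-cube is glued to the subgraph spanned by the vertices $gG_{c''}$ with $c\subseteq c''\subseteq c'$ (each cube being determined by its vertex set). $G$ acts by left multiplication on cosets, and this is a cocompact cubulation of $G$. Niblo--Reeves cubulation. Let $(W,S)$ be a Coxeter system with $S$ finite. Let $\Sigma$ be the $2$-complex with vertex set $W$, an edge joining $w$ and $ws$ for each $w\in W$, $s\in S$, and, for all distinct $s,t\in S$ such that $st$ has finite order $m$, a $2m$-gon attached along each cycle with edges alternately labelled by $s$ and $t$ (one for each coset $w\langle s,t\rangle$). Walls of $\Sigma$ are the subsets uniquely determined by the property that a wall intersects each $2$-cell either in the empty set or in a segment joining midpoints of opposite edges; equivalently, each wall is obtained from the midpoint of an edge by continuing through such segments. Each wall separates $\Sigma$ into two sides. The Niblo--Reeves cubulation is the action of $W$ on the CAT(0) cube complex dual to this collection of walls: its vertices are the choices of one side for each wall such that any two chosen sides intersect and such that, for any given vertex $w\in\Sigma$, all but finitely many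 chosen sides contain $w$; two vertices are joined by an edge when they differ on exactly one wall; and all cubes whose $1$-skeleton appears are filled in. *)

(* Defs.v *)
From HB Require Import structures.
From Stdlib Require Import Relations.
From mathcomp Require Import all_boot fingroup.
From mathcomp Require Import boolp classical_sets functions cardinality.

Set Implicit Arguments.
Unset Strict Implicit.
Unset Printing Implicit Defensive.

Local Open Scope classical_set_scope.
Local Open Scope group_scope.

Section Subgroups.
Variable G : groupType.
Implicit Types A H : set G.

Definition subgroup H : Prop :=
  [/\ H 1, forall x y, H x -> H y -> H (x * y) & forall x, H x -> H x^-1].

Definition normal_subgroup H : Prop :=
  subgroup H /\ forall x y, H x -> H (x ^ y).

Definition subgroup_gen A : set G := smallest subgroup A.

Definition normal_closure A : set G := smallest normal_subgroup A.

Definition translate (g : G) A : set G := (fun x => g * x) @` A.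

Definition has_order (x : G) (m : nat) : Prop :=
  [/\ (0 < m)%N, x ^+ m = 1 &
    forall k, (0 < k)%N -> x ^+ k = 1 -> (m <= k)%N].

(* [word_length_le S n x]: the word length of [x] with respect to [S] is at
   most [n]. *)
Definition word_length_le (S : set G) (n : nat) (x : G) : Prop :=
  exists2 w : seq G, (size w <= n)%N &
    (forall y, y \in w -> S y \/ S y^-1) /\ x = \prod_(y <- w) y.

End Subgroups.

Section CoarseMedianStructures.
Variable G : groupType.
Implicit Types mu nu : G -> G -> G -> G.

(* The left-invariant word distance of [g] and [h] is the length of
   [g^-1 * h]. *)
Definition same_coarse_median_structure mu nu : Prop :=
  exists S : set G, [/\ finite_set S, subgroup_gen S = setT &
    exists C : nat, forall a b c,
      word_length_le S C ((mu a b c)^-1 * nu a b c)].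

(* [psi] stands for the inverse of the automorphism [phi]. *)
Definition aut_act (phi psi : G -> G) mu : G -> G -> G -> G :=
  fun a b c => phi (mu (psi a) (psi b) (psi c)).

(* Inner automorphisms act trivially on coarse median structures, so the
   action of Out(G) is given by representatives in Aut(G): a structure is fixed
   by Out(G) when all automorphisms fix it. *)
Definition fixed_by_Out mu : Prop :=
  forall (phi : {multiplicative G -> G}) (psi : G -> G),
    cancel phi psi -> cancel psi phi ->
    same_coarse_median_structure (aut_act phi psi mu) mu.

End CoarseMedianStructures.

(* In the cube complexes below each cube is determined by its vertex set, so a
   complex with vertices in [T] is given by the vertex sets of its cubes. *)
Definition cube_complex (T : Type) := set (set T).

Section CubeComplexes.
Variables (T : choiceType) (X : cube_complex T).
Implicit Types x y z m : T.

Definition vertex x : Prop := X [set x].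

Definition adjacent x y : Prop := x <> y /\ X [set x; y].

Fixpoint walk (n : nat) x y : Prop :=
  if n is n'.+1 then exists2 z, adjacent x z & walk n' z y else x = y.

Definition dist_le (n : nat) x y : Prop := exists2 k, (k <= n)%N & walk k x y.

Definition on_geodesic x y m : Prop :=
  exists i j, [/\ walk i x m, walk j m y &
    forall k, walk k x y -> (i + j <= k)%N].

(* [x] is a default value: in a CAT(0) cube complex there is exactly one vertex
   with this property. *)
Definition median x y z : T :=
  xget x [set m | [/\ on_geodesic x y m, on_geodesic y z m
                    & on_geodesic x z m]].

Variables (G : groupType) (act : G -> T -> T).

Definition cubical_coarse_median (v : T) (mu : G -> G -> G -> G) : Prop :=
  exists n : nat, forall g1 g2 g3,
    dist_le n (act (mu g1 g2 g3) v) (median (act g1 v) (act g2 v) (act g3 v)).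

(* The quotient of a cube complex by a group of cubical automorphisms is compact
   exactly when there are finitely many orbits of cubes. *)
Definition cocompact : Prop :=
  exists K : set (set T), [/\ finite_set K, K `<=` X &
    forall C, X C -> exists g C0, K C0 /\ C = act g @` C0].

End CubeComplexes.

Section Quotient.
Variables (G : groupType) (A : set G).
Local Notation N := (normal_closure A).

Lemma normal_closureP : normal_subgroup N.
Proof.
split; first split.
- by move=> H [[[]]].
- by move=> x y Nx Ny H HP; case: (HP) => [[[_ HM _] _] _];
  apply: HM; [exact: Nx|exact: Ny].
- by move=> x Nx H HP; case: (HP) => [[[_ _ HV] _] _]; apply: HV; exact: Nx.
- by move=> x y Nx H HP; case: (HP) => [[_ HJ] _]; apply: HJ; exact: Nx.
Qed.

Definition coset_rel (x y : G) : bool := `[< N (x^-1 * y) >].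

Lemma coset_rel_refl : reflexive coset_rel.
Proof. by move=> x; apply/asboolP; rewrite mulVg; case: normal_closureP => [[]]. Qed.

Lemma coset_rel_sym : symmetric coset_rel.
Proof.
have [[_ _ NV] _] := normal_closureP.
by move=> x y; apply/asboolP/asboolP => /NV; rewrite invgM invgK.
Qed.

Lemma coset_rel_trans : transitive coset_rel.
Proof.
have [[_ NM _] _] := normal_closureP.
move=> y x z /asboolP xy /asboolP yz; apply/asboolP.
by have := NM _ _ xy yz; rewrite mulgA mulgK.
Qed.

Definition coset_equiv : equiv_rel G :=
  EquivRel coset_rel coset_rel_refl coset_rel_sym coset_rel_trans.


Local Open Scope quotient_scope.

(* The quotient of [G] by the normal subgroup generated by [A]. *)
Definition quotient_by : Type := {eq_quot coset_equiv}.

HB.instance Definition _ := Choice.copy quotient_by {eq_quot coset_equiv}.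

Definition quotient_pi (x : G) : quotient_by := \pi_{eq_quot coset_equiv} x.

Let rep (X : quotient_by) : G := generic_quotient.repr (X : {eq_quot coset_equiv}).

Lemma quotient_piP x y : quotient_pi x = quotient_pi y <-> N (x^-1 * y).
Proof. by split=> [/eqmodP/asboolP|h]; last exact/eqmodP/asboolP. Qed.

Let repK X : quotient_pi (rep X) = X.
Proof. exact: reprK. Qed.

Let quotient_one : quotient_by := quotient_pi 1.
Let quotient_inv X : quotient_by := quotient_pi (rep X)^-1.
Let quotient_mul X Y : quotient_by := quotient_pi (rep X * rep Y).

Let pi_mul x y :
  quotient_mul (quotient_pi x) (quotient_pi y) = quotient_pi (x * y).
Proof.
have [[_ NM NV] NJ] := normal_closureP.
apply/quotient_piP.
have /quotient_piP/NV hx := repK (quotient_pi x).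
have /quotient_piP hy := repK (quotient_pi y).
rewrite invgM !mulgA.
set a := rep _ in hx *; set b := rep _ in hy *.
have -> : b^-1 * a^-1 * x * y = (a^-1 * x) ^ b * (b^-1 * y).
  by rewrite /conjg !mulgA mulgK.
apply: NM => //; apply: NJ; move/NV: hx.
by rewrite invgK.
Qed.

Let pi_inv x : quotient_inv (quotient_pi x) = quotient_pi x^-1.
Proof.
have [[_ NM NV] NJ] := normal_closureP.
apply/quotient_piP; rewrite invgK.
have /quotient_piP/NV/(NJ _ x^-1) := repK (quotient_pi x).
by rewrite /conjg invgM !invgK !mulgA mulgV mul1g.
Qed.

Let quotient_mulA : associative quotient_mul.
Proof.
by move=> X Y Z; rewrite -(repK X) -(repK Y) -(repK Z) !pi_mul mulgA.
Qed.
Let quotient_mul1 : left_id quotient_one quotient_mul.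
Proof. by move=> X; rewrite -(repK X) pi_mul mul1g. Qed.
Let quotient_1mul : right_id quotient_one quotient_mul.
Proof. by move=> X; rewrite -(repK X) pi_mul mulg1. Qed.
Let quotient_mulV : left_inverse quotient_one quotient_inv quotient_mul.
Proof. by move=> X; rewrite -(repK X) pi_inv pi_mul mulVg. Qed.
Let quotient_Vmul : right_inverse quotient_one quotient_inv quotient_mul.
Proof. by move=> X; rewrite -(repK X) pi_inv pi_mul mulgV. Qed.

HB.instance Definition _ := isGroup.Build quotient_by
  quotient_mulA quotient_mul1 quotient_1mul quotient_mulV quotient_Vmul.

Lemma quotient_pi_is_multiplicative : {morph quotient_pi : x y / x * y}.
Proof. by move=> x y; rewrite -pi_mul. Qed.

HB.instance Definition _ :=
  isMultiplicative.Build G quotient_by quotient_pi quotient_pi_is_multiplicative.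

End Quotient.

Section FreeProduct.
Variables (V : finType) (F : V -> finGroupType).

(* A letter [Tagged F x] is an element [x] of the factor [F (tag _)]. *)
Definition free_product_word := seq {v : V & F v}.

Inductive free_product_eq : free_product_word -> free_product_word -> Prop :=
| Free_product_unit v : free_product_eq [:: Tagged F (1 : F v)] [::]
| Free_product_mul v (x y : F v) :
    free_product_eq [:: Tagged F x; Tagged F y] [:: Tagged F (x * y)]
| Free_product_refl a : free_product_eq a a
| Free_product_sym a b : free_product_eq a b -> free_product_eq b a
| Free_product_trans a b c :
    free_product_eq a b -> free_product_eq b c -> free_product_eq a c
| Free_product_cat a a' b b' : free_product_eq a a' -> free_product_eq b b' ->
    free_product_eq (a ++ b) (a' ++ b').

Definition free_product_rel (a b : free_product_word) : bool :=
  `[< free_product_eq a b >].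

Lemma free_product_rel_refl : reflexive free_product_rel.
Proof. by move=> a; apply/asboolP; exact: Free_product_refl. Qed.

Lemma free_product_rel_sym : symmetric free_product_rel.
Proof. by move=> a b; apply/asboolP/asboolP; exact: Free_product_sym. Qed.

Lemma free_product_rel_trans : transitive free_product_rel.
Proof.
by move=> b a c /asboolP ab /asboolP bc; apply/asboolP/(Free_product_trans ab).
Qed.

Definition free_product_equiv : equiv_rel free_product_word :=
  EquivRel free_product_rel free_product_rel_refl free_product_rel_sym
    free_product_rel_trans.

Local Open Scope quotient_scope.

Definition free_product : Type := {eq_quot free_product_equiv}.

HB.instance Definition _ :=
  Choice.copy free_product {eq_quot free_product_equiv}.

Definition free_product_pi (a : free_product_word) : free_product :=
  \pi_{eq_quot free_product_equiv} a.

Let rep (X : free_product) : free_product_word :=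
  generic_quotient.repr (X : {eq_quot free_product_equiv}).

Lemma free_product_piP a b :
  free_product_pi a = free_product_pi b <-> free_product_eq a b.
Proof. by split=> [/eqmodP/asboolP|h]; last exact/eqmodP/asboolP. Qed.

Let repK X : free_product_pi (rep X) = X.
Proof. exact: reprK. Qed.

Let invw (a : free_product_word) : free_product_word :=
  rev [seq Tagged F (tagged u : F (tag u))^-1 | u <- a].

Let invw_eq a b : free_product_eq a b -> free_product_eq (invw a) (invw b).
Proof.
elim=> {a b} [v|v x y|a|a b _ ba|a b c _ ab _ bc|a a' b b' _ aa' _ bb'].
- by rewrite /invw /= invg1; exact: Free_product_unit.
- rewrite /invw /= invgM; exact: Free_product_mul.
- exact: Free_product_refl.
- exact: Free_product_sym.
- exact: Free_product_trans bc.
- by rewrite /invw !map_cat !rev_cat; exact: Free_product_cat.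
Qed.

Let invwK : involutive invw.
Proof.
move=> a; rewrite /invw map_rev revK -map_comp -[RHS]map_id.
by apply: eq_map => -[v x] /=; rewrite invgK.
Qed.

Let mul_invw a : free_product_eq (a ++ invw a) [::].
Proof.
elim: a => [|[v x] a IH]; first exact: Free_product_refl.
rewrite /invw /= rev_cons -cats1 -/(invw a).
apply: (@Free_product_trans _ ([:: Tagged F x] ++ [:: Tagged F x^-1])).
  rewrite -[X in free_product_eq X _]cat1s [a ++ _]catA.
  apply: Free_product_cat; first exact: Free_product_refl.
  rewrite -[X in free_product_eq _ X]cat0s.
  by apply: Free_product_cat => //; exact: Free_product_refl.
apply: Free_product_trans (Free_product_mul _ _) _.
by rewrite mulgV; exact: Free_product_unit.
Qed.

Let fone : free_product := free_product_pi [::].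
Let finv X : free_product := free_product_pi (invw (rep X)).
Let fmul X Y : free_product := free_product_pi (rep X ++ rep Y).

Let pi_mul a b :
  fmul (free_product_pi a) (free_product_pi b) = free_product_pi (a ++ b).
Proof.
by apply/free_product_piP/Free_product_cat; apply/free_product_piP/repK.
Qed.

Let pi_inv a : finv (free_product_pi a) = free_product_pi (invw a).
Proof. by apply/free_product_piP/invw_eq; apply/free_product_piP/repK. Qed.

Let fmulA : associative fmul.
Proof.
by move=> X Y Z; rewrite -(repK X) -(repK Y) -(repK Z) !pi_mul catA.
Qed.
Let fmul1g : left_id fone fmul.
Proof. by move=> X; rewrite -(repK X) pi_mul. Qed.
Let fmulg1 : right_id fone fmul.
Proof. by move=> X; rewrite -(repK X) pi_mul cats0. Qed.
Let fmulgV : right_inverse fone finv fmul.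
Proof.
by move=> X; rewrite -(repK X) pi_inv pi_mul; apply/free_product_piP/mul_invw.
Qed.
Let fmulVg : left_inverse fone finv fmul.
Proof.
move=> X; rewrite -(repK X) pi_inv pi_mul; apply/free_product_piP.
by rewrite -[X in _ ++ X]invwK; exact: mul_invw.
Qed.

HB.instance Definition _ :=
  isGroup.Build free_product fmulA fmul1g fmulg1 fmulVg fmulgV.

Definition free_product_in v (x : F v) : free_product :=
  free_product_pi [:: Tagged F x].

End FreeProduct.

Section GraphProduct.
Variables (V : finType) (e : rel V) (F : V -> finGroupType).

Definition edge_commutators : set (free_product F) :=
  [set z | exists v w (x : F v) (y : F w),
    e v w /\ z = [~ free_product_in x, free_product_in y]].

Definition graph_product : groupType := quotient_by edge_commutators.

Definition graph_product_in v (x : F v) : graph_product :=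
  quotient_pi edge_commutators (free_product_in x).

(* The subgroup [G_L] generated by the vertex groups of [L]. *)
Definition parabolic (L : {set V}) : set graph_product :=
  subgroup_gen [set z | exists v (x : F v), v \in L /\ z = graph_product_in x].

Definition clique (c : {set V}) : bool :=
  [forall v in c, forall w in c, (v != w) ==> e v w].

(* The vertices are cosets, viewed as subsets of the graph product. A cube is
   the set of vertices [g G_d] with [c \subset d \subset c'], for cliques
   [c \subset c']; vertices and edges are the cases [#|c'| = #|c|] and
   [#|c'| = #|c|.+1]. *)
Definition graph_product_complex : cube_complex (set graph_product) :=
  [set C | exists g (c c' : {set V}), [/\ clique c, clique c', c \subset c' &
    C = [set A | exists d : {set V},
           [/\ c \subset d, d \subset c' & A = translate g (parabolic d)]]]].

End GraphProduct.

Arguments graph_product_complex {V} e F.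

Section Coxeter.
Variables (W : groupType) (S : set W).

(* [W] is presented by the generators [S] and the relations [(s * t) ^+ m = 1],
   for [s], [t] in [S] such that [s * t] has finite order [m] (when [s = t] this
   is [s ^+ 2 = 1]). *)
Definition coxeter_system : Prop :=
  [/\ forall s, S s -> has_order s 2, subgroup_gen S = setT &
    forall (H : groupType) (f : W -> H),
      (forall s t m, S s -> S t -> has_order (s * t) m ->
        (f s * f t) ^+ m = 1) ->
      exists phi : {multiplicative W -> H}, forall s, S s -> phi s = f s].

Definition coxeter_edge (E : set W) : Prop :=
  exists w s, S s /\ E = [set w; w * s].

(* The product [s * t * s * ...] of [n] alternating factors. *)
Fixpoint alternating (s t : W) (n : nat) : W :=
  if n is n'.+1 then s * alternating t s n' else 1.

(* The [2m]-gon of the coset [w <s, t>] through the edge from [w] to [w * s] has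
   successive vertices [w * alternating s t i], [i < 2m]; in it the [m]-th edge
   is opposite to the initial one. *)
Definition opposite_edges (E E' : set W) : Prop :=
  exists w s t m, [/\ S s, S t, s <> t & has_order (s * t) m] /\
    (E = [set w; w * s] /\
     E' = [set w * alternating s t m; w * alternating s t m.+1]).

(* A wall is recorded by the set of edges whose midpoints it contains. *)
Definition wall (H : set (set W)) : Prop :=
  exists E, coxeter_edge E /\
    H = [set E' | clos_refl_sym_trans _ opposite_edges E E'].

(* The sides of a wall are the components of its complement in the 2-complex,
   each recorded by its set of vertices. Every nonempty intersection of two
   sides contains a vertex, so that sides intersect exactly when their vertex
   sets do. *)
Definition side (H : set (set W)) (A : set W) : Prop :=
  exists w, A = [set u | clos_refl_trans W
    (fun x y => coxeter_edge [set x; y] /\ ~ H [set x; y]) w u].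

(* A choice of sides is a function on walls, extended by [set0] to the sets of
   edges that are not walls. *)
Definition side_choice := set (set W) -> set W.

Definition NR_vertex (a : side_choice) : Prop :=
  [/\ forall H, (wall H -> side H (a H)) /\ (~ wall H -> a H = set0),
      forall H K, wall H -> wall K -> a H `&` a K !=set0 &
      forall w, finite_set [set H | wall H /\ ~ a H w]].

Definition NR_adjacent (a b : side_choice) : Prop :=
  exists! H, a H <> b H.

(* [C] is the vertex set of a subgraph isomorphic to the 1-skeleton of a
   [k]-cube. *)
Definition niblo_reeves_complex : cube_complex side_choice :=
  [set C | exists k (f : {ffun 'I_k -> bool} -> side_choice),
    [/\ injective f, C = range f, forall p, NR_vertex (f p) &
      forall p q, NR_adjacent (f p) (f q) <-> #|[set i | p i != q i]%SET| = 1%N]].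

Definition niblo_reeves_act (w : W) (a : side_choice) : side_choice :=
  fun H => translate w (a (translate w^-1 @` H)).

End Coxeter.

Arguments niblo_reeves_complex {W} S.

(* Main.v *)
From HB Require Import structures.
From Stdlib Require Import Relations.
Require Import Defs.
From mathcomp Require Import all_boot fingroup.
From mathcomp Require Import boolp classical_sets functions cardinality.

(* Let phi be an automorphism of G. Two coarse medians induced by a complex
   agree up to bounded distance as soon as phi maps its half-spaces to uniformly
   quasi-convex sets: if the wall of a half-space A separates the two medians to
   be compared, then one of them is uniformly close to A and to its complement,
   and only boundedly many walls pass near a given point.

   Since a geodesic that leaves a half-space passes near its wall, it is enough
   that phi maps walls to quasi-convex sets. A wall is coarsely the fixed set of
   an element r of finite order, so that its image is coarsely the fixed set of
   phi(r), another element of finite order.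

   In a graph product, a wall and its translates carry the same label and hence
   never cross; this makes the coarse fixed set of every element of finite order
   quasi-convex.

   In a Coxeter group, r is a reflection and g = phi(r) is an involution. It is
   a product of reflections t that commute with g and whose sides are swapped by
   g, so its coarse fixed set is an intersection of neighbourhoods of walls.
   Cocompactness makes these neighbourhoods quasi-convex. *)

Set Implicit Arguments.
Unset Strict Implicit.
Unset Printing Implicit Defensive.

Local Open Scope classical_set_scope.
Local Open Scope group_scope.

(** * Words, half-spaces and rigidity *)

(** The coarse fixed set of [r] consists of the [x] at which the displacement [x^-1 * r * x] is
    short. Displacement is what an automorphism respects: [phi] sends it to the displacement of
    [phi r] at [phi x], and since balls are finite, bounds go to bounds. Nothing comparable is
    available for [phi] on walls themselves, whence the passage to elements of finite order.

    All estimates are made in the group. Half-spaces are pulled back along the orbit of a base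
    vertex, and word length is compared with the number of separating half-spaces. The complexes
    enter through their medians, which decide each wall by a majority vote of the three points. In a
    graph product a vertex with those sides has to be built, by crossing one wall at a time.

    The obstacle in a Coxeter group is that such a median is a vertex of the cubulation and not an
    element of the group. Cocompactness places a group element near it, up to finitely many types of
    half-spaces, and the median argument for a wall can then be run in [W]. *)

Definition mulgE := (@mulgA, @invgM, @invgK, @invg1, @mulg1, @mul1g, @mulgK, @mulgVK, @mulgV, @mulVg).

Section GeneratedSubgroups.
Variable G : groupType.
Implicit Types (x y h g t : G).

Lemma subgroup_gen_subgroup (A : set G) : subgroup (subgroup_gen A).
Proof.
split.
- by move=> H [[]].
- by move=> x y hx hy H HH; case: (HH) => [[_ hM _] _]; apply: hM; [exact: hx|exact: hy].
- by move=> x hx H HH; case: (HH) => [[_ _ hV] _]; apply: hV; exact: hx.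
Qed.

Lemma subgroup_gen_sub (A : set G) : A `<=` subgroup_gen A.
Proof. by move=> x Ax H [_]; apply. Qed.

Lemma subgroup_gen_conj (A B : set G) h :
  (forall t, A t -> subgroup_gen B (h * t * h^-1)) ->
  forall g, subgroup_gen A g -> subgroup_gen B (h * g * h^-1).
Proof.
move=> hAB; have [B1 BM BV] := subgroup_gen_subgroup B.
apply: (@smallest_sub _ _ _ [set g | subgroup_gen B (h * g * h^-1)]) => //.
split=> /=; first by rewrite mulg1 mulgV.
- by move=> x y hx hy; have := BM _ _ hx hy; rewrite !mulgE.
- by move=> x /BV; rewrite !mulgE.
Qed.

End GeneratedSubgroups.

Section Words.
Variables (G : groupType) (S : set G).
Implicit Types (x y g h s : G) (w : seq G) (n m : nat).

Definition step s := S s \/ S s^-1.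

Definition word w := forall y, y \in w -> step y.

Definition wprod w : G := \prod_(y <- w) y.

Lemma wprod_nil : wprod [::] = 1. Proof. exact: big_nil. Qed.

Lemma wprod_cons s w : wprod (s :: w) = s * wprod w. Proof. exact: big_cons. Qed.

Lemma wprod_cat u w : wprod (u ++ w) = wprod u * wprod w.
Proof. exact: big_cat. Qed.

Lemma stepV s : step s -> step s^-1.
Proof. by rewrite /step invgK => -[]; [right|left]. Qed.

Lemma word_nil : word [::]. Proof. by []. Qed.

Lemma word_cons s w : word (s :: w) <-> step s /\ word w.
Proof.
split=> [h|[ss hw] y]; first by split=> [|y yw]; apply: h; rewrite inE ?eqxx ?yw ?orbT.
by rewrite inE => /orP[/eqP->|/hw].
Qed.

Lemma word_cat u w : word (u ++ w) <-> word u /\ word w.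
Proof.
split=> [h|[hu hw] y]; first by split=> y yw; apply: h; rewrite mem_cat yw ?orbT.
by rewrite mem_cat => /orP[/hu|/hw].
Qed.

Lemma wlen_word w : word w -> word_length_le S (size w) (wprod w).
Proof. by exists w. Qed.

Lemma wlen_mono n m g : (n <= m)%N -> word_length_le S n g -> word_length_le S m g.
Proof. by move=> nm [w wn h]; exists w => //; exact: leq_trans nm. Qed.

Lemma wlen1 n : word_length_le S n 1.
Proof. by exists [::] => //; split=> //; rewrite big_nil. Qed.

Lemma wlen_step s : step s -> word_length_le S 1 s.
Proof.
move=> ss; exists [:: s] => //; split; last by rewrite big_seq1.
by apply/word_cons.
Qed.

Lemma wlenM n m g h : word_length_le S n g -> word_length_le S m h ->
  word_length_le S (n + m) (g * h).
Proof.
move=> [u un [hu ->]] [w wm [hw ->]]; exists (u ++ w).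
  by rewrite size_cat leq_add.
by split; [exact/word_cat|rewrite big_cat].
Qed.

Definition winv w := rev [seq y^-1 | y <- w].

Lemma size_winv w : size (winv w) = size w.
Proof. by rewrite size_rev size_map. Qed.

Lemma word_winv w : word w -> word (winv w).
Proof. by move=> hw y; rewrite mem_rev => /mapP[z /hw zs ->]; exact: stepV. Qed.

Lemma wprod_winv w : wprod (winv w) = (wprod w)^-1.
Proof.
elim: w => [|s w IH]; first by rewrite /winv /= wprod_nil invg1.
rewrite /winv /= rev_cons -cats1 wprod_cat -/(winv w) IH wprod_cons.
by rewrite wprod_cons wprod_nil mulg1 invgM.
Qed.

Lemma wlenV n g : word_length_le S n g -> word_length_le S n g^-1.
Proof.
move=> [w wn [hw ->]]; exists (winv w); first by rewrite size_winv.
by split; [exact: word_winv|exact/esym/wprod_winv].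
Qed.

Lemma wlen_conj n m x y g : word_length_le S n (x^-1 * y) ->
  word_length_le S m (y^-1 * g * y) -> word_length_le S (n + m + n) (x^-1 * g * x).
Proof.
move=> h k; have := wlenM (wlenM h k) (wlenV h).
by rewrite !mulgE.
Qed.

Lemma first_change (T : eqType) (f : G -> T) w x :
  f (x * wprod w) != f x ->
  exists w1 s w2, [/\ w = w1 ++ s :: w2, f (x * wprod w1) = f x &
    f (x * wprod w1 * s) != f x].
Proof.
elim: w x => [|s w IH] x; first by rewrite wprod_nil mulg1 eqxx.
rewrite wprod_cons mulgA => h.
have [e|ne] := eqVneq (f (x * s)) (f x); last first.
  by exists [::], s, w; rewrite wprod_nil mulg1.
have [|w1 [t [w2 [-> h1 h2]]]] := IH (x * s); first by rewrite e.
exists (s :: w1), t, w2; split=> //; rewrite wprod_cons mulgA -?e //.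
Qed.

Lemma gen_word g : subgroup_gen S g -> exists2 w, word w & wprod w = g.
Proof.
apply: (@smallest_sub _ _ _ [set h | exists2 w, word w & wprod w = h]);
  first split.
- by exists [::] => //; rewrite wprod_nil.
- move=> _ _ [u hu <-] [w hw <-]; exists (u ++ w); last by rewrite wprod_cat.
  exact/word_cat.
- by move=> _ [u hu <-]; exists (winv u); [exact: word_winv|rewrite wprod_winv].
- move=> s ss; exists [:: s]; first by apply/word_cons; split=> //; left.
  by rewrite wprod_cons wprod_nil mulg1.
Qed.

Lemma word_gen w : word w -> subgroup_gen S (wprod w).
Proof.
have [S1 SM SV] := subgroup_gen_subgroup S.
elim: w => [|s w IH]; first by rewrite wprod_nil.
move=> /word_cons[ss /IH hw]; rewrite wprod_cons; apply: SM hw.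
by case: ss => /(@subgroup_gen_sub _ S)// /SV; rewrite invgK.
Qed.

Hypothesis genS : subgroup_gen S = setT.

Lemma word_exists g : exists2 w, word w & wprod w = g.
Proof. by apply: gen_word; rewrite genS. Qed.

Definition geodesic w :=
  word w /\ forall u, word u -> wprod u = wprod w -> (size w <= size u)%N.

Lemma geodesic_exists g : exists2 w, geodesic w & wprod w = g.
Proof.
pose P n := `[< exists2 w, word w & wprod w = g /\ size w = n >].
have exP : exists n, P n.
  by have [w hw e] := word_exists g; exists (size w); apply/asboolP; exists w.
have [n /asboolP[w hw [wg <-]] mn] := ex_minnP exP.
exists w => //; split=> // u hu eu; apply: mn; apply/asboolP; exists u => //.
by rewrite eu.
Qed.

Lemma geodesic_catr u w : geodesic (u ++ w) -> geodesic w.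
Proof.
move=> [/word_cat[hu hw] h]; split=> // v hv e.
have := h (u ++ v); rewrite !size_cat leq_add2l; apply; first exact/word_cat.
by rewrite !wprod_cat e.
Qed.

Hypothesis finS : finite_set S.

Lemma ball_finite n : exists B : seq G, forall g, word_length_le S n g -> g \in B.
Proof.
have [L hL] : exists L : seq G, forall s, step s -> s \in L.
  have /finite_seqP[L eL] := finS.
  exists (L ++ [seq s^-1 | s <- L]) => s.
  rewrite /step eL mem_cat => -[/= ->//|/= h].
  by rewrite -(invgK s) map_f ?orbT.
elim: n => [|n [B hB]].
  exists [:: 1] => g [[|? ?] // _ [_ ->]]; by rewrite big_nil inE.
exists (1 :: [seq s * g | s <- L, g <- B]) => g [[|s w] //=].
  by move=> _ [_ ->]; rewrite big_nil inE eqxx.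
move=> wn [/word_cons[ss hw] ->]; rewrite big_cons inE; apply/orP; right.
by apply: allpairs_f; [exact: hL|apply: hB; exists w].
Qed.

Lemma wlen_all (B : seq G) : exists n, forall g, g \in B -> word_length_le S n g.
Proof.
elim: B => [|g B [n hn]]; first by exists 0%N.
have [w hw e] := word_exists g; exists (size w + n)%N => h.
rewrite inE => /orP[/eqP->|/hn]; last by apply: wlen_mono; rewrite leq_addl.
by rewrite -e; apply: (wlen_mono (leq_addr _ _)); exact: wlen_word.
Qed.

(** Balls are finite, so [f] is bounded on each of them. For an automorphism this is the Lipschitz
    control used below. *)
Lemma wlen_map (f : G -> G) n :
  exists m, forall g, word_length_le S n g -> word_length_le S m (f g).
Proof.
have [B hB] := ball_finite n; have [m hm] := wlen_all [seq f g | g <- B].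
by exists m => g /hB gB; apply: hm; exact: map_f.
Qed.

End Words.

Section Translate.
Variable G : groupType.
Implicit Types (A : set G) (g x : G).

Lemma translateE g A x : translate g A x = A (g^-1 * x).
Proof.
apply/propext; split=> [[y Ay <-]|h]; first by rewrite mulKg.
by exists (g^-1 * x) => //; rewrite mulVKg.
Qed.

Lemma translate_mem g A x : (x \in translate g A) = (g^-1 * x \in A).
Proof. by apply/idP/idP; rewrite !inE translateE. Qed.

Lemma translateM g h A : translate g (translate h A) = translate (g * h) A.
Proof. by apply/predeqP => x; rewrite !translateE invgM mulgA. Qed.

Lemma translate1 A : translate 1 A = A.
Proof. by apply/predeqP => x; rewrite translateE invg1 mul1g. Qed.

Lemma translateK g A : translate g^-1 (translate g A) = A.
Proof. by rewrite translateM mulVg translate1. Qed.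

Lemma translateVK g A : translate g (translate g^-1 A) = A.
Proof. by rewrite translateM mulgV translate1. Qed.

End Translate.

(** * Half-space systems and the word metric *)

Section Halfspaces.
Variables (G : groupType) (S : set G) (HH : set (set G)).
Implicit Types (x y z g h p q s : G) (w : seq G) (n m K : nat) (A B : set G).

Definition sep A x y := (x \in A) != (y \in A).

(** A coarse median interval: in a median graph, the case [K = 0] says that [z] lies between [x] and
    [y]. *)
Definition near_interval K x y z := exists2 l : seq (set G), (size l <= K)%N &
  forall B, HH B -> (x \in B) = (y \in B) -> sep B x z -> B \in l.

(** The interface between the two kinds of groups and the rigidity argument. [hs_fold] plays the
    part of an exchange condition: a path that crosses a wall and returns is not shortest. With
    [hs_sep_ex] it bounds word length by the number of separating half-spaces. *)
Record halfspace_system : Prop := HalfspaceSystem {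
  hs_finite : finite_set S;
  hs_gen : subgroup_gen S = setT;
  hs_inv : forall g A, HH A -> HH (translate g A);
  hs_sep_fin : forall s, step S s ->
    exists l : seq (set G), forall A, HH A -> sep A 1 s -> A \in l;
  hs_sep_ex : forall s, step S s -> s <> 1 -> exists2 A, HH A & sep A 1 s;
  hs_fold : forall A w1 w2, HH A -> word S w1 -> word S w2 ->
    sep A 1 (wprod w1) -> (1 \in A) = (wprod w1 * wprod w2 \in A) ->
    exists w, [/\ word S w, (size w < size w1 + size w2)%N &
      wprod w = wprod w1 * wprod w2] }.

Lemma sepC A x y : sep A x y = sep A y x.
Proof. by rewrite /sep eq_sym. Qed.

Lemma sep_translate g A x y : sep (translate g A) x y = sep A (g^-1 * x) (g^-1 * y).
Proof. by rewrite /sep !translate_mem. Qed.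

Lemma sep_trans A x y z : sep A x z -> sep A x y \/ sep A y z.
Proof. by rewrite /sep; case: (x \in A) (y \in A) (z \in A) => [] [] []; auto. Qed.

Hypothesis hs : halfspace_system.

Let finS := hs_finite hs.
Let genS := hs_gen hs.

Lemma near_interval_translate g K x y z :
  near_interval K x y z -> near_interval K (g * x) (g * y) (g * z).
Proof.
move=> [l lK h]; exists [seq translate g B | B <- l]; first by rewrite size_map.
move=> B HB e s; rewrite -(translateVK g B); apply: map_f; apply: h.
- exact: (hs_inv hs).
- by rewrite !translate_mem !invgK.
- by rewrite sep_translate !invgK.
Qed.

Lemma sep_bounded n : exists C, forall g h, word_length_le S n (g^-1 * h) ->
  exists2 l : seq (set G), (size l <= C)%N & forall A, HH A -> sep A g h -> A \in l.
Proof.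
have fin1 g : exists l : seq (set G), forall A, HH A -> sep A 1 g -> A \in l.
  have [w hw <-] := word_exists genS g.
  elim: w hw => [|s w IH]; first by exists [::] => A _; rewrite wprod_nil /sep eqxx.
  move=> /word_cons[/(hs_sep_fin hs)[l1 hl1] /IH[l2 hl2]].
  exists (l1 ++ [seq translate s B | B <- l2]) => A HA.
  rewrite wprod_cons mem_cat => /(@sep_trans _ _ s)[/hl1->//|h].
  rewrite -(translateVK s A) map_f ?orbT //; apply: hl2; first exact: (hs_inv hs).
  by rewrite sep_translate invgK mulg1.
have [B hB] := ball_finite finS n.
have [C hC] : exists C, forall g, g \in B -> exists2 l : seq (set G), (size l <= C)%N &
    forall A, HH A -> sep A 1 g -> A \in l.
  elim: B {hB} => [|g B [C hC]]; first by exists 0%N.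
  have [l hl] := fin1 g; exists (size l + C)%N => h.
  rewrite inE => /orP[/eqP->|/hC[l' lC hl']]; first by exists l => //; rewrite leq_addr.
  by exists l' => //; rewrite (leq_trans lC) ?leq_addl.
exists C => g h /hB/hC[l lC hl]; exists [seq translate g A | A <- l].
  by rewrite size_map.
move=> A HA e; rewrite -(translateVK g A) map_f //; apply: hl; first exact: (hs_inv hs).
by rewrite sep_translate !invgK mulg1 mulVKg.
Qed.

(** A geodesic that left the side of its endpoints and came back could be shortened by [hs_fold]. *)
Lemma geodesic_sep A x w1 w2 : HH A -> geodesic S (w1 ++ w2) ->
  (x \in A) = (x * wprod w1 * wprod w2 \in A) -> (x * wprod w1 \in A) = (x \in A).
Proof.
move=> HA [/word_cat[h1 h2] hm] e; apply/eqP; apply: contraT => ne.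
have [|||||w [hw lw ew]] := @hs_fold hs (translate x^-1 A) w1 w2; rewrite /sep ?translate_mem
  ?invgK ?mulg1 ?mulgA //; first exact: (hs_inv hs).
- by rewrite eq_sym.
- by have := hm w hw; rewrite size_cat leqNgt lw wprod_cat => /(_ ew).
Qed.

(** Each letter crosses some wall, and by [geodesic_sep] a geodesic does not cross a wall again, so
    the letters yield distinct half-spaces. *)
Lemma geodesic_seps w x : geodesic S w -> exists l : seq (set G),
  [/\ uniq l, size l = size w & forall A, A \in l -> HH A /\ sep A x (x * wprod w)].
Proof.
elim: w x => [|s w IH] x gw; first by exists [::].
have [l [ul sl hl]] := IH (x * s) (geodesic_catr (gw : geodesic S ([:: s] ++ w))).
have [hw _] := gw; have /word_cons[ss _] := hw.
have [|A HA sA] := @hs_sep_ex hs s ss.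
  move=> s1; have [_ /(_ w)] := gw; rewrite wprod_cons s1 mul1g /= ltnn.
  by move=> h; have := h (proj2 (iffLR (word_cons _ _ _) hw)) erefl.
have key B : HH B -> (x \in B) = (x * s * wprod w \in B) -> (x * s \in B) = (x \in B).
  move=> HB; have := @geodesic_sep B x [:: s] w HB gw.
  by rewrite wprod_cons wprod_nil mulg1.
pose A' := translate x A.
have HA' : HH A' by exact: (hs_inv hs).
have sA' : sep A' x (x * s) by rewrite sep_translate mulVg mulKg.
exists (A' :: l); rewrite /= sl ul andbT; split=> //.
  apply/negP => /hl[_]; rewrite /sep => ne.
  have : (x \in A') = (x * s * wprod w \in A').
    by move: sA' ne; rewrite /sep; case: (_ \in _) (_ \in _) (_ \in _) => [] [] [].
  by move=> /(key _ HA') e; move: sA'; rewrite /sep e eqxx.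
move=> B; rewrite inE wprod_cons mulgA => /orP[/eqP->|/hl[HB sB]]; split=> //.
  by apply: contraTN sA' => /eqP/(key _ HA') e; rewrite /sep e eqxx.
by apply: contraTN sB => /eqP e; rewrite /sep (key _ HB e) e eqxx.
Qed.

Lemma wlen_of_sep (l : seq (set G)) x y :
  (forall A, HH A -> sep A x y -> A \in l) -> word_length_le S (size l) (x^-1 * y).
Proof.
move=> h; have [w gw e] := geodesic_exists genS (x^-1 * y).
have [l' [ul sl hl]] := geodesic_seps x gw.
rewrite -e; apply: wlen_mono (wlen_word gw.1); rewrite -sl.
by apply: uniq_leq_size => // A /hl[HA]; rewrite e mulVKg; exact: h.
Qed.

End Halfspaces.

Section MultiplicativeMaps.
Variables (G H : groupType) (f : G -> H).
Hypothesis fM : {morph f : x y / x * y}.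

Lemma morph_mul1 : f 1 = 1.
Proof. by apply: (mulgI (f 1)); rewrite -fM !mulg1. Qed.

Lemma morph_mulV x : f x^-1 = (f x)^-1.
Proof. by apply: (mulgI (f x)); rewrite -fM !mulgV morph_mul1. Qed.

End MultiplicativeMaps.

(** * The rigidity criterion *)

Section Rigidity.
Variables (G : groupType) (S : set G) (HH : set (set G)).
Hypothesis hs : halfspace_system S HH.
Variables (phi : {multiplicative G -> G}) (psi : G -> G).
Hypotheses (phiK : cancel phi psi) (psiK : cancel psi phi).
Implicit Types (A B : set G) (r x p u : G).

Let finS := hs_finite hs.
Let genS := hs_gen hs.
Let phiM : {morph phi : x y / x * y}. Proof. exact: gmulfM. Qed.
Let psiM : {morph psi : x y / x * y}. Proof. exact: can2_gmulfM phiK psiK. Qed.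

(* [r] stands for an isometry whose coarse fixed set is the wall bounding [A];
   the image of this set under [phi] is required to be coarsely convex. *)
Record rigid_wall A r : Prop := RigidWall {
  rw_cross : exists D, forall u s, step S s -> sep A u (u * s) ->
    word_length_le S D (u^-1 * r * u);
  rw_near : forall D, exists R, forall x, word_length_le S D (x^-1 * r * x) ->
    exists2 u, word_length_le S R (x^-1 * u) & sep A u x;
  rw_convex : forall D K, exists D', forall q q' p,
    word_length_le S D (q^-1 * phi r * q) ->
    word_length_le S D (q'^-1 * phi r * q') ->
    near_interval HH K q q' p -> word_length_le S D' (p^-1 * phi r * p) }.

(** A half-space separating a point of a geodesic from its end [p] also separates the start from
    [p]. Hence moving [a] and [b] along geodesics towards [p] creates no new exceptions. *)
Lemma near_interval_geodesic K a b (u1 u2 w1 w2 : seq G) p :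
  geodesic S (u1 ++ u2) -> geodesic S (w1 ++ w2) ->
  p = a * wprod u1 * wprod u2 -> p = b * wprod w1 * wprod w2 ->
  near_interval HH K a b p -> near_interval HH K (a * wprod u1) (b * wprod w1) p.
Proof.
move=> gu gw pu pw [l lK h]; exists l => // B HB e sB.
have := geodesic_sep hs (x := a) HB gu; have := geodesic_sep hs (x := b) HB gw.
rewrite -pu -pw; move: e sB (h B HB); rewrite /sep.
by do 5!case: (_ \in B) => //=; intuition.
Qed.

(** The geodesics from [phi a] and [phi b] to [phi p] both have to pass the image of the wall, at
    points of small displacement for [phi r]. Quasi-convexity gives small displacement at [phi p],
    and [psi] carries this back to [p]. *)
Lemma rigid_wall_separates A r K : rigid_wall A r -> exists R, forall a b p,
  near_interval HH K (phi a) (phi b) (phi p) ->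
  (a \in A) = (b \in A) -> sep A a p ->
  exists2 u, word_length_le S R (p^-1 * u) & sep A u p.
Proof.
move=> [[D hD] h2 h3].
have [L hL] := wlen_map genS finS psi 1.
have [D1 hD1] := wlen_map genS finS phi (L + D + L).
have [D' hD'] := h3 D1 K.
have [D'' hD''] := wlen_map genS finS psi D'.
have [R hR] := h2 D''.
have cross a p : sep A a p -> exists w1 w2, [/\ geodesic S (w1 ++ w2),
    phi p = phi a * wprod w1 * wprod w2 &
    word_length_le S D1 ((phi a * wprod w1)^-1 * phi r * (phi a * wprod w1))].
  move=> sA; have [w gw ew] := geodesic_exists genS ((phi a)^-1 * phi p).
  have [|w1 [s [w2 [e h h']]]] := first_change (w := w) (x := phi a) (f := fun g => psi g \in A).
    by rewrite ew mulVKg !phiK eq_sym.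
  have [hw _] := gw; move: hw; rewrite e => /word_cat[_ /word_cons[ss _]].
  exists w1, (s :: w2); split; rewrite -?e //.
    by rewrite -mulgA -wprod_cat -e ew mulVKg.
  set q := _ * _ in h h' *.
  (* The image under [psi] of a path can jump: neighbours are joined by a word of length at most
     [L], and the crossing of [A] is located inside that word. Going there and back accounts for
     [L + D + L]. *)
  have [v vL [hv ev]] := hL s (wlen_step ss).
  have [|v1 [t [v2 [ev' h1 h1']]]] := first_change (w := v) (x := psi q) (f := fun g => g \in A).
    by rewrite /wprod -ev -psiM h.
  move: hv vL; rewrite ev' => /word_cat[hv1 /word_cons[st _]].
  rewrite size_cat => vL.
  have := hD (psi q * wprod v1) t st; rewrite /sep h1 eq_sym h1' => /(_ isT) hDq.
  have := @wlen_conj _ S L D (psi q) (psi q * wprod v1) r; rewrite mulKg.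
  have lv1 : word_length_le S L (wprod v1).
    by apply: wlen_mono (wlen_word hv1); rewrite (leq_trans _ vL) ?leq_addr.
  move=> /(_ lv1 hDq)/hD1.
  by rewrite !phiM (morph_mulV phiM) psiK.
exists R => a b p nab eab sap.
have [u1 [u2 [gu pu hu]]] := cross _ _ sap.
have [|w1 [w2 [gw pw hw]]] := cross b p; first by rewrite /sep -eab.
have := hD' _ _ _ hu hw (near_interval_geodesic gu gw pu pw nab).
move=> /hD''; rewrite !psiM (morph_mulV psiM) !phiK => /hR[u uR su].
by exists u.
Qed.

Variable mu : G -> G -> G -> G.

Theorem rigid_walls_fixed (K : nat) (Q : seq (set G * G)) :
  (forall a b c, [/\ near_interval HH K a b (mu a b c),
    near_interval HH K b c (mu a b c) & near_interval HH K a c (mu a b c)]) ->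
  (forall A, HH A -> exists2 q, q \in Q & exists g, A = translate g q.1) ->
  (forall q, q \in Q -> rigid_wall q.1 q.2) ->
  same_coarse_median_structure (aut_act phi psi mu) mu.
Proof.
move=> hmu cover rigid; exists S; split=> //.
have [R hR] : exists R, forall A a b p, HH A ->
    near_interval HH K (phi a) (phi b) (phi p) ->
    (a \in A) = (b \in A) -> sep A a p ->
    exists2 u, word_length_le S R (p^-1 * u) & sep A u p.
  have [R hR] : exists R, forall q, q \in Q -> forall a b p,
      near_interval HH K (phi a) (phi b) (phi p) ->
      (a \in q.1) = (b \in q.1) -> sep q.1 a p ->
      exists2 u, word_length_le S R (p^-1 * u) & sep q.1 u p.
    elim: Q rigid {cover} => [|q Q' IH] rigid; first by exists 0%N.
    have [|R hR] := IH; first by move=> q' q'Q; apply: rigid; rewrite inE q'Q orbT.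
    have [|R' hR'] := @rigid_wall_separates q.1 q.2 K.
      by apply: rigid; rewrite inE eqxx.
    exists (maxn R R') => q'; rewrite inE => /orP[/eqP->|/hR {}hR] a b p nab eab sab.
      have [u hu su] := hR' a b p nab eab sab; exists u => //.
      by apply: wlen_mono hu; exact: leq_maxr.
    have [u hu su] := hR a b p nab eab sab; exists u => //.
    by apply: wlen_mono hu; exact: leq_maxl.
  exists R => A a b p HA nab eab sab.
  have [q qQ [g eA]] := cover A HA; rewrite {}eA in eab sab *.
  have [|||u hu su] := hR q qQ (g^-1 * a) (g^-1 * b) (g^-1 * p).
  - by rewrite !phiM; exact: (near_interval_translate hs).
  - by rewrite -!translate_mem.
  - by rewrite -sep_translate.
  exists (g * u); last by rewrite sep_translate mulKg.
  by move: hu; rewrite !mulgE.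
have [Cs hCs] := sep_bounded hs R.
have [B hB] := ball_finite finS R.
(* Each pair among the three points contributes [K] exceptions; the last term counts the half-spaces
   separating [p] from a point at distance at most [R]. *)
pose C := (K + (K + (K + size B * Cs)))%N.
have key a b c : word_length_le S C
    ((mu (psi a) (psi b) (psi c))^-1 * psi (mu a b c)).
  set m := mu _ _ _; set p := psi _.
  have [nab nbc nac] := hmu (psi a) (psi b) (psi c).
  have [pab pbc pac] : [/\ near_interval HH K (phi (psi a)) (phi (psi b)) (phi p),
      near_interval HH K (phi (psi b)) (phi (psi c)) (phi p) &
      near_interval HH K (phi (psi a)) (phi (psi c)) (phi p)].
    by rewrite !psiK; exact: hmu.
  have [l lC hl] : exists2 l : seq (set G), (size l <= size B * Cs)%N &
      forall w A, w \in B -> HH A -> word_length_le S R w ->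
        sep A (p * w) p -> A \in l.
    elim: B {hB C} => [|w B' [l lC hl]]; first by exists [::].
    have [hw|hw] := pselect (word_length_le S R w); last first.
      exists l => [|w' A]; first by rewrite (leq_trans lC) // leq_mul.
      by rewrite inE => /orP[/eqP->//|]; exact: hl.
    have [|l' lC' hl'] := hCs p (p * w); first by rewrite mulKg.
    exists (l' ++ l) => [|w' A]; first by rewrite size_cat mulSn leq_add.
    rewrite inE mem_cat => /orP[/eqP->|w'B] HA hw' sA; last by rewrite (hl w') ?orbT.
    by rewrite hl' // sepC.
  have sep_l x y A : HH A -> near_interval HH K (phi x) (phi y) (phi p) ->
      (x \in A) = (y \in A) -> sep A x p -> A \in l.
    move=> HA nxy exy /(hR A x y p HA nxy exy)[u hu su].
    by apply: (hl (p^-1 * u)) => //; [exact: hB|rewrite mulVKg].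
  case: nab nbc nac => [l1 L1 h1] [l2 L2 h2] [l3 L3 h3].
  have : word_length_le S (size (l1 ++ l2 ++ l3 ++ l)) (m^-1 * p).
    apply: (wlen_of_sep hs) => A HA; rewrite !mem_cat.
    (* Two of the three points lie on the same side of [A]. So [A] separates them either from [m],
       as an exception to the interval, or from [p], and then [p] is near the wall. *)
    have agree (x y z : bool) : [\/ x = y, y = z | x = z].
      by case: x y z => [] [] []; constructor.
    move=> smp; have split_at x := @sep_trans _ A m x p smp.
    case: (agree (psi a \in A) (psi b \in A) (psi c \in A)) => e.
    - case: (split_at (psi a)); first by rewrite sepC => /(h1 A HA e)->.
      by move=> /(sep_l _ _ A HA pab e)->; rewrite !orbT.
    - case: (split_at (psi b)); first by rewrite sepC => /(h2 A HA e)->; rewrite orbT.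
      by move=> /(sep_l _ _ A HA pbc e)->; rewrite !orbT.
    - case: (split_at (psi a)); first by rewrite sepC => /(h3 A HA e)->; rewrite !orbT.
      by move=> /(sep_l _ _ A HA pac e)->; rewrite !orbT.
  by apply: wlen_mono; rewrite !size_cat !leq_add.
have [C' hC'] := wlen_map genS finS phi C.
exists C' => a b c; have := hC' _ (key a b c).
by rewrite phiM (morph_mulV phiM) psiK.
Qed.

End Rigidity.

(** * Cube complexes with walls *)

Lemma count_lt (T : eqType) (p q : pred T) x (s : seq T) :
  subpred p q -> x \in s -> q x -> ~~ p x -> (count p s < count q s)%N.
Proof.
move=> pq + qx px; elim: s => //= y s IH; rewrite inE => /orP[/eqP<-|/IH h].
  by rewrite qx (negPf px) add0n add1n ltnS sub_count.
rewrite -addnS leq_add //; by have := pq y; case: (p y) => // ->.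
Qed.

Lemma exists_minimal (T : eqType) (f : T -> nat) x (s : seq T) :
  x \in s -> exists2 y, y \in s & forall z, z \in s -> (f y <= f z)%N.
Proof.
move=> xs; have ex : exists n, has (fun y => f y == n) s.
  by exists (f x); apply/hasP; exists x.
have [n /hasP[y ys /eqP <-] hn] := ex_minnP ex.
by exists y => // z zs; apply: hn; apply/hasP; exists z.
Qed.

Definition majority (a b c : bool) := if a == b then a else c.

Section WallGraph.
Variables (T : choiceType) (X : cube_complex T) (I : eqType) (sg : T -> I -> bool).
Implicit Types (x y z m : T) (i j : I).

(* [sg x i] records the side of the wall [i] on which [x] lies. *)
Record wall_graph : Prop := WallGraph {
  wg_adj : forall x y, vertex X x -> adjacent X x y -> vertex X y /\
    exists i, forall j, sg x j != sg y j -> j = i;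
  wg_flip : forall x y, vertex X x -> vertex X y -> x <> y ->
    exists z i, [/\ vertex X z, adjacent X x z, sg x i != sg y i,
      sg z i = sg y i & forall j, j != i -> sg z j = sg x j];
  wg_fin : forall x y, vertex X x -> vertex X y ->
    exists l : seq I, forall i, sg x i != sg y i -> i \in l;
  wg_maj : forall x y z, vertex X x -> vertex X y -> vertex X z ->
    exists2 m, vertex X m & forall i, sg m i = majority (sg x i) (sg y i) (sg z i) }.

Hypothesis wg : wall_graph.

Lemma walk_walls n x y : vertex X x -> walk X n x y -> vertex X y /\
  exists2 l : seq I, (size l <= n)%N & forall i, sg x i != sg y i -> i \in l.
Proof.
elim: n x => [|n IH] x vx /=.
  by move=> <-; split=> //; exists [::] => // i; rewrite eqxx.
move=> [z /(wg_adj wg vx)[vz [i hi]] /(IH z vz)[vy [l ln hl]]]; split=> //.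
exists (i :: l) => // j hj; rewrite inE.
have [/hi->|/negPn/eqP e] := boolP (sg x j != sg z j); first by rewrite eqxx.
by rewrite hl ?orbT // -e.
Qed.

(** Each use of [wg_flip] removes one wall from those separating the current vertex from [y]. *)
Lemma walk_exists x y : vertex X x -> vertex X y -> exists2 l : seq I,
  uniq l /\ (forall i, (i \in l) = (sg x i != sg y i)) & walk X (size l) x y.
Proof.
move=> vx vy; have [l hl] := wg_fin wg vx vy.
pose l0 := undup [seq i <- l | sg x i != sg y i].
have ul : uniq l0 by exact: undup_uniq.
have el i : (i \in l0) = (sg x i != sg y i).
  by rewrite mem_undup mem_filter; apply/andP/idP => [[]//|h]; split=> //; exact: hl.
move: l0 ul el => {hl}l ul el; exists l => //.
elim: {l}(size l) {-2}l (leqnn (size l)) ul x vx el => [|n IH] l ln ul x vx el.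
  have l0 : l = [::] by case: l ln {ul el}.
  rewrite l0 /=; have [//|nxy] := pselect (x = y).
  by have [z [i [_ _]]] := wg_flip wg vx vy nxy; rewrite -el l0.
have [xy|nxy] := pselect (x = y).
  case: l ln ul el => [|i l] _ _ el; first by rewrite xy.
  by have := el i; rewrite inE eqxx xy eqxx.
have [z [i [vz az dxy zy zx]]] := wg_flip wg vx vy nxy.
have il : i \in l by rewrite el.
have sl : size l = (size (rem i l)).+1.
  by rewrite size_rem // prednK //; case: l il {ln ul el}.
rewrite sl; exists z => //; apply: IH => //.
- by rewrite -ltnS -sl.
- exact: rem_uniq.
move=> j; rewrite mem_rem_uniq // !inE; have [->|ji] := eqVneq j i.
  by rewrite zy eqxx.
by rewrite el zx.
Qed.

Lemma on_geodesicP x y m : vertex X x -> vertex X y -> on_geodesic X x y m <->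
  vertex X m /\ forall i, sg x i = sg y i -> sg m i = sg x i.
Proof.
move=> vx vy; split=> [[p [q [wp wq hmin]]]|[vm hm]].
  have [vm [l1 s1 h1]] := walk_walls vx wp; split=> // i exy.
  have [_ [l2 s2 h2]] := walk_walls vm wq.
  have [l [ul hl] wl] := walk_exists vx vy.
  apply/eqP; apply: contraT => ne.
  have i1 : i \in l1 by rewrite h1 // eq_sym.
  have i2 : i \in l2 by rewrite h2 // -exy.
  (* The wall [i] is crossed on the way to [m] and again afterwards. It can be deleted from both
     lists, so a walk shorter by two exists. *)
  have : (size l <= size (rem i l1 ++ rem i l2))%N.
    apply: uniq_leq_size => // j; rewrite hl => jxy.
    have ji : j != i by apply: contraNneq jxy => ->; rewrite exy.
    rewrite mem_cat.
    have [/h1 j1|/negPn/eqP e] := boolP (sg x j != sg m j).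
      have : j \in i :: rem i l1 by rewrite -(perm_mem (perm_to_rem i1)).
      by rewrite inE (negPf ji) => /= ->.
    have /h2 j2 : sg m j != sg y j by rewrite -e.
    have : j \in i :: rem i l2 by rewrite -(perm_mem (perm_to_rem i2)).
    by rewrite inE (negPf ji) /= => ->; rewrite orbT.
  rewrite size_cat !size_rem // leqNgt (leq_trans _ (hmin _ wl)) //.
  case: l1 i1 s1 {h1} => // a l1 _ /= s1; case: l2 i2 s2 {h2} => // b l2 _ /= s2.
  by rewrite (leq_trans _ (leq_add s1 s2)) // addnS ltnS addSn leqnSn.
have [l1 [u1 h1] w1] := walk_exists vx vm; have [l2 [u2 h2] w2] := walk_exists vm vy.
exists (size l1), (size l2); split=> // k /(walk_walls vx)[_ [l lk hl]].
rewrite -size_cat; apply: leq_trans lk; apply: uniq_leq_size.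
  rewrite cat_uniq u1 u2 andbT; apply/hasPn => i; rewrite h1 h2.
  apply: contraTN => /eqP; have := hm i.
  by case: (sg x i) (sg y i) (sg m i) => [] [] [] // ->.
move=> i; rewrite mem_cat h1 h2; have := hm i; have := hl i.
by case: (sg x i) (sg y i) (sg m i) => [] [] [] //= h h'; auto; move: (h' erefl).
Qed.

(** The vertex given by [wg_maj] lies on all three intervals, so the default value of [median] is
    not taken; conversely the three intervals determine every side. *)
Lemma median_majority x y z : vertex X x -> vertex X y -> vertex X z ->
  vertex X (median X x y z) /\
  forall i, sg (median X x y z) i = majority (sg x i) (sg y i) (sg z i).
Proof.
move=> vx vy vz; have [m0 vm0 hm0] := wg_maj wg vx vy vz.
rewrite /median; case: xgetP => [m -> [/on_geodesicP-/(_ vx vy)[vm h1]]|].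
  move=> /on_geodesicP-/(_ vy vz)[_ h2] /on_geodesicP-/(_ vx vz)[_ h3].
  split=> // i; have := h1 i; have := h2 i; have := h3 i; rewrite /majority.
  by case: (sg x i) (sg y i) (sg z i) => [] [] [] /= h h' h''; auto.
move=> /(_ m0)[]; split; apply/on_geodesicP => //; split=> // i;
  rewrite hm0 /majority; by case: (sg x i) (sg y i) (sg z i) => [] [] [].
Qed.

Lemma dist_le_walls n x y : vertex X x -> dist_le X n x y -> vertex X y /\
  exists2 l : seq I, (size l <= n)%N & forall i, sg x i != sg y i -> i \in l.
Proof.
move=> vx [k kn /(walk_walls vx)[vy [l lk hl]]]; split=> //.
by exists l => //; exact: leq_trans kn.
Qed.

End WallGraph.

(** * From medians in a wall graph to coarse intervals in the group *)

Section CoarseMedianWalls.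
Variables (G : groupType) (T : choiceType) (X : cube_complex T).
Variables (I : eqType) (sg : T -> I -> bool) (act : G -> T -> T) (iact : G -> I -> I).
Variables (HH : set (set G)) (v0 v : T) (mu : G -> G -> G -> G).
Hypothesis wg : wall_graph X sg.
Hypothesis act_vertex : forall g x, vertex X x -> vertex X (act g x).
Hypothesis act_walls : forall g x y i, vertex X x -> vertex X y ->
  sg (act g x) i != sg (act g y) i -> exists2 j, sg x j != sg y j & i = iact g j.
Hypothesis halfspace_walls : forall B, HH B ->
  exists i b, forall g, (g \in B) = (sg (act g v0) i == b).
Hypotheses (vv0 : vertex X v0) (vv : vertex X v).

Lemma coarse_median_near_interval : cubical_coarse_median X act v mu ->
  exists K, forall a b c, [/\ near_interval HH K a b (mu a b c),
    near_interval HH K b c (mu a b c) & near_interval HH K a c (mu a b c)].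
Proof.
move=> [n hn]; have [l0 hl0] := wg_fin wg vv vv0.
(* Replacing the base vertex [v] by [v0] affects at most [size l0] walls at each of [a], [b], [c]
   and [m]; the final [n] is the distance to the median. The factor 2 below counts the two sides of
   a wall. *)
pose N := (size l0 + (size l0 + (size l0 + (size l0 + n))))%N.
exists (2 * N)%N => a b c; set m := mu a b c.
have [va vb vc vm] : [/\ vertex X (act a v), vertex X (act b v), vertex X (act c v)
    & vertex X (act m v)] by split; exact: act_vertex.
have [_ [l1 s1 h1]] := dist_le_walls wg vm (hn a b c).
have [_ hmed] := median_majority wg va vb vc.
pose l := [seq iact a i | i <- l0] ++ [seq iact b i | i <- l0] ++
  [seq iact c i | i <- l0] ++ [seq iact m i | i <- l0] ++ l1.
have base g i : i \notin [seq iact g j | j <- l0] -> sg (act g v) i = sg (act g v0) i.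
  move=> h; apply/eqP; apply: contraNT h => /act_walls[]// j jl ->.
  by apply: map_f; exact: hl0.
have hl i : i \notin l ->
    sg (act m v0) i = majority (sg (act a v0) i) (sg (act b v0) i) (sg (act c v0) i).
  rewrite !mem_cat !negb_or => /and5P[/base<- /base<- /base<- /base<- il1].
  by rewrite -hmed; apply/eqP; apply: contraNT il1; exact: h1.
pose L := flatten [seq [:: [set g | sg (act g v0) i == true];
                          [set g | sg (act g v0) i == false]] | i <- l].
have sL : (size L <= 2 * N)%N.
  have -> : (size L = 2 * size l)%N.
    by rewrite /L; elim: (l) => //= i l' ->; rewrite mulnS.
  by rewrite leq_mul2l /= !size_cat !size_map !leq_add2l.
have main x y : (forall i, i \notin l -> sg (act x v0) i = sg (act y v0) i ->
    sg (act m v0) i = sg (act x v0) i) -> near_interval HH (2 * N) x y m.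
  move=> hxy; exists L => // B HB exy sxm; have [i [b0 hB]] := halfspace_walls HB.
  have il : i \in l.
    apply: contraT => /hxy; move: exy sxm; rewrite /sep !hB.
    case: (sg (act x v0) i) (sg (act y v0) i) (sg (act m v0) i) b0 {hB}
      => [] [] [] [] //= _ _ h; by have := h erefl.
  have -> : B = [set g | sg (act g v0) i == b0].
    by apply/predeqP => g; rewrite /= -hB inE.
  apply/flattenP; eexists; first by apply/mapP; exists i.
  by case: b0 {hB}; rewrite !inE eqxx ?orbT.
split; apply: main => i /hl->; rewrite /majority;
  by case: (sg (act a v0) i) (sg (act b v0) i) (sg (act c v0) i) => [] [] [].
Qed.

End CoarseMedianWalls.

(** * Coxeter groups *)

Section ParityGroup.
Variable W : groupType.

(* The semidirect product of [W] with the group of functions from [W] to Z/2. *)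
Definition parity_group : Type := ((W -> bool) * W)%type.

HB.instance Definition _ := Choice.copy parity_group ((W -> bool) * W)%type.

Implicit Types p q r : parity_group.

Let pone : parity_group := (fun=> false, 1).
Let pinv p : parity_group := (fun x => p.1 (x * p.2^-1), p.2^-1).
Let pmul p q : parity_group := (fun x => p.1 x (+) q.1 (x * p.2), p.2 * q.2).

Let pmulA : associative pmul.
Proof.
move=> p q r; congr pair; rewrite /= ?mulgA //.
by apply/funext => x; rewrite addbA mulgA.
Qed.
Let pmul1g : left_id pone pmul.
Proof. by case=> f w; congr pair; rewrite /= ?mul1g //; apply/funext => x; rewrite mulg1. Qed.
Let pmulg1 : right_id pone pmul.
Proof. by case=> f w; congr pair; rewrite /= ?mulg1 //; apply/funext => x; rewrite addbF. Qed.
Let pmulVg : left_inverse pone pinv pmul.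
Proof.
by case=> f w; congr pair; rewrite /= ?mulVg //; apply/funext => x; rewrite addbb.
Qed.
Let pmulgV : right_inverse pone pinv pmul.
Proof.
case=> f w; congr pair; rewrite /= ?mulgV //; apply/funext => x.
by rewrite mulgK addbb.
Qed.

HB.instance Definition _ :=
  isGroup.Build parity_group pmulA pmul1g pmulg1 pmulVg pmulgV.

Lemma parity_mul1 p q x : (p * q).1 x = p.1 x (+) q.1 (x * p.2).
Proof. by []. Qed.

Lemma parity_mul2 p q : (p * q).2 = p.2 * q.2.
Proof. by []. Qed.

Lemma parity_exp p n :
  p ^+ n = (fun x => \big[addb/false]_(i < n) p.1 (x * p.2 ^+ i), p.2 ^+ n).
Proof.
elim: n => [|n IH].
  by congr pair; apply/funext => x; rewrite big_ord0.
rewrite expgSr IH; congr pair; last by rewrite expgSr.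
by apply/funext => x; rewrite big_ord_recr.
Qed.

End ParityGroup.

Section Alternating.
Variable W : groupType.
Implicit Types s t w : W.

Lemma alternatingD s t i j : alternating s t (i + j) =
  alternating s t i * (if odd i then alternating t s j else alternating s t j).
Proof.
elim: i s t => [|i IH] s t; first by rewrite mul1g.
by rewrite /= IH mulgA; case: (odd i).
Qed.

Lemma alternatingSr s t n :
  alternating s t n.+1 = alternating s t n * (if odd n then t else s).
Proof. by rewrite -addn1 alternatingD /= !mulg1. Qed.

Lemma alternating_double s t n : alternating s t n.*2 = (s * t) ^+ n.
Proof. by elim: n => //= n IH; rewrite expgS -IH mulgA. Qed.

Lemma alternating_rev s t n : s * s = 1 -> t * t = 1 ->
  alternating t s n * (if odd n then alternating t s n else alternating s t n) = 1.
Proof.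
move=> ss tt; elim: n => [|n IH]; first by rewrite /= mulg1.
have hr (x y : W) : y * y = 1 -> alternating t s n * y * (y * x) = alternating t s n * x.
  by move=> yy; rewrite !mulgA -(mulgA _ y y) yy mulg1.
have := alternatingSr t s n; move: IH; rewrite [odd n.+1]/=.
by case: (odd n) => /= IH e; rewrite {1}e hr.
Qed.

(** The relation is a closed path of length [2m], and the two words run along its two halves. *)
Lemma alternatingC s t m : s * s = 1 -> t * t = 1 -> (s * t) ^+ m = 1 ->
  alternating s t m = alternating t s m.
Proof.
move=> ss tt; rewrite -alternating_double -addnn alternatingD => h.
by apply: (mulIg (if odd m then alternating t s m else alternating s t m));
  rewrite h alternating_rev.
Qed.

End Alternating.

Lemma set2_inj (T : Type) (a b c d : T) : [set a; b] = [set c; d] ->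
  (a = c /\ b = d) \/ (a = d /\ b = c).
Proof.
move=> e; have ha : [set c; d] a by rewrite -e; left.
have hb : [set c; d] b by rewrite -e; right.
have hc : [set a; b] c by rewrite e; left.
have hd : [set a; b] d by rewrite e; right.
move: ha hb hc hd => /= [] -> [] -> [] + []; by intuition.
Qed.

Lemma image_set2 (T U : Type) (f : T -> U) a b : f @` [set a; b] = [set f a; f b].
Proof. by rewrite image_setU !image_set1. Qed.

(** * Reflections, walls and crossing parity *)

Section Coxeter.
Variables (W : groupType) (S : set W).
Hypothesis cox : coxeter_system S.
Implicit Types (s t r g w x y z : W) (u : seq W) (H : set (set W)) (E : set W).

Let genS : subgroup_gen S = setT. Proof. by case: cox. Qed.

Lemma cox_sq s : S s -> s * s = 1.
Proof. by case: cox => h _ _ /h[_ + _]; rewrite expg2. Qed.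

Lemma cox_inv s : S s -> s^-1 = s.
Proof. by move=> /cox_sq/mulg1_eq. Qed.

Lemma cox_step s : step S s <-> S s.
Proof. by split=> [[//|h]|]; [rewrite -(invgK s) cox_inv|left]. Qed.

Lemma cox_mulK s x : S s -> x * s * s = x.
Proof. by move=> Ss; rewrite -mulgA cox_sq // mulg1. Qed.

Lemma cox_ind (P : W -> Prop) : P 1 -> (forall w s, S s -> P w -> P (w * s)) ->
  forall w, P w.
Proof.
move=> P1 PS w; have [u hu <-] := word_exists genS w.
elim/last_ind: u hu => [|u s IH]; first by rewrite wprod_nil.
rewrite -cats1 => /word_cat[/IH Pu /word_cons[/cox_step Ss _]].
by rewrite wprod_cat wprod_cons wprod_nil mulg1; exact: PS.
Qed.

Lemma has_orderC s t m : S s -> S t -> has_order (s * t) m -> has_order (t * s) m.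
Proof.
move=> Ss St; have e : t * s = (s * t)^-1 by rewrite invgM !cox_inv.
move=> [m0 hm hmin]; split=> //; first by rewrite e expVgn hm invg1.
by move=> k k0 /eqP; rewrite e expVgn invg_eq1 => /eqP; exact: hmin.
Qed.

(** Around a 2m-gon the edges of [C] come in opposite pairs, so the number of edges of [C] on a path
    from [1] to [w], modulo 2, depends only on [w]. The parity group records this count together
    with the endpoint, and the presentation of [W] extends it from the generators. *)
Lemma parity_exists (C : set (set W)) :
  (forall E E', opposite_edges S E E' -> (C E <-> C E')) ->
  exists c : W -> bool, c 1 = false /\
    forall w s, S s -> c (w * s) = c w (+) `[< C [set w; w * s] >].
Proof.
move=> hC; pose f s : parity_group W := (fun x => `[< C [set x; x * s] >], s).
have rel s t m : S s -> S t -> has_order (s * t) m -> (f s * f t) ^+ m = 1.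
  move=> Ss St om; have [m0 em hm] := om.
  rewrite parity_exp parity_mul2 /= em; congr pair; apply/funext => x.
  pose F j := `[< C [set x * alternating s t j; x * alternating s t j.+1] >].
  have -> : \big[addb/false]_(i < m) (f s * f t).1 (x * (s * t) ^+ i) =
      \big[addb/false]_(j < m + m) F j.
    rewrite addnn; elim: (m) => [|n IH]; first by rewrite !big_ord0.
    rewrite doubleS !big_ord_recr /= IH -addbA; congr addb.
    by rewrite /F !alternatingSr /= odd_double /= alternating_double !mulgA.
  rewrite big_split_ord /=.
  (* The edges numbered [i] and [m + i] are opposite; when [s = t], the path runs back and forth
     along one edge. *)
  have -> : \big[addb/false]_(i < m) F (m + i)%N = \big[addb/false]_(i < m) F i.
    apply: eq_bigr => i _; rewrite /F.
    have [est|nst] := pselect (s = t).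
      have e1 : m = 1%N.
        apply/eqP; rewrite eqn_leq m0 andbT; apply: hm => //.
        by rewrite -est cox_sq.
      have -> : (i : nat) = 0%N by case: i => i /=; rewrite e1; case: i.
      by rewrite e1 /= -est !mulg1 cox_sq // mulg1 setUC.
    have op a b w : S a -> S b -> a <> b -> has_order (a * b) m ->
        `[< C [set x * (w * alternating a b m); x * (w * alternating a b m.+1)] >]
        = `[< C [set x * w; x * (w * a)] >].
      move=> Sa Sb ab oab; symmetry; apply/asbool_equiv_eq/hC.
      by exists (x * w), a, b, m; rewrite -!mulgA.
    rewrite addnC -addnS !alternatingD (alternatingSr s t i).
    case: (odd i); apply: op => //; last exact: has_orderC.
    by move=> e; apply: nst.
  by rewrite addbb.
have [_ _ /(_ _ f rel)[phi hphi]] := cox.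
have phiM : {morph phi : x y / x * y} by exact: gmulfM.
have phi2 w : (phi w).2 = w.
  elim/cox_ind: w => [|w s Ss IH]; first by rewrite (morph_mul1 phiM).
  by rewrite phiM parity_mul2 IH hphi.
exists (fun w => (phi w).1 1); split; first by rewrite (morph_mul1 phiM).
by move=> w s Ss; rewrite phiM parity_mul1 phi2 mul1g (hphi s Ss).
Qed.

Definition reflection t := exists w s, S s /\ t = w * s * w^-1.

Definition wall_of t : set (set W) :=
  [set E | coxeter_edge S E /\ exists x, E = [set x; t * x]].

Lemma wall_of_edge t w s : t * t = 1 -> S s ->
  wall_of t [set w; w * s] <-> t * w = w * s.
Proof.
move=> tt Ss; split=> [[_ [x e]]|e].
  by case: (set2_inj e) => -[-> ->//]; rewrite mulgA tt mul1g.
by split; [exists w, s|exists w; rewrite e].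
Qed.

Lemma reflection_sq t : reflection t -> t * t = 1.
Proof.
by move=> [w [s [Ss ->]]]; rewrite !mulgE cox_mulK // mulgV.
Qed.

Lemma reflection_gen s : S s -> reflection s.
Proof. by exists 1, s; rewrite invg1 mulg1 mul1g. Qed.

Lemma reflection_conj g t : reflection t -> reflection (g * t * g^-1).
Proof. by move=> [w [s [Ss ->]]]; exists (g * w), s; rewrite !mulgE. Qed.

Lemma reflectionP t : reflection t -> exists w s, S s /\ t * w = w * s.
Proof. by move=> [w [s [Ss ->]]]; exists w, s; rewrite mulgVK. Qed.

Lemma coxeter_edgeP x y : coxeter_edge S [set x; y] <-> exists2 s, S s & y = x * s.
Proof.
split=> [[w [s [Ss e]]]|[s Ss ->]]; last by exists x, s.
by exists s => //; case: (set2_inj e) => -[-> ->]; rewrite ?cox_mulK.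
Qed.

(** By [alternatingC] the alternating word of length [m] may start with either letter, so the
    identity [t * w = w * s] can be carried along it to the opposite edge. *)
Lemma wall_of_opposite t E E' : t * t = 1 -> opposite_edges S E E' ->
  (wall_of t E <-> wall_of t E').
Proof.
move=> tt [w [s [r [m [[Ss Sr _ [m0 em _]] [-> ->]]]]]].
rewrite wall_of_edge // alternatingSr mulgA wall_of_edge //; last by case: ifP.
rewrite -[_ * _ * (if _ then _ else _)]mulgA -alternatingSr /=.
rewrite (@alternatingC _ r s) ?cox_sq //; last first.
  by rewrite (_ : r * s = (s * r)^-1) ?expVgn ?em ?invg1 // invgM !cox_inv.
by rewrite !mulgA; split=> [->//|/mulIg].
Qed.

(** Crossings with the wall of [t] on a path from [1], counted modulo 2; for a reflection, the level
    sets are the two sides. The default value is not taken when [t * t = 1], by [parity_exists]. *)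
Definition parity t : W -> bool := xget (fun=> false)
  [set c : W -> bool | c 1 = false /\
    forall w s, S s -> c (w * s) = c w (+) (t * w == w * s)].

Lemma parityP t : t * t = 1 -> parity t 1 = false /\
  forall w s, S s -> parity t (w * s) = parity t w (+) (t * w == w * s).
Proof.
move=> tt; rewrite /parity; case: xgetP => [c -> //|h].
have [c [c1 cs]] := parity_exists (fun E E' => @wall_of_opposite t E E' tt).
case: (h c); split=> // w s Ss; rewrite cs //; congr addb.
by apply/asboolP/eqP; rewrite wall_of_edge.
Qed.

Lemma parity1 t : t * t = 1 -> parity t 1 = false.
Proof. by move=> /parityP[]. Qed.

Lemma parityS t w s : t * t = 1 -> S s ->
  parity t (w * s) = parity t w (+) (t * w == w * s).
Proof. by move=> /parityP[_]; apply. Qed.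

Lemma parity_translate g t x : t * t = 1 ->
  parity (g * t * g^-1) (g * x) = parity t x (+) parity (g * t * g^-1) g.
Proof.
move=> tt; have tt' : g * t * g^-1 * (g * t * g^-1) = 1.
  by rewrite !mulgE -(mulgA _ t t) tt !mulgE.
elim/cox_ind: x => [|x s Ss IH]; first by rewrite mulg1 parity1.
rewrite mulgA (parityS _ tt' Ss) (parityS _ tt Ss) IH -!addbA; congr addb.
rewrite addbC; congr addb; rewrite mulgA mulgVK -!mulgA.
by rewrite (inj_eq (mulgI g)).
Qed.

(** By [parity_translate], applying [t] changes the parity by a constant, and an edge inverted by
    [t] shows that the constant is 1. *)
Lemma parity_reflection t x : reflection t -> parity t (t * x) = ~~ parity t x.
Proof.
move=> rt; have tt := reflection_sq rt.
have h y : parity t (t * y) = parity t y (+) parity t t.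
  by have := parity_translate t y tt; rewrite mulgK.
have [w [s [Ss e]]] := reflectionP rt.
have := h w; rewrite {1}e parityS // e eqxx h.
by case: (parity t w) (parity t t) => [] [] //=; case: (parity t x).
Qed.

(* Applying [t] to the part of the word before its crossing with the wall of [t]
   removes the letter of the crossing. *)
Lemma fold_word t u x : reflection t -> word S u ->
  parity t (x * wprod u) != parity t x ->
  exists u', [/\ word S u', (size u' < size u)%N & x * wprod u' = t * x * wprod u].
Proof.
move=> rt; have tt := reflection_sq rt.
elim: u x => [|s u IH] x; first by rewrite wprod_nil mulg1 eqxx.
move=> /word_cons[/[dup] ss /cox_step Ss hu]; rewrite wprod_cons mulgA.
have := parityS x tt Ss; have [e _ _|_ e] := eqVneq (t * x) (x * s).
  by exists u; rewrite !mulgA e cox_mulK.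
rewrite addbF in e; rewrite -e => /(IH _ hu)[u' [hu' su' eu']].
exists (s :: u'); split=> //; first exact/word_cons.
by rewrite wprod_cons mulgA eu' !mulgA.
Qed.

(** A class [C] of opposite edges stays inside [wall_of t] by [wall_of_opposite]. Conversely, [C] is
    invariant under [t], so [t] changes the crossing parity of [C] by a constant. The constant is
    read off at the starting edge and then forces every edge inverted by [t] to be in [C]. *)
Lemma wallP H : wall S H <-> exists2 t, reflection t & H = wall_of t.
Proof.
have class w s : S s -> [set E' | clos_refl_sym_trans _ (opposite_edges S)
    [set w; w * s] E'] = wall_of (w * s * w^-1).
  move=> Ss; move tE : (w * s * w^-1) => t; set C := [set E' | _].
  have rt : reflection t by rewrite -tE; exists w, s.
  have tt := reflection_sq rt; have tw : t * w = w * s by rewrite -tE mulgVK.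
  have oppt E E' : opposite_edges S E E' ->
      opposite_edges S (( *%g t) @` E) (( *%g t) @` E').
    move=> [x [a [b [m [h [-> ->]]]]]]; exists (t * x), a, b, m; split=> //.
    by rewrite !image_set2 !mulgA.
  have Ct E : C E -> C (( *%g t) @` E).
    rewrite /C /= => h; have : clos_refl_sym_trans _ (opposite_edges S)
        (( *%g t) @` [set w; w * s]) (( *%g t) @` E).
      elim: h => [E1 E2 /oppt|E1|E1 E2 _|E1 E2 E3 _ h1 _].
      - exact: rst_step.
      - exact: rst_refl.
      - exact: rst_sym.
      - exact: rst_trans h1.
    by rewrite image_set2 mulgA tw cox_mulK // setUC.
  have Copp E E' : opposite_edges S E E' -> (C E <-> C E').
    move=> h; split=> k; apply: rst_trans k _; first exact: rst_step.
    exact/rst_sym/rst_step.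
  apply/seteqP; split=> E.
    have : wall_of t [set w; w * s] by apply/wall_of_edge.
    move=> h0 h; suff : wall_of t [set w; w * s] <-> wall_of t E by move=> [+ _]; apply.
    elim: h {h0} => // [E1 E2 /(wall_of_opposite tt)//|E1 E2 _ ->//|].
    by move=> E1 E2 E3 _ -> _ ->.
  move=> [[y [s' [Ss' ->]]] hE].
  have ty : t * y = y * s' by apply/wall_of_edge => //; split=> //; exists y, s'.
  have [c [c1 cs]] := parity_exists Copp.
  have ct z : c (t * z) = c z (+) c t.
    elim/cox_ind: z => [|z a Sa IH]; first by rewrite mulg1 c1.
    rewrite mulgA (cs (t * z) a Sa) (cs z a Sa) IH -!addbA; congr addb.
    rewrite addbC; congr addb.
    apply/asbool_equiv_eq; split=> /Ct; rewrite image_set2 !mulgA ?tt ?mul1g //.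
  have /eqP : c (t * w) = c (w * s) by rewrite tw.
  rewrite ct cs // (_ : `[< C [set w; w * s] >] = true); last first.
    by apply/asboolP; exact: rst_refl.
  rewrite (inj_eq (@addbI _)) => /eqP ctt.
  have /eqP : c (t * y) = c (y * s') by rewrite ty.
  by rewrite ct cs // ctt (inj_eq (@addbI _)) eq_sym => /eqP/asboolP.
split=> [[E [[w [s [Ss ->]]] ->]]|[t [w [s [Ss ->]]] ->]].
  by exists (w * s * w^-1); [exists w, s|rewrite class].
by exists [set w; w * s]; split; [exists w, s|rewrite class].
Qed.

End Coxeter.

(** * Sides of walls, and involutions of a Coxeter group *)

Section CoxeterHalfspaces.
Variables (W : groupType) (S : set W).
Hypotheses (cox : coxeter_system S) (finS : finite_set S).
Implicit Types (s t r g h w x y z : W) (u : seq W) (H : set (set W)) (A E : set W).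

Let genS : subgroup_gen S = setT. Proof. by case: cox. Qed.

Local Notation parity := (parity S).
Local Notation reflection := (reflection S).
Local Notation wall_of := (wall_of S).

Lemma coxeter_sideE t x : reflection t ->
  [set y | clos_refl_trans W
    (fun x y => coxeter_edge S [set x; y] /\ ~ wall_of t [set x; y]) x y]
  = [set y | parity t x = parity t y].
Proof.
move=> rt; have tt := reflection_sq cox rt; set R := (fun x y => _ /\ _).
have Rt a b : R a b -> R (t * a) (t * b).
  rewrite /R => -[/(coxeter_edgeP cox)[s Ss ->] h].
  split; first by apply/(coxeter_edgeP cox); exists s; rewrite ?mulgA.
  move: h; rewrite !mulgA !wall_of_edge // => h k; apply: h.
  by apply: (mulgI t); rewrite k mulgA.
have crt a b : clos_refl_trans W R a b -> clos_refl_trans W R (t * a) (t * b).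
  elim=> [c d /Rt|c|c d e _ h1 _]; [exact: rt_step|exact: rt_refl|exact: rt_trans h1].
apply/seteqP; split=> y.
  elim=> // [a b []|a b c _ -> _ -> //] /(coxeter_edgeP cox)[s Ss ->].
  by rewrite /= wall_of_edge // (parityS cox _ tt Ss) => /eqP/negPf->; rewrite addbF.
(* At each crossing the rest of the path is reflected by [t]. The path so kept on the side of its
   start ends at the original endpoint or at its mirror image, according to the parity. *)
have main u a : word S u -> clos_refl_trans W R a
    (if parity t a == parity t (a * wprod u) then a * wprod u else t * a * wprod u).
  elim: u a => [|s u IH] a; first by rewrite wprod_nil !mulg1 eqxx => _; exact: rt_refl.
  move=> /word_cons[/(cox_step cox) Ss /(IH (a * s))].
  rewrite wprod_cons !mulgA (parityS cox _ tt Ss); have [e|ne] := eqVneq (t * a) (a * s).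
    move=> /crt; rewrite -{1}e mulgA tt mul1g addbT.
    by case: (parity t a) (parity t (a * s * wprod u)) => [] [];
      rewrite /= !mulgA ?tt ?mul1g.
  rewrite addbF; have st : clos_refl_trans W R a (a * s).
    apply: rt_step; split; first by apply/(coxeter_edgeP cox); exists s.
    by rewrite wall_of_edge //; exact/eqP.
  exact: rt_trans st.
have [u hu eu] := word_exists genS (x^-1 * y).
by move=> /= e; have := main u x hu; rewrite eu mulVKg e eqxx.
Qed.

Lemma side_wallP t A : reflection t ->
  side S (wall_of t) A <-> exists b, A = [set y | parity t y = b].
Proof.
move=> rt; split=> [[w ->]|[b ->]]; rewrite /side.
  by rewrite coxeter_sideE //; exists (parity t w); apply/predeqP => y /=; split=> ->.
have [e|ne] := eqVneq (parity t 1) b.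
  by exists 1; rewrite coxeter_sideE //; apply/predeqP => y /=; rewrite e; split=> ->.
exists (t * 1); rewrite coxeter_sideE // parity_reflection //.
apply/predeqP => y /=; move: ne.
by case: (parity t 1) (parity t y) b => [] [] [] //=; split.
Qed.

Definition coxeter_halfspaces : set (set W) :=
  [set A | exists t b, reflection t /\ A = [set y | parity t y == b]].

Lemma in_halfspace t b x : (x \in [set y | parity t y == b]) = (parity t x == b).
Proof. by apply/idP/idP; rewrite inE. Qed.

Lemma sep_halfspace t b x y :
  sep [set z | parity t z == b] x y = (parity t x != parity t y).
Proof. by rewrite /sep !in_halfspace; case: (parity t x) (parity t y) b => [] [] []. Qed.

Lemma parity_edge t x s : t * t = 1 -> S s -> (parity t x != parity t (x * s)) =
  (t * x == x * s).
Proof.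
by move=> tt Ss; rewrite (parityS cox _ tt Ss); case: (_ == _ * _); case: (parity t x).
Qed.

Lemma parity_gen t s : t * t = 1 -> S s -> (parity t 1 != parity t s) = (t == s).
Proof. by move=> tt Ss; have := parity_edge 1 tt Ss; rewrite mulg1 mul1g. Qed.

Lemma translate_halfspace g t b : reflection t ->
  translate g [set y | parity t y == b] =
  [set y | parity (g * t * g^-1) y == b (+) parity (g * t * g^-1) g].
Proof.
move=> rt; apply/predeqP => x; rewrite translateE /=.
have := parity_translate cox g (g^-1 * x) (reflection_sq cox rt); rewrite mulVKg => ->.
by rewrite (inj_eq (@addIb _)).
Qed.

Lemma coxeter_halfspace_system : halfspace_system S coxeter_halfspaces.
Proof.
split=> //.
- move=> g A [t [b [rt ->]]]; rewrite translate_halfspace //.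
  by exists (g * t * g^-1), (b (+) parity (g * t * g^-1) g); split=> //; exact: reflection_conj.
- move=> s /(cox_step cox) Ss; exists [:: [set y | parity s y == true];
    [set y | parity s y == false]] => A [t [b [rt ->]]].
  have tt := reflection_sq cox rt.
  rewrite sep_halfspace parity_gen // => /eqP->.
  by case: b; rewrite !inE eqxx ?orbT.
- move=> s /(cox_step cox) Ss _; have rs := reflection_gen Ss.
  exists [set y | parity s y == true]; first by exists s, true.
  by rewrite sep_halfspace parity_gen // (cox_sq cox).
move=> A w1 w2 [t [b [rt ->]]] h1 h2; rewrite sep_halfspace !in_halfspace => d e.
have tt := reflection_sq cox rt.
have [|u1 [hu1 su1 eu1]] := fold_word cox (x := 1) rt h1; first by rewrite mul1g eq_sym.
have [|u2 [hu2 su2 eu2]] := fold_word cox (x := t * wprod w1) rt h2.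
  rewrite -mulgA !parity_reflection //; move: d e.
  by case: (parity t 1) (parity t (wprod w1)) (parity t (wprod w1 * wprod w2)) b
    => [] [] [] [].
move: eu1 eu2; rewrite mul1g mulg1 => eu1 eu2.
exists (u1 ++ u2); split; first exact/word_cat.
  by rewrite size_cat (leq_trans _ (leq_add su1 (ltnW su2))) // addSn.
by rewrite wprod_cat eu1 eu2 !mulgA tt mul1g.
Qed.

Definition flipped g : set W :=
  [set t | reflection t /\ commute g t /\ forall x, parity t (g * x) = ~~ parity t x].

Lemma flipped_conj g h t : flipped g t -> flipped (h * g * h^-1) (h * t * h^-1).
Proof.
move=> [rt [gt gx]]; have tt := reflection_sq cox rt; split; last split.
- exact: reflection_conj.
- by rewrite /commute !mulgE -[h * g * t]mulgA gt mulgA.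
move=> x; have e y := parity_translate cox h (h^-1 * y) tt.
have := e x; have := e (h * g * h^-1 * x); rewrite !mulVKg => -> ->.
by rewrite -!mulgA mulKg gx addNb.
Qed.

Lemma flipped_gen g s : S s -> commute g s -> parity s g -> flipped g s.
Proof.
move=> Ss gs pg; have rs := reflection_gen Ss; have ss := cox_sq cox Ss.
split=> //; split=> // x; have := parity_translate cox g x ss.
have -> : g * s * g^-1 = s by rewrite gs mulgK.
by rewrite pg addbT.
Qed.

(* An involution of minimal length in its conjugacy class commutes with its
   descents, and lies in the parabolic subgroup they generate. *)
Lemma involution_flipped g : g * g = 1 -> subgroup_gen (flipped g) g.
Proof.
have [n] : exists n, word_length_le S n g.
  by have [w hw <-] := word_exists genS g; exists (size w); exact: wlen_word.
elim/ltn_ind: n g => n IH g gn gg.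
have gV : g^-1 = g by apply: mulg1_eq.
have [u [un [hu eu]]] : exists u, (size u <= n)%N /\ word S u /\ g = wprod u.
  by case: gn => u un [hu eu]; exists u.
(* A descent [s] not commuting with [g] makes [s * g * s] shorter by at least two letters:
   [fold_word] is applied on the left, then to the inverse word. *)
have [[s [Ss ps ns]]|hcomm] := pselect (exists s, [/\ S s, parity s g & s * g <> g * s]).
  have ss := cox_sq cox Ss; have sV := cox_inv cox Ss; have rs := reflection_gen Ss.
  have [|u1 [hu1 su1 eu1]] := fold_word cox (x := 1) rs hu.
    by rewrite mul1g -eu ps parity1.
  move: eu1; rewrite mul1g mulg1 -eu => eu1.
  have [|u2 [hu2 su2 eu2]] := fold_word cox (x := 1) rs (word_winv hu1).
    rewrite mul1g wprod_winv eu1 invgM gV sV parityS // ps parity1 //.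
    by move/eqP/negPf: ns => ->.
  move: eu2; rewrite mul1g mulg1 wprod_winv eu1 invgM gV sV => eu2.
  move: su2; rewrite size_winv => su2.
  have su2n : (size u2 < n)%N.
    by rewrite (leq_trans su2) // (leq_trans (ltnW su1)).
  have h2 : word_length_le S (size u2) (s * g * s).
    by rewrite -mulgA -eu2; exact: wlen_word.
  have h3 : s * g * s * (s * g * s) = 1.
    by rewrite !mulgA (cox_mulK cox) // -(mulgA s g g) gg mulg1.
  have e : s * (s * g * s) * s^-1 = g by rewrite sV !mulgA ss mul1g (cox_mulK cox).
  rewrite -{2}e; apply: subgroup_gen_conj (IH _ su2n _ h2 h3) => t ht.
  by apply: subgroup_gen_sub; have := flipped_conj s ht; rewrite e.
pose D := [set s | S s /\ parity s g].
have Dg s : D s -> commute g s.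
  move=> [Ss ps]; apply: contrapT => ns; apply: hcomm; exists s; split=> //.
  by move=> e; apply: ns.
have Dflip : subgroup_gen D `<=` subgroup_gen (flipped g).
  apply: (@smallest_sub _ _ _ (subgroup_gen (flipped g))).
    exact: subgroup_gen_subgroup.
  by move=> s Ds; apply: subgroup_gen_sub; apply: flipped_gen (Dg _ Ds) _; case: Ds.
have [D1 DM DV] := subgroup_gen_subgroup D.
have Dgen d : subgroup_gen D d -> commute g d.
  move=> /gen_word[w hw <-]; elim: w hw => [|s w IHw].
    by rewrite wprod_nil => _; exact: commute1.
  move=> /word_cons[ss /IHw hw]; rewrite wprod_cons; apply: commuteM hw.
  by case: ss => /Dg // /commuteV; rewrite invgK.
(* The element [a] of the subgroup generated by the descents is chosen so that [a^-1 * g] is as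
   short as possible; the aim is to show that this remainder is trivial. *)
pose P m := `[< exists2 a, subgroup_gen D a &
  exists2 w, word S w & wprod w = a^-1 * g /\ size w = m >].
have exP : exists m, P m.
  have [w hw ew] := word_exists genS (1^-1 * g).
  by exists (size w); apply/asboolP; exists 1 => //; exists w.
have [m /asboolP[a Da [w hw [ew <-]]] hmin] := ex_minnP exP.
have {}hmin c (w' : seq W) : subgroup_gen D c -> word S w' -> wprod w' = c^-1 * g ->
    (size w <= size w')%N.
  by move=> Dc hw' e; apply: hmin; apply/asboolP; exists c => //; exists w'.
case: w hw ew hmin => [|s w] hw ew hmin.
  apply: Dflip; suff -> : g = a by [].
  by apply: (mulgI a^-1); rewrite -ew wprod_nil mulVg.
move/word_cons: hw => [/(cox_step cox) Ss hw].
have ss := cox_sq cox Ss; have rs := reflection_gen Ss.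
have sV := cox_inv cox Ss.
set b := a^-1 * g in ew *.
have nDs : ~ subgroup_gen D s.
  move=> Ds; have := hmin (a * s) w (DM _ _ Da Ds) hw; rewrite /= ltnn.
  suff e : wprod w = (a * s)^-1 * g by move=> /(_ e).
  by rewrite invgM sV -mulgA -/b -ew wprod_cons mulgA ss mul1g.
have pb : parity s b.
  apply: contraT => /negPf pb.
  have [|u' [hu' su' eu']] := fold_word cox (x := s) rs hw.
    by rewrite -wprod_cons ew pb; have := parity_gen ss Ss; rewrite parity1 // eqxx.
  have := hmin a u' Da hu'; rewrite /= ltnNge ltnW //.
  suff e : wprod u' = a^-1 * g by move=> /(_ e).
  by rewrite -/b -ew wprod_cons; apply: (mulgI s); rewrite eu' mulgA.
have pg : parity s g = false.
  by apply/negP => pg; apply: nDs; exact: subgroup_gen_sub.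
have gba : g = b * a.
  by rewrite /b -mulgA (Dgen a Da) mulKg.
(* Now [s] is a descent of [b] but not of [g = b * a], so the path spelling [a] from [b] crosses the
   wall of [s] at some letter [d] of [D]. This makes [s] a conjugate by [b] of an element of the
   subgroup, which [b] normalizes because [g] centralizes it. *)
have [v hv ev] := gen_word Da.
have [|v1 [d [v2 [evv hv1' hd]]]] := first_change (w := v) (x := b) (f := parity s).
  by rewrite ev -gba pg pb.
case: nDs; move: hv; rewrite evv => /word_cat[hv1 /word_cons[hd' _]].
have Sd : S d.
  by case: hd' => -[Sd _] //; rewrite -(invgK d) (cox_inv cox).
have {}hd : s * (b * wprod v1) = b * wprod v1 * d.
  by apply/eqP; rewrite -parity_edge // eq_sym hv1'.
have Dv1 := word_gen hv1.
have Dd : subgroup_gen D d.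
  by case: hd' => /(@subgroup_gen_sub _ D)// /DV; rewrite invgK.
have [k Dk ->] : exists2 k, subgroup_gen D k & s = b * k * b^-1.
  exists (wprod v1 * d * (wprod v1)^-1); first exact: DM (DM _ _ Dv1 Dd) (DV _ Dv1).
  by rewrite !mulgE -hd !mulgE.
have -> : b * k * b^-1 = a^-1 * k * a.
  by rewrite /b !mulgE -[a^-1 * g * k]mulgA (Dgen k Dk) !mulgE.
exact: (DM _ _ (DM _ _ (DV _ Da) Dk) Da).
Qed.

End CoxeterHalfspaces.

(** * Quasi-convexity of walls in a Coxeter group *)

Section CoxeterRigidity.
Variables (W : groupType) (S : set W).
Hypotheses (cox : coxeter_system S) (finS : finite_set S).
Implicit Types (s t r g h w x y z : W) (u v : seq W) (A B : set W).

Let genS : subgroup_gen S = setT. Proof. by case: cox. Qed.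
Let hs := coxeter_halfspace_system cox finS.

Local Notation parity := (parity S).
Local Notation reflection := (reflection S).
Local Notation HH := (coxeter_halfspaces S).

Lemma halfspace_reflection t t' b b' : reflection t -> reflection t' ->
  [set y | parity t y == b] = [set y | parity t' y == b'] -> t = t'.
Proof.
move=> rt rt' e; have [x [s [Ss tx]]] := reflectionP rt.
have : sep [set y | parity t y == b] x (x * s).
  by rewrite sep_halfspace (parity_edge cox) ?tx // (reflection_sq cox rt).
rewrite e sep_halfspace (parity_edge cox) ?(reflection_sq cox rt') //.
by rewrite -tx => /eqP/mulIg.
Qed.

(** At the crossing, at distance at most [n] from [x], the displacement of [t] is a single
    letter. *)
Lemma wlen_crossing n t x y : reflection t -> word_length_le S n (x^-1 * y) ->
  parity t x != parity t y -> word_length_le S (n + 1 + n) (x^-1 * t * x).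
Proof.
move=> rt [v vn [hv ev]] ne.
have [|v1 [s [v2 [e h1 h2]]]] := first_change (w := v) (x := x) (f := parity t).
  by rewrite /wprod -ev mulVKg eq_sym.
move: hv vn; rewrite e => /word_cat[hv1 /word_cons[/(cox_step cox) Ss _]].
rewrite size_cat => vn; apply: (@wlen_conj _ S n 1 x (x * wprod v1) t).
  rewrite mulKg; apply: wlen_mono (wlen_word hv1).
  by rewrite (leq_trans _ vn) ?leq_addr.
have /eqP tx : t * (x * wprod v1) == x * wprod v1 * s.
  by rewrite -(parity_edge cox) ?(reflection_sq cox rt) // h1 eq_sym.
by rewrite -mulgA tx mulKg; apply: wlen_step; left.
Qed.

Lemma flipped_wlen n g t x : flipped S g t -> word_length_le S n (x^-1 * g * x) ->
  word_length_le S (n + 1 + n) (x^-1 * t * x).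
Proof.
move=> [rt [_ gx]] h; apply: (@wlen_crossing n t x (g * x)) => //.
  by rewrite mulgA.
by rewrite gx; case: (parity t x).
Qed.

(* In the Niblo-Reeves cubulation this says that every median of principal
   vertices is at bounded distance from a principal vertex. *)
Definition approximate_medians := exists Z : seq (set W), forall a b c,
  exists w, forall A, HH A -> (w \in A) != majority (a \in A) (b \in A) (c \in A) ->
    translate w^-1 A \in Z.

Hypothesis approx : approximate_medians.

(** The points [q] and [q'] may be replaced by their images under [t], so as to lie across the wall
    from [p]. Their median with [p] is then across the wall too, while boundedly many half-spaces
    separate it from [p]. *)
Lemma reflection_convex D K : exists D', forall t q q' p, reflection t ->
  word_length_le S D (q^-1 * t * q) -> word_length_le S D (q'^-1 * t * q') ->
  near_interval HH K q q' p -> word_length_le S D' (p^-1 * t * p).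
Proof.
have [Z hZ] := approx; have [C hC] := sep_bounded hs D.
have [E hE] : exists E, forall t b, reflection t -> [set y | parity t y == b] \in Z ->
    word_length_le S E t.
  elim: Z {hZ} => [|B Z [E hE]]; first by exists 0%N.
  have [[t [rt [b eB]]]|nB] := pselect (exists t, reflection t /\
      exists b, [set y | parity t y == b] = B).
    have [v hv ev] := word_exists genS t; exists (size v + E)%N => t' b' rt'.
    rewrite inE => /orP[/eqP e|/(hE t' b' rt')]; last first.
      by apply: wlen_mono; exact: leq_addl.
    have := halfspace_reflection rt' rt (etrans e (esym eB)) => ->.
    by rewrite -ev; apply: wlen_mono (wlen_word hv); exact: leq_addr.
  exists E => t' b' rt'; rewrite inE => /orP[/eqP e|/(hE t' b' rt')//].
  by case: nB; exists t'; split=> //; exists b'.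
(* [C] for each of the two moves by [t], [K] for the interval, and [size Z] for replacing the median
   by a group element [w]. *)
pose n := (C + (C + (K + size Z)))%N.
exists (n + (1 + E) + n)%N => t q q' p rt hq hq' [l lK hl].
have tt := reflection_sq cox rt.
have push x : word_length_le S D (x^-1 * t * x) -> exists y,
    parity t y != parity t p /\ exists2 k : seq (set W), (size k <= C)%N &
      forall A, HH A -> sep A x y -> A \in k.
  move=> hx; have [e|ne] := eqVneq (parity t x) (parity t p); last first.
    by exists x; split=> //; exists [::] => // A _; rewrite /sep eqxx.
  exists (t * x); split; first by rewrite (parity_reflection cox) // e; case: (parity t p).
  by apply: hC; rewrite mulgA.
have [q1 [n1 [l1 s1 h1]]] := push _ hq; have [q2 [n2 [l2 s2 h2]]] := push _ hq'.
have [w hw] := hZ p q1 q2.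
have near A : HH A -> sep A p w -> A \in l1 ++ l2 ++ l ++ [seq translate w B | B <- Z].
  move=> HA spw; rewrite !mem_cat.
  have [/(hw A HA) h|/negPn/eqP e] := boolP ((w \in A) != majority (p \in A) (q1 \in A) (q2 \in A)).
    by rewrite -{4}(translateVK w A) map_f ?orbT.
  have := h1 A HA; have := h2 A HA; have := hl A HA; move: spw; rewrite /sep e /majority.
  case: (q \in A) (q' \in A) (p \in A) (q1 \in A) (q2 \in A) => [] [] [] [] [] //= _;
  do ?[by move=> /(_ erefl isT)->; rewrite !orbT];
  do ?[by move=> _ /(_ isT)->; rewrite !orbT]; by move=> _ _ /(_ isT)->; rewrite ?orbT.
have lpw : word_length_le S n (p^-1 * w).
  apply: wlen_mono (wlen_of_sep hs near); rewrite !size_cat size_map.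
  by rewrite !leq_add.
(* If [w] is across the wall, [wlen_crossing] applies. Otherwise the wall is one of the finitely
   many exceptions at [w], where [t] then has displacement at most [E]. The term [1 + E] covers both
   cases. *)
have [e|ne] := eqVneq (parity t p) (parity t w); last first.
  apply: wlen_mono (wlen_crossing rt lpw ne).
  by rewrite leq_add2r leq_add2l leq_addr.
pose A := [set y | parity t y == parity t p].
have HA : HH A by exists t, (parity t p).
have : translate w^-1 A \in Z.
  by apply: hw => //; rewrite /A !in_halfspace (negPf n1) (negPf n2) e eqxx.
have rt' : reflection (w^-1 * t * w).
  by have := reflection_conj w^-1 rt; rewrite invgK.
rewrite (translate_halfspace cox) // invgK => /(hE _ _ rt')/(wlen_conj lpw).
by apply: wlen_mono; rewrite leq_add2r leq_add2l leq_addl.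
Qed.

Lemma coxeter_rigid_wall (phi : {multiplicative W -> W}) s b : S s ->
  rigid_wall S HH phi [set y | parity s y == b] s.
Proof.
move=> Ss; have rs := reflection_gen Ss; have ss := cox_sq cox Ss; split.
- exists 1%N => u s' /(cox_step cox) Ss'; rewrite sep_halfspace (parity_edge cox) //.
  by move=> /eqP e; rewrite -mulgA e mulKg; apply: wlen_step; left.
- move=> D; exists D => x hx; exists (s * x); first by rewrite mulgA.
  by rewrite sep_halfspace parity_reflection //; case: (parity s x).
move=> D K; set g := phi s.
have gg : g * g = 1 by rewrite -gmulfM ss (morph_mul1 (@gmulfM _ _ phi)).
have [D' hD'] := reflection_convex (D + 1 + D) K.
have [v hv ev] := gen_word (involution_flipped cox gg).
(* Each factor of [g] has displacement at most [D'] at [p], and displacements of a product add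
   up. *)
exists (size v * D')%N => q q' p hq hq' npq.
rewrite -{}ev; elim: v hv => [|t v IH].
  by move=> _; rewrite wprod_nil mulg1 mulVg; exact: wlen1.
move=> /word_cons[ht /IH h]; rewrite wprod_cons.
have {}ht : flipped S g t.
  case: ht => // -[rt ?]; suff -> : t = t^-1 by [].
  by apply/esym/mulg1_eq; rewrite -[t]invgK -invgM (reflection_sq cox rt) invg1.
have := wlenM (hD' t q q' p ht.1 (flipped_wlen ht hq) (flipped_wlen ht hq') npq) h.
by rewrite !mulgE.
Qed.

Lemma coxeter_fixed mu : (exists K, forall a b c,
  [/\ near_interval HH K a b (mu a b c), near_interval HH K b c (mu a b c)
    & near_interval HH K a c (mu a b c)]) -> fixed_by_Out mu.
Proof.
move=> [K hK] phi psi phiK psiK; have /finite_seqP[L eL] := finS.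
pose Q := [seq ([set y | parity s y == b], s) | s <- L, b <- [:: true; false]].
apply: (rigid_walls_fixed hs phiK psiK hK (Q := Q)).
  move=> A [t [b [rt ->]]]; have [w [s [Ss et]]] := rt.
  exists ([set y | parity s y == b (+) parity t w], s).
    by apply: allpairs_f; [move: Ss; rewrite eL|case: (_ (+) _)].
  exists w; rewrite (translate_halfspace cox); last exact: reflection_gen.
  by rewrite -et -addbA addbb addbF.
move=> _ /allpairsP[[s b] [sL _ ->]]; apply: coxeter_rigid_wall.
by rewrite eL.
Qed.

End CoxeterRigidity.

(** * The Niblo-Reeves cubulation *)

Section NibloReeves.
Variables (W : groupType) (S : set W).
Hypotheses (cox : coxeter_system S) (finS : finite_set S).
Implicit Types (s t r g h w x y z : W) (H K : set (set W)) (a b c : side_choice W).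

Local Notation parity := (parity S).
Local Notation reflection := (reflection S).
Local Notation wall_of := (wall_of S).
Local Notation X := (niblo_reeves_complex S).
Local Notation act := (@niblo_reeves_act W).

Lemma wall_of_inj t t' : reflection t -> reflection t' -> wall_of t = wall_of t' -> t = t'.
Proof.
move=> rt rt' e; have [x [s [Ss tx]]] := reflectionP rt.
have : wall_of t [set x; x * s] by apply/wall_of_edge => //; exact: (reflection_sq cox).
rewrite e wall_of_edge ?(reflection_sq cox rt') // -tx.
by move=> /mulIg.
Qed.

Lemma wall_wall_of t : reflection t -> wall S (wall_of t).
Proof. by move=> rt; apply/(wallP cox); exists t. Qed.

Definition side_sign a H : bool := `[< a H 1 >].

Lemma NR_side a t : NR_vertex S a -> reflection t ->
  a (wall_of t) = [set y | parity t y = ~~ side_sign a (wall_of t)].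
Proof.
move=> [va _ _] rt; have [/(_ (wall_wall_of rt)) + _] := va (wall_of t).
move=> /(side_wallP cox _ rt)[b e]; rewrite /side_sign e.
apply/predeqP => y /=; rewrite (parity1 cox (reflection_sq cox rt)).
by case: b {e}; [rewrite asboolF|rewrite asboolT].
Qed.

Lemma NR_nonwall a H : NR_vertex S a -> ~ wall S H -> a H = set0.
Proof. by move=> [va _ _] nH; have [_ ->] := va H. Qed.

Lemma side_sign_inj a b H : NR_vertex S a -> NR_vertex S b ->
  side_sign a H = side_sign b H -> a H = b H.
Proof.
move=> va vb e; have [/(wallP cox)[t rt eH]|nH] := pselect (wall S H).
  by rewrite eH in e *; rewrite !NR_side // e.
by rewrite !NR_nonwall.
Qed.

Lemma side_sign_wall a b H : NR_vertex S a -> NR_vertex S b ->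
  side_sign a H != side_sign b H -> wall S H.
Proof.
move=> va vb; apply: contraNP => nH.
by rewrite /side_sign !NR_nonwall.
Qed.

Lemma vertex_NR a : vertex X a <-> NR_vertex S a.
Proof.
split=> [[k [f [_ e vf _]]]|va].
  have : range f a by rewrite -e.
  by move=> [p _ <-].
exists 0%N, (fun=> a); split=> //.
- by move=> p q _; apply/ffunP => -[].
- by apply/seteqP; split=> b; [move=> ->; exists [ffun=> false]|move=> [_ _ <-]].
move=> p q; split=> [[H [/(_ erefl)//]]|].
by rewrite (_ : [set i | _]%SET = finset.set0) ?cards0 //; apply/setP => -[].
Qed.

Lemma NR_adjacentP a b : adjacent X a b <->
  [/\ NR_vertex S a, NR_vertex S b & NR_adjacent a b].
Proof.
split=> [[ab [k [f [injf e vf af]]]]|[va vb [H [abH hH]]]].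
  have [p _ fp] : range f a by rewrite -e; left.
  have [q _ fq] : range f b by rewrite -e; right.
  rewrite -fp -fq; split=> //; apply/af.
  have [i pqi] : exists i, p i != q i.
    apply: contrapT => h; apply: ab; rewrite -fp -fq; congr f; apply/ffunP => i.
    by apply/eqP; apply: contraT => pqi; case: h; exists i.
  (* Flipping one coordinate where [p] and [q] differ already gives the other end of the edge, so
     they differ nowhere else. *)
  pose q' := [ffun j => if j == i then q i else p j].
  have eq : q' = q.
    apply/injf; rewrite fq; have : [set a; b] (f q') by rewrite e; exists q'.
    move=> [|//]; rewrite -fp => /injf/ffunP/(_ i); rewrite ffunE eqxx => h.
    by rewrite h eqxx in pqi.
  rewrite (_ : [set j | _]%SET = [set i]%SET) ?cards1 //; apply/setP => j.
  by rewrite !inE -eq ffunE; case: (eqVneq j i) => [->|_]; rewrite ?pqi ?eqxx.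
have ab : a <> b by move=> ab; apply: abH; rewrite ab.
split=> //; pose f (p : {ffun 'I_1 -> bool}) := if p ord0 then b else a.
have pe (p q : {ffun 'I_1 -> bool}) : p ord0 = q ord0 -> p = q.
  by move=> e; apply/ffunP => i; rewrite !ord1.
exists 1%N, f; split.
- by move=> p q; rewrite /f => e; apply: pe; move: e; do 2!case: ifP => // _; move=> e;
  case: ab.
- apply/seteqP; split=> [c [->|->]|c [p _ <-]].
  + by exists [ffun=> false] => //; rewrite /f ffunE.
  + by exists [ffun=> true] => //; rewrite /f ffunE.
  + by rewrite /f; case: ifP => _; [right|left].
- by move=> p; rewrite /f; case: ifP.
move=> p q; have -> : #|[set i | p i != q i]%SET| = (p ord0 != q ord0).
  rewrite (_ : [set i | _]%SET = if p ord0 != q ord0 then [set ord0]%SET else finset.set0).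
    by case: ifP; rewrite ?cards1 ?cards0.
  by apply/setP => i; rewrite !ord1 inE; case: (p ord0 != q ord0); rewrite inE ?eqxx.
have adj1 : NR_adjacent a b by exists H.
have adj2 : NR_adjacent b a by exists H; split=> [e|K h]; [exact: abH|apply: hH => e; exact: h].
have irr c : ~ NR_adjacent c c by move=> [K [/(_ erefl)]].
by rewrite /f; case: (p ord0) (q ord0) => [] []; split=> //= /irr.
Qed.

(** On each wall the majority agrees with two of the three choices, hence on any two walls with a
    common one, from which it inherits the intersection property. *)
Lemma NR_majority a b c : NR_vertex S a -> NR_vertex S b -> NR_vertex S c ->
  NR_vertex S (fun H => if a H == b H then a H else c H).
Proof.
move=> va vb vc; set m := (fun H => _).
have two H : wall S H -> [\/ m H = a H /\ m H = b H, m H = b H /\ m H = c H |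
    m H = a H /\ m H = c H].
  move=> wH; rewrite /m; case: eqP => [e|nab]; first by constructor 1.
  have : side_sign a H = side_sign c H \/ side_sign b H = side_sign c H.
    have : side_sign a H <> side_sign b H by move=> /(side_sign_inj va vb).
    by case: (side_sign a H) (side_sign b H) (side_sign c H) => [] [] []; auto.
  by case=> /side_sign_inj h; [constructor 3|constructor 2]; rewrite h.
have [va1 va2 va3] := va; have [vb1 vb2 vb3] := vb; have [vc1 vc2 vc3] := vc.
split.
- by move=> H; rewrite /m; case: ifP => _; [exact: va1|exact: vc1].
- move=> H K wH wK.
  case: (two H wH) => -[e1 e2]; case: (two K wK) => -[e3 e4];
    by [rewrite e1 e3; auto|rewrite e1 e4; auto|rewrite e2 e3; auto|rewrite e2 e4; auto].
move=> w; have : finite_set ([set H | wall S H /\ ~ a H w] `|` [set H | wall S H /\ ~ c H w]).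
  by rewrite finite_setU.
apply: sub_finite_set => H [wH]; rewrite /m; case: ifP => _ h; [left|right]; by split.
Qed.

Lemma NR_wall_graph : wall_graph X side_sign.
Proof.
have fin a b : NR_vertex S a -> NR_vertex S b ->
    exists l : seq (set (set W)), forall H, side_sign a H != side_sign b H -> H \in l.
  move=> va vb; have [_ _ fa] := va; have [_ _ fb] := vb.
  have : finite_set ([set H | wall S H /\ ~ a H 1] `|` [set H | wall S H /\ ~ b H 1]).
    by rewrite finite_setU.
  move=> /finite_seqP[l el]; exists l => H sH.
  have wH := side_sign_wall va vb sH.
  have : ([set H | wall S H /\ ~ a H 1] `|` [set H | wall S H /\ ~ b H 1]) H.
    move: sH; rewrite /side_sign.
    by case: asboolP => ha; case: asboolP => hb //= _; [right|left].
  by rewrite el.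
split.
- move=> a b va /NR_adjacentP[_ vb [H [_ hH]]]; split; first exact/vertex_NR.
  exists H => K /eqP h; apply/esym/hH => e; apply: h; by rewrite /side_sign e.
- move=> a b /vertex_NR va /vertex_NR vb ab.
  have [l0 hl0] := fin a b va vb.
  pose l := [seq H <- l0 | side_sign a H != side_sign b H].
  have hl H : (H \in l) = (side_sign a H != side_sign b H).
    by rewrite mem_filter andb_idr //; exact: hl0.
  have [H0 H0l] : exists H, H \in l.
    apply: contrapT => h; apply: ab; apply/funext => H; apply: side_sign_inj => //.
    by apply/eqP; apply: contraT; rewrite -hl => Hl; case: h; exists H.
  (* Among the walls separating [a] from [b], one takes [H] with [a H] minimal for inclusion,
     measured by counting the sides inside it. If the flipped side missed [a K], then [a K] would be
     a strictly smaller candidate. *)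
  pose le H K := `[< a K `<=` a H >].
  have [H Hl Hmin] := exists_minimal (fun H => count (le H) l) H0l.
  have dH : side_sign a H != side_sign b H by rewrite -hl.
  have wH := side_sign_wall va vb dH.
  have [va1 va2 va3] := va; have [vb1 vb2 vb3] := vb.
  pose c K := if K == H then b H else a K.
  have meets K : wall S K -> K != H -> b H `&` a K !=set0.
    move=> wK KH; apply: contrapT => h.
    have [t rt eH] : exists2 t, reflection t & H = wall_of t by exact/(wallP cox).
    have [r rr eK] : exists2 r, reflection r & K = wall_of r by exact/(wallP cox).
    have KaH : a K `<=` a H.
      move=> x ax; apply: contrapT => nx; apply: h; exists x; split=> //.
      move: nx dH; rewrite eH !NR_side //=.
      by case: (parity t x) (side_sign a _) (side_sign b _) => [] [] [].
    have Kl : K \in l.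
      rewrite hl; apply: contraT => /negPn/eqP/(side_sign_inj va vb) e.
      by case: h; rewrite e; exact: vb2.
    have := Hmin K Kl; rewrite leqNgt => /negP; apply.
    apply: (count_lt (x := H)) => //.
    - by move=> L /asboolP h1; apply/asboolP => x /h1/KaH.
    - by apply/asboolP.
    apply/asboolP => HaK; move/eqP: KH; apply.
    have : a H = a K by apply/seteqP.
    rewrite eH eK !NR_side // => e; congr wall_of.
    apply: (@halfspace_reflection _ _ cox r t (~~ side_sign a K) (~~ side_sign a H)) => //.
    rewrite eH eK; apply/predeqP => x; have /= /predeqP/(_ x) := e.
    by move=> /= -[h1 h2]; split=> /eqP; [move=> /h2->|move=> /h1->].
  have vc : NR_vertex S c.
    split.
    + by move=> K; rewrite /c; case: eqP => [->|_]; [exact: vb1|exact: va1].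
    + move=> K L wK wL; rewrite /c; case: eqP => [eK|/eqP nK]; case: eqP => [eL|/eqP nL].
      * exact: vb2.
      * exact: meets.
      * by rewrite setIC; exact: meets.
      * exact: va2.
    move=> w; apply: (@sub_finite_set _ _ ([set K | wall S K /\ ~ a K w] `|`
      [set K | wall S K /\ ~ b K w])); last by rewrite finite_setU.
    by move=> K [wK]; rewrite /c; case: eqP => [eK h|_ h]; [right|left]; split=> //; rewrite eK.
  exists c, H; split=> //.
  + exact/vertex_NR.
  + apply/NR_adjacentP; split=> //; exists H; split.
      rewrite /c eqxx => e; move: dH; by rewrite /side_sign e eqxx.
    by move=> K; rewrite /c; case: eqP.
  + by rewrite /side_sign /c eqxx.
  + by move=> K /negPf KH; rewrite /side_sign /c KH.
- by move=> a b /vertex_NR va /vertex_NR vb; exact: fin.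
move=> a b c /vertex_NR va /vertex_NR vb /vertex_NR vc.
eexists; first by apply/vertex_NR; exact: NR_majority va vb vc.
move=> H; rewrite /majority; case: eqP => [e|ne].
  by rewrite {1}/side_sign (side_sign_inj va vb e) eqxx -/(side_sign b H) -e.
rewrite {1}/side_sign ifN //; apply/eqP => e; apply: ne.
by rewrite /side_sign e.
Qed.

End NibloReeves.

(** * The action on the cubulation and the use of cocompactness *)

Section NibloReevesAction.
Variables (W : groupType) (S : set W).
Hypotheses (cox : coxeter_system S) (finS : finite_set S).
Implicit Types (s t r g h w x y z : W) (H K : set (set W)) (a b c : side_choice W).

Local Notation parity := (parity S).
Local Notation reflection := (reflection S).
Local Notation wall_of := (wall_of S).
Local Notation X := (niblo_reeves_complex S).
Local Notation act := (@niblo_reeves_act W).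

Definition wall_act g H : set (set W) := translate g @` H.

Lemma wall_actK g H : wall_act g^-1 (wall_act g H) = H.
Proof.
apply/seteqP; split=> [_ [_ [E HE <-] <-]|E HE]; first by rewrite translateK.
by exists (translate g E); [exists E|rewrite translateK].
Qed.

Lemma wall_actVK g H : wall_act g (wall_act g^-1 H) = H.
Proof. by rewrite -{1}(invgK g) wall_actK. Qed.

Lemma wall_act_of g t : wall_act g (wall_of t) = wall_of (g * t * g^-1).
Proof.
have sub h r : wall_act h (wall_of r) `<=` wall_of (h * r * h^-1).
  move=> _ [E [[w [s [Ss ->]]] [x e]] <-]; rewrite e; split.
    by exists (h * w), s; split=> //; rewrite -e /translate image_set2 mulgA.
  by exists (h * x); rewrite /translate image_set2 !mulgA mulgVK.
apply/seteqP; split; first exact: sub.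
rewrite -{1}(wall_actVK g (wall_of (g * t * g^-1))); apply: image_subset.
by have := sub g^-1 (g * t * g^-1); rewrite !mulgE.
Qed.

Lemma wall_wall_act g H : wall S (wall_act g H) <-> wall S H.
Proof.
have sub h K : wall S K -> wall S (wall_act h K).
  move=> /(wallP cox)[t rt ->]; rewrite wall_act_of.
  by apply: (wall_wall_of cox); exact: reflection_conj.
by split; [move=> /(sub g^-1); rewrite wall_actK|exact: sub].
Qed.

Lemma NR_vertex_act g a : NR_vertex S a -> NR_vertex S (act g a).
Proof.
move=> va; have [va1 va2 va3] := va; split.
- move=> H; split=> [|nH]; last first.
    rewrite /niblo_reeves_act (NR_nonwall va) ?/translate ?image_set0 //.
    by move=> /wall_wall_act.
  move=> /(wallP cox)[t rt ->]; apply/(side_wallP cox _ rt).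
  rewrite /niblo_reeves_act -/(wall_act g^-1 _) wall_act_of.
  have rt' := reflection_conj g^-1 rt; rewrite (NR_side cox va rt').
  set b := ~~ _; exists (b (+) parity t g).
  have := translate_halfspace cox g b rt'; rewrite !mulgE => e.
  apply/predeqP => y; have /predeqP/(_ y) := e; rewrite /= !translateE /=.
  by move=> [h1 h2]; split=> /eqP; [move=> /h1/eqP|move=> /h2/eqP].
- move=> H K wH wK; have [||x [hx kx]] := va2 (wall_act g^-1 H) (wall_act g^-1 K).
  + exact/wall_wall_act.
  + exact/wall_wall_act.
  by exists (g * x); split; exists x.
move=> w; have := finite_image (wall_act g) (va3 (g^-1 * w)).
apply: sub_finite_set => H [wH h]; exists (wall_act g^-1 H); last exact: wall_actVK.
split; first exact/wall_wall_act.
by move=> k; apply: h; rewrite /niblo_reeves_act translateE.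
Qed.

Lemma side_sign_act g a b H : NR_vertex S a -> NR_vertex S b ->
  side_sign (act g a) H != side_sign (act g b) H ->
  exists2 K, side_sign a K != side_sign b K & H = wall_act g K.
Proof.
move=> va vb h; exists (wall_act g^-1 H); last by rewrite wall_actVK.
apply: contraNN h => /eqP/(side_sign_inj cox va vb) e.
by rewrite /side_sign /niblo_reeves_act -!/(wall_act _ _) e.
Qed.

(** On walls this chooses the side of [1]. Its translate by [g] chooses the sides of [g], so its
    orbit is the copy of [W] in the cubulation. *)
Definition principal : side_choice W := fun H =>
  [set y | exists2 t, reflection t & H = wall_of t /\ parity t y = false].

Lemma principal_wall t : reflection t ->
  principal (wall_of t) = [set y | parity t y = false].
Proof.
move=> rt; apply/predeqP => y; split=> [[r rr [/(wall_of_inj cox rt rr) <-]]//|h].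
by exists t.
Qed.

Lemma principal_vertex : NR_vertex S principal.
Proof.
split.
- move=> H; split=> [/(wallP cox)[t rt ->]|nH].
    by apply/(side_wallP cox _ rt); exists false; rewrite principal_wall.
  apply/predeqP => y; split=> // -[t rt [e _]]; apply: nH; rewrite e.
  exact: (wall_wall_of cox).
- move=> H K /(wallP cox)[t rt ->] /(wallP cox)[r rr ->]; exists 1.
  rewrite !principal_wall //.
  by split; apply: (parity1 cox); exact: (reflection_sq cox).
move=> w; have : finite_set [set t | reflection t /\ parity t w].
  elim/(cox_ind cox): w => [|w s Ss IH].
    by apply: (@sub_finite_set _ _ set0) => // t [rt]; rewrite (parity1 cox) // (reflection_sq cox).
  apply: (@sub_finite_set _ _ ([set t | reflection t /\ parity t w] `|` [set w * s * w^-1])).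
    move=> t [rt]; rewrite (parityS cox _ (reflection_sq cox rt) Ss).
    by case: eqP => [e _|_]; [right; rewrite /= -e mulgK|rewrite addbF; left].
  by rewrite finite_setU; split=> //; exact: finite_set1.
move=> /(finite_image wall_of); apply: sub_finite_set => H [/(wallP cox)[t rt ->]].
by rewrite principal_wall //= => h; exists t => //; split=> //; case: (parity t w) h.
Qed.

Lemma side_sign_principal g t : reflection t ->
  side_sign (act g principal) (wall_of t) = ~~ parity t g.
Proof.
move=> rt; have tt := reflection_sq cox rt.
have rt' := reflection_conj g^-1 rt.
rewrite /side_sign /niblo_reeves_act -/(wall_act _ _) wall_act_of translateE.
rewrite principal_wall //= mulg1.
have := parity_translate cox g^-1 g tt; rewrite mulVg (parity1 cox (reflection_sq cox rt')).
by case: (parity t g) (parity _ g^-1) => [] [] //= _; [exact: asboolF|exact: asboolT].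
Qed.

Lemma halfspace_principal B : coxeter_halfspaces S B ->
  exists H (b : bool), forall g, (g \in B) = (side_sign (act g principal) H == b).
Proof.
move=> [t [b [rt ->]]]; exists (wall_of t), (~~ b) => g.
by rewrite in_halfspace side_sign_principal //; case: (parity t g) b => [] [].
Qed.

Lemma act_vertex g a : vertex X a -> vertex X (act g a).
Proof. by move=> /vertex_NR h; apply/vertex_NR; exact: NR_vertex_act. Qed.

Lemma cocompact_vertices : cocompact X act ->
  exists2 L : seq (side_choice W), (forall a, a \in L -> vertex X a) &
    forall a, vertex X a -> exists2 k, k \in L & exists g, a = act g k.
Proof.
move=> [K [/finite_seqP[L ->] LX hK]].
exists [seq x <- [seq xget principal C | C <- L] | `[< vertex X x >]].
  by move=> a; rewrite mem_filter => /andP[/asboolP].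
move=> a va; have [g [C [CL e]]] := hK _ va.
have [c Cc _] : (act g @` C) a by rewrite -e.
have [k ek Ck] : exists2 k, k = xget principal C & C k.
  by exists (xget principal C) => //; exact: (xgetI _ Cc).
exists k; last by exists g; apply/esym; rewrite -[_ = a]/([set a] _) e; exists k.
rewrite mem_filter {2}ek map_f // andbT; apply/asboolP/vertex_NR.
have [n [f [_ eC vf _]]] := LX C CL.
by move: Ck; rewrite eC => -[p _ <-].
Qed.

(** A median of principal vertices is a translate by some [w] of one of finitely many vertices [k].
    The half-spaces at which it differs from the principal vertex of [w] are translates by [w] of
    those separating [k] from the base vertex. *)
Lemma NR_approximate_medians : cocompact X act -> approximate_medians S.
Proof.
move=> /cocompact_vertices[L vL hL]; have wg := NR_wall_graph cox.
have vp : vertex X principal by apply/vertex_NR; exact: principal_vertex.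
pose hf j (b : bool) := [set g | side_sign (act g principal) j == b].
have [Z hZ] : exists Z : seq (set W), forall k, k \in L -> forall H,
    side_sign principal H != side_sign k H -> forall b : bool, hf H b \in Z.
  elim: L vL {hL} => [|k L IH] vL; first by exists [::].
  have [|Z hZ] := IH; first by move=> a aL; apply: vL; rewrite inE aL orbT.
  have [|l hl] := wg_fin wg vp (_ : vertex X k); first by apply: vL; rewrite inE eqxx.
  exists ([seq hf H i | H <- l, i <- [:: true; false]] ++ Z) => k'.
  rewrite inE => /orP[/eqP->|/hZ h] H d b; rewrite mem_cat; last by rewrite h ?orbT.
  by rewrite allpairs_f //; [exact: hl|case: b].
exists Z => a b c.
have va g : vertex X (act g principal) by exact: act_vertex.
have [m vm hm] := wg_maj wg (va a) (va b) (va c).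
have [k kL [w em]] := hL m vm.
exists w => A HA; have [t [b0 [rt eA]]] := HA.
have h g : (g \in A) = (side_sign (act g principal) (wall_of t) == ~~ b0).
  by rewrite eA in_halfspace side_sign_principal //; case: (parity t g) b0 {eA} => [] [].
rewrite !h => ne.
have : side_sign (act w principal) (wall_of t) != side_sign (act w k) (wall_of t).
  rewrite -em hm; move: ne; rewrite /majority.
  by case: (side_sign _ _) (side_sign _ _) (side_sign _ _) (side_sign _ _) b0 {h eA} => [] [] [] [] [].
have vk := vL k kL.
move=> /side_sign_act-/(_ principal_vertex (iffLR (vertex_NR _ _) vk))[j dj ej].
have rt' := reflection_conj w^-1 rt.
have -> : translate w^-1 A = hf j (~~ (b0 (+) parity (w^-1 * t * w^-1^-1) w^-1)).
  rewrite eA (translate_halfspace cox) //.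
  have -> : j = wall_of (w^-1 * t * w^-1^-1) by rewrite -wall_act_of ej wall_actK.
  apply/predeqP => g; rewrite /hf /= side_sign_principal //.
  by rewrite (inj_eq (can_inj negbK)).
exact: (hZ k kL j dj).
Qed.

Theorem niblo_reeves_fixed v mu : cocompact X act -> vertex X v ->
  cubical_coarse_median X act v mu -> fixed_by_Out mu.
Proof.
move=> hcc vv hmu; apply: (coxeter_fixed cox finS (NR_approximate_medians hcc)).
apply: (coarse_median_near_interval (NR_wall_graph cox) act_vertex _ halfspace_principal
  _ vv hmu (iact := wall_act)).
  move=> g a b H /vertex_NR va /vertex_NR vb; exact: side_sign_act.
by apply/vertex_NR; exact: principal_vertex.
Qed.

End NibloReevesAction.

(** * Graph products *)

Lemma quotient_pi_surj (G : groupType) (A : set G) (X : quotient_by A) :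
  exists x, X = quotient_pi A x.
Proof.
exists (generic_quotient.repr (X : {eq_quot coset_equiv A}%qT)).
exact/esym/generic_quotient.reprK.
Qed.

Lemma free_product_pi_surj (V : finType) (F : V -> finGroupType) (X : free_product F) :
  exists a, X = free_product_pi a.
Proof.
exists (generic_quotient.repr (X : {eq_quot free_product_equiv F}%qT)).
exact/esym/generic_quotient.reprK.
Qed.

Lemma free_product_pi_cat (V : finType) (F : V -> finGroupType)
    (a b : free_product_word F) :
  free_product_pi (a ++ b) = free_product_pi a * free_product_pi b.
Proof.
apply/esym/free_product_piP/Free_product_cat;
  by apply/free_product_piP; exact: generic_quotient.reprK.
Qed.

(** * Actions of a graph product given on letters *)

Section GraphProductAction.
Variables (V : finType) (e : rel V) (F : V -> finGroupType).
Local Notation G := (graph_product e F).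
Local Notation gin := (@graph_product_in V e F _).
Local Notation pi := (quotient_pi (@edge_commutators V e F)).

Lemma pi_mul (x y : free_product F) : pi (x * y) = pi x * pi y.
Proof. exact: quotient_pi_is_multiplicative. Qed.

Lemma gin_mul v : {morph (gin : F v -> G) : x y / x * y}.
Proof.
move=> x y; rewrite /graph_product_in -pi_mul; congr quotient_pi.
rewrite -free_product_pi_cat.
by apply/free_product_piP/Free_product_sym/Free_product_mul.
Qed.

Lemma gin1 v : gin (1 : F v) = 1.
Proof. exact: (morph_mul1 (@gin_mul v)). Qed.

Lemma gin_inv v (x : F v) : gin x^-1 = (gin x)^-1.
Proof. exact: (morph_mulV (@gin_mul v)). Qed.

Lemma gin_comm v w (x : F v) (y : F w) : e v w -> gin x * gin y = gin y * gin x.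
Proof.
move=> vw; rewrite /graph_product_in -!pi_mul.
apply/esym/quotient_piP => N [_]; apply.
exists v, w, x, y; split=> //.
by rewrite /commg /conjg invgM !mulgA.
Qed.

Lemma gin_ind (P : G -> Prop) : P 1 -> (forall v (x : F v) g, P g -> P (g * gin x)) ->
  forall g, P g.
Proof.
move=> P1 PM g; have [z ->] := quotient_pi_surj g.
have [a ->] := free_product_pi_surj z.
elim/last_ind: a => [|a [v x] IH]; first by rewrite -(morph_mul1 pi_mul) in P1.
by rewrite -cats1 free_product_pi_cat pi_mul; exact: PM.
Qed.

(** The universal property of the graph product, in the form of right actions on a set, so that
    functions on the group can be defined by reading letters. *)
Lemma graph_product_action (Y : Type) (rho : forall v, F v -> Y -> Y) :
  (forall v y, rho v 1 y = y) ->
  (forall v (x x' : F v) y, rho v (x * x') y = rho v x' (rho v x y)) ->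
  (forall v w (x : F v) (x' : F w) y, e v w ->
    rho w x' (rho v x y) = rho v x (rho w x' y)) ->
  exists alpha : G -> Y -> Y, [/\ forall y, alpha 1 y = y,
    forall g h y, alpha (g * h) y = alpha h (alpha g y) &
    forall v (x : F v) y, alpha (gin x) y = rho v x y].
Proof.
move=> rho1 rhoM rhoC.
pose wact (a : free_product_word F) y :=
  foldl (fun y (l : {v : V & F v}) => rho (tag l) (tagged l) y) y a.
have wact_eq a b : free_product_eq a b -> forall y, wact a y = wact b y.
  elim=> {a b} [v|v x x'|a|a b _ IH|a b c _ IH1 _ IH2|a a' b b' _ IH1 _ IH2] y //=.
  - by rewrite IH1.
  - by rewrite /wact !foldl_cat -!/(wact _ _) IH1 IH2.
have [fact hfact] : exists fact : free_product F -> Y -> Y,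
    forall a y, fact (free_product_pi a) y = wact a y.
  have [r hr] := choice (@free_product_pi_surj V F).
  exists (fun z => wact (r z)) => a; apply: wact_eq.
  by apply/free_product_piP; rewrite -hr.
have factM x x' y : fact (x * x') y = fact x' (fact x y).
  have [a ->] := free_product_pi_surj x; have [b ->] := free_product_pi_surj x'.
  by rewrite -free_product_pi_cat !hfact /wact foldl_cat.
have fact1 y : fact 1 y = y by exact: (hfact [::]).
have factN : normal_closure (@edge_commutators V e F) `<=` [set z | forall y, fact z y = y].
  apply: smallest_sub; first split; first split=> //=.
  - by move=> x x' h h' y; rewrite factM h h'.
  - by move=> x h y; rewrite -{1}(h y) -factM mulgV fact1.
  - by move=> x x' h y; rewrite /conjg !factM h -factM mulVg fact1.
  move=> _ [v [w [x [x' [vw ->]]]]] y /=.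
  have finE u (t : F u) p : fact (free_product_in t) p = rho u t p by exact: hfact.
  have comm p : fact (free_product_in x' * free_product_in x) p =
      fact (free_product_in x * free_product_in x') p.
    by rewrite !factM !finE; exact/esym/rhoC.
  set xx := free_product_in x in comm *; set xx' := free_product_in x' in comm *.
  have -> : [~ xx, xx'] = (xx' * xx)^-1 * (xx * xx').
    by rewrite /commg /conjg invgM !mulgA.
  by rewrite factM -comm -factM mulVg fact1.
have [r hr] := choice (quotient_pi_surj (A := @edge_commutators V e F)).
have key x y : fact (r (pi x)) y = fact x y.
  have /quotient_piP/factN h := hr (pi x).
  by rewrite -[RHS]h -factM mulVKg.
exists (fun g => fact (r g)); split.
- by move=> y; rewrite -(morph_mul1 pi_mul) key fact1.
- by move=> g h y; rewrite (hr g) (hr h) -pi_mul !key factM.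
- by move=> v x y; rewrite key hfact.
Qed.

End GraphProductAction.

(** * Panel coordinates *)

Section Coordinates.
Variables (V : finType) (e : rel V) (F : V -> finGroupType).
Hypotheses (e_sym : symmetric e) (e_irr : irreflexive e).
Local Notation G := (graph_product e F).
Local Notation gin := (@graph_product_in V e F _).
Local Notation parabolic := (@parabolic V e F).
Implicit Types (v w u : V) (g h p y : G) (c d L : {set V}).

Definition vertex_letters L : set G := [set z | exists v (x : F v), v \in L /\ z = gin x].

Lemma step_letters L s : step (vertex_letters L) s <->
  exists v (x : F v), v \in L /\ s = gin x.
Proof.
split=> [[//|[v [x [vL e']]]]|]; last by left.
by exists v, x^-1; split=> //; rewrite gin_inv -e' invgK.
Qed.

Lemma parabolic1 L : parabolic L 1.
Proof. by case: (subgroup_gen_subgroup (vertex_letters L)). Qed.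

Lemma parabolicM L g h : parabolic L g -> parabolic L h -> parabolic L (g * h).
Proof. by case: (subgroup_gen_subgroup (vertex_letters L)) => _ + _; apply. Qed.

Lemma parabolicV L g : parabolic L g -> parabolic L g^-1.
Proof. by case: (subgroup_gen_subgroup (vertex_letters L)) => _ _; apply. Qed.

Lemma parabolic_gin L v (x : F v) : v \in L -> parabolic L (gin x).
Proof. by move=> vL; apply: subgroup_gen_sub; exists v, x. Qed.

Lemma parabolicMr L g h : parabolic L h -> parabolic L (g * h) <-> parabolic L g.
Proof.
move=> Ph; split=> [|Pg]; last exact: parabolicM.
by move=> /parabolicM/(_ (parabolicV Ph)); rewrite mulgK.
Qed.

Lemma parabolicMl L g h : parabolic L g -> parabolic L (g * h) <-> parabolic L h.
Proof.
move=> Pg; split=> [|Ph]; last exact: parabolicM.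
by move=> /(parabolicM (parabolicV Pg)); rewrite mulKg.
Qed.

Lemma parabolicS L L' : L \subset L' -> parabolic L `<=` parabolic L'.
Proof.
move=> /fintype.subsetP LL; apply: smallest_sub; first exact: subgroup_gen_subgroup.
by move=> _ [v [x [vL ->]]]; apply: parabolic_gin; exact: LL.
Qed.

Lemma parabolic_ind L (Q : G -> Prop) : Q 1 ->
  (forall v (x : F v) g, v \in L -> parabolic L g -> Q g -> Q (g * gin x)) ->
  forall g, parabolic L g -> Q g.
Proof.
move=> Q1 QM g /gen_word[w hw <-].
elim/last_ind: w hw => [|w s IH]; first by rewrite wprod_nil.
rewrite -cats1 => /word_cat[hw /word_cons[/step_letters[v [x [vL ->]]] _]].
rewrite wprod_cat wprod_cons wprod_nil mulg1; apply: QM => //; last exact: IH.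
exact: (word_gen hw).
Qed.

Definition star v : {set V} := finset (fun w => (w == v) || e v w).

Lemma star_id v : v \in star v. Proof. by rewrite inE eqxx. Qed.

Lemma star_sym v w : (v \in star w) = (w \in star v).
Proof. by rewrite !inE eq_sym e_sym. Qed.

Definition component v w (x : F w) : F v :=
  match w =P v with ReflectT E => ecast i (F i) E x | _ => 1 end.

Lemma component_id v (x : F v) : component v x = x.
Proof. by rewrite /component; case: eqP => // E; rewrite eq_axiomK. Qed.

Lemma component_neq v w (x : F w) : w != v -> component v x = 1.
Proof. by rewrite /component; case: eqP. Qed.

Lemma component1 v w : component v (1 : F w) = 1.
Proof.
by have [<-|ne] := eqVneq w v; [exact: component_id|exact: component_neq].
Qed.

Lemma componentM v w (x y : F w) : component v (x * y) = component v x * component v y.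
Proof.
have [<-|ne] := eqVneq w v; first by rewrite !component_id.
by rewrite !component_neq // mulg1.
Qed.

(** The state carries the current group element along with the coordinate, because a letter counts
    only when read inside [parabolic (star v)]. Adjacent letters commute on states: if one has label
    [v], the other lies in its star and does not affect membership; if neither has, the coordinate
    does not change. *)
Lemma coordinate_exists v : exists k : G -> F v, k 1 = 1 /\
  forall w (x : F w) h, k (h * gin x) =
    if h \in parabolic (star v) then k h * component v x else k h.
Proof.
pose rho w (x : F w) (p : G * F v) : G * F v :=
  (p.1 * gin x, if p.1 \in parabolic (star v) then p.2 * component v x else p.2).
have Pgin w (x : F w) h : w \in star v ->
    (h * gin x \in parabolic (star v)) = (h \in parabolic (star v)).
  by move=> wv; apply/idP/idP; rewrite !inE => /parabolicMr; apply; exact: parabolic_gin.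
have rhoC0 w w' (x : F w) (x' : F w') (p : G * F v) : w' != w -> w' \in star v -> w = v ->
    (rho w' x' (rho w x p)).2 = (rho w x (rho w' x' p)).2.
  move=> + w'v wv; move: x; rewrite wv => x w'nv.
  rewrite /rho /= !Pgin ?star_id // [component v x']component_neq //.
  by case: (p.1 \in parabolic (star v)); rewrite ?mulg1.
have [|||alpha [a1 aM ag]] := @graph_product_action V e F (G * F v) rho.
- by move=> w [h k]; rewrite /rho /= gin1 mulg1 component1 mulg1 if_same.
- move=> w x x' [h k]; rewrite /rho /= gin_mul mulgA componentM.
  have [wv|/negPf wv] := boolP (w \in star v).
    by rewrite Pgin //; case: ifP; rewrite ?mulgA.
  have wv' : w != v by apply: contraFneq wv => ->; exact: star_id.
  by rewrite !component_neq // !mulg1 !if_same.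
- move=> w w' x x' [h k] ww'.
  have ne : w' != w by apply: contraTneq ww' => ->; rewrite e_irr.
  apply: injective_projections; first by rewrite /rho /= -!mulgA gin_comm.
  have [wv|nwv] := eqVneq w v; first by apply: rhoC0; rewrite // inE -wv ww' orbT.
  have [wv|nwv'] := eqVneq w' v.
    by apply/esym/rhoC0; rewrite // 1?eq_sym // inE -wv e_sym ww' orbT.
  by rewrite /rho /= !component_neq // !mulg1 !if_same.
have af h : (alpha h (1, 1)).1 = h.
  elim/(@gin_ind V e F): h => [|w x h IH]; first by rewrite a1.
  by rewrite aM ag /rho /= IH.
exists (fun h => (alpha h (1, 1)).2); split; first by rewrite a1.
by move=> w x h; rewrite aM ag /rho /= af.
Qed.

(* A panel of label [v] is a coset [g * parabolic (star v)]. The function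
   [coordinate v] is the [F v]-coordinate of the projection to the panel of [1],
   which is the product of [F v] and of the subgroup of the link of [v]; the
   panel of [g] has the coordinate [h |-> coordinate v (g^-1 * h)]. *)
Definition coordinate v : G -> F v := xget (fun=> 1) [set k : G -> F v | k 1 = 1 /\
  forall w (x : F w) h, k (h * gin x) =
    if h \in parabolic (star v) then k h * component v x else k h].

Lemma coordinateP v : coordinate v 1 = 1 /\
  forall w (x : F w) h, coordinate v (h * gin x) =
    if h \in parabolic (star v) then coordinate v h * component v x else coordinate v h.
Proof.
rewrite /coordinate; case: xgetP => [k -> //|h].
by have [k hk] := coordinate_exists v; case: (h k).
Qed.

Lemma coordinate1 v : coordinate v 1 = 1.
Proof. by have [] := coordinateP v. Qed.

Lemma coordinate_gin v w (x : F w) h :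
  coordinate v (h * gin x) = coordinate v h \/ (w = v /\ parabolic (star v) h).
Proof.
have [_ ->] := coordinateP v; case: ifP; last by left.
rewrite inE => hP; have [wv|wv] := eqVneq w v; first by right.
by left; rewrite component_neq // mulg1.
Qed.

Lemma coordinateM_gin v (x : F v) h : parabolic (star v) h ->
  coordinate v (h * gin x) = coordinate v h * x.
Proof.
by move=> hP; have [_ ->] := coordinateP v; rewrite component_id ifT ?inE.
Qed.

Lemma coordinate_of_gin v (x : F v) : coordinate v (gin x) = x.
Proof.
by rewrite -[gin x]mul1g coordinateM_gin ?coordinate1 ?mul1g //; exact: parabolic1.
Qed.

Lemma coordinate_mul v p h : parabolic (star v) p ->
  coordinate v (p * h) = coordinate v p * coordinate v h.
Proof.
move=> hp; elim/(@gin_ind V e F): h => [|w x h IH]; first by rewrite coordinate1 !mulg1.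
have [_ C] := coordinateP v; rewrite mulgA !C IH.
have -> : (p * h \in parabolic (star v)) = (h \in parabolic (star v)).
  by apply/idP/idP; rewrite !inE => /(parabolicMl _ hp).
by case: ifP; rewrite ?mulgA.
Qed.

Lemma gin_star v (x : F v) p : parabolic (star v) p -> exists x' : F v, gin x * p = p * gin x'.
Proof.
elim/(@parabolic_ind (star v)) => [|w y g wv _ [x' e']].
  by exists x; rewrite mulg1 mul1g.
rewrite mulgA e'; have := wv; rewrite inE => /orP[/eqP E|vw].
  move: y; rewrite E => y; exists (x' ^ y).
  by rewrite -!mulgA -!gin_mul -conjgC.
by exists x'; rewrite -!mulgA gin_comm.
Qed.

End Coordinates.

(** * Half-spaces of a graph product *)

Section GraphProductHalfspaces.
Variables (V : finType) (e : rel V) (F : V -> finGroupType).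
Hypotheses (e_sym : symmetric e) (e_irr : irreflexive e).
Local Notation G := (graph_product e F).
Local Notation gin := (@graph_product_in V e F _).
Local Notation parabolic := (@parabolic V e F).
Local Notation star := (star e).
Local Notation coordinate := (@coordinate V e F).
Implicit Types (v w u : V) (g h p q y : G) (c d L : {set V}) (A B : set G).

Definition gp_letters : set G := @vertex_letters V e F finset.setT.
Local Notation S := gp_letters.

(** A label with trivial group carries no wall: its half-spaces would be all of [G]. *)
Definition nontrivial v := exists x : F v, x <> 1.

Definition base_halfspace v : set G := [set h | coordinate v h = 1].

(** One half-space for each panel and each element of [F v]: the points whose projection to the
    panel of [g] has the same [F v]-coordinate as [g]. *)
Definition halfspace g v : set G := translate g (base_halfspace v).

Definition gp_halfspaces : set (set G) :=
  [set A | exists g v, nontrivial v /\ A = halfspace g v].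
Local Notation HH := gp_halfspaces.

Lemma in_halfspaceE g v h : (h \in halfspace g v) = (coordinate v (g^-1 * h) == 1).
Proof. by rewrite /halfspace translate_mem; apply/idP/eqP; rewrite inE. Qed.

Lemma halfspaceP g v h : halfspace g v h <-> coordinate v (g^-1 * h) = 1.
Proof. by rewrite /halfspace translateE. Qed.

Lemma halfspace_self g v : g \in halfspace g v.
Proof. by rewrite in_halfspaceE mulVg (coordinate1 F e_sym e_irr). Qed.

Lemma translate_gp_halfspace h g v : translate h (halfspace g v) = halfspace (h * g) v.
Proof. by rewrite /halfspace translateM. Qed.

Lemma gp_halfspaces_translate g A : HH A -> HH (translate g A).
Proof.
by move=> [h [v [nv ->]]]; exists (g * h), v; rewrite translate_gp_halfspace.
Qed.

Lemma step_gin s : step S s <-> exists v (x : F v), s = gin x.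
Proof.
by rewrite step_letters; split=> [[v [x [_ ->]]]|[v [x ->]]]; exists v, x.
Qed.

Lemma step_of_gin v (x : F v) : step S (gin x).
Proof. by apply/step_gin; exists v, x. Qed.

Lemma panel_coordinate g h v y : parabolic (star v) (g^-1 * h) ->
  coordinate v (g^-1 * y) = coordinate v (g^-1 * h) * coordinate v (h^-1 * y).
Proof.
by move=> gh; rewrite -coordinate_mul // mulgA mulgK.
Qed.

Lemma panel_sym g h v : parabolic (star v) (g^-1 * h) -> parabolic (star v) (h^-1 * g).
Proof. by move=> /parabolicV; rewrite invgM invgK. Qed.

Lemma panel_trans g h y v : parabolic (star v) (g^-1 * h) ->
  parabolic (star v) (h^-1 * y) -> parabolic (star v) (g^-1 * y).
Proof. by move=> a b; have := parabolicM a b; rewrite mulgA mulgK. Qed.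

Lemma halfspace_rebase g h v : parabolic (star v) (g^-1 * h) -> h \in halfspace g v ->
  halfspace g v = halfspace h v.
Proof.
move=> gh; rewrite in_halfspaceE => /eqP gh1; apply/predeqP => y.
by rewrite !halfspaceP (panel_coordinate _ gh) gh1 mul1g.
Qed.

Lemma sep_gin g v h w (x : F w) : sep (halfspace g v) h (h * gin x) ->
  w = v /\ parabolic (star v) (g^-1 * h).
Proof.
rewrite /sep !in_halfspaceE mulgA.
have [->|//] := coordinate_gin e_sym e_irr v x (g^-1 * h).
by rewrite eqxx.
Qed.

Lemma sep_gin_self g v (x : F v) : x <> 1 -> sep (halfspace g v) g (g * gin x).
Proof.
move=> x1; rewrite /sep halfspace_self in_halfspaceE mulKg coordinate_of_gin //.
by move/eqP/negPf: x1 => ->.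
Qed.

Lemma halfspace_eq g h u v : nontrivial u -> halfspace g u = halfspace h v ->
  u = v /\ parabolic (star v) (h^-1 * g).
Proof. by move=> [x x1] E; have := sep_gin_self g x1; rewrite E => /sep_gin. Qed.

Lemma sep_gin_rebase A h v (x : F v) : HH A -> sep A h (h * gin x) ->
  nontrivial v /\ (A = halfspace h v \/ A = halfspace (h * gin x) v).
Proof.
move=> [g [w [nw ->]]] sA; have [E gP] := sep_gin sA; subst v; split=> //.
have gP' : parabolic (star w) (g^-1 * (h * gin x)).
  by rewrite mulgA; apply: parabolicM gP _; apply: parabolic_gin; exact: star_id.
move: sA; rewrite /sep; case: (boolP (h \in _)) => [/(halfspace_rebase gP)->|_]; first by left.
by move=> /= /negPn/(halfspace_rebase gP')->; right.
Qed.

Lemma finite_gp_letters : finite_set S.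
Proof.
pose L := flatten [seq [seq (gin x : G) | x <- enum (F v)] | v <- enum V].
apply: (@sub_finite_set _ _ [set` L]); last exact: finite_seq.
move=> _ [v [x [_ ->]]] /=; apply/flattenP; eexists; first by apply/mapP; exists v; rewrite ?mem_enum.
by apply: map_f; rewrite mem_enum.
Qed.

Lemma gen_gp_letters : subgroup_gen S = setT.
Proof.
apply/predeqP => g; split=> // _.
elim/(@gin_ind V e F): g => [|v x g IH]; first exact: parabolic1.
by apply: parabolicM => //; apply: parabolic_gin; rewrite finset.in_setT.
Qed.

Lemma gp_halfspace_system : halfspace_system S HH.
Proof.
split.
- exact: finite_gp_letters.
- exact: gen_gp_letters.
- exact: gp_halfspaces_translate.
- move=> _ /step_gin[v [x ->]]; exists [:: halfspace 1 v; halfspace (gin x) v] => A HA.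
  rewrite -{1}[gin x]mul1g => /(sep_gin_rebase HA)[_]; rewrite mul1g.
  by case=> ->; rewrite !inE eqxx ?orbT.
- move=> _ /step_gin[v [x ->]] x1.
  have {}x1 : x <> 1 by move=> E; apply: x1; rewrite E gin1.
  exists (halfspace 1 v); first by exists 1, v; split=> //; exists x.
  by rewrite -[gin x]mul1g; exact: sep_gin_self.
move=> A w1 w2 [g [v [nv ->]]] hw1 hw2 s1 e12; set A' := halfspace g v in s1 e12.
have [|u1 [s [u2 [E1 h1 h1']]]] := first_change (w := w1) (x := 1) (f := fun h => h \in A').
  by rewrite mul1g eq_sym.
move: hw1; rewrite E1 => /word_cat[hu1 /word_cons[/step_gin[w [x Es]] hu2]].
rewrite !mul1g in h1 h1'; move: h1'; rewrite {}Es in E1 *.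
move=> h1'; have [|E gP] := @sep_gin g v (wprod u1) w x; first by rewrite /sep h1 eq_sym.
subst w; set h := wprod u1 in h1 h1' gP.
have hu : word S (u2 ++ w2) by apply/word_cat.
have eu : h * gin x * wprod (u2 ++ w2) = wprod w1 * wprod w2.
  by rewrite E1 !wprod_cat wprod_cons !mulgA.
have [|t1 [s' [t2 [E2 h2 h2']]]] := first_change (w := u2 ++ w2) (x := h * gin x)
    (f := fun y => y \in A').
  by rewrite eu -e12 eq_sym.
have := hu; rewrite E2 => /word_cat[ht1 /word_cons[/step_gin[w [x' Es']] ht2]].
rewrite {}Es' in E2 h2' *.
have [|E zP] := @sep_gin g v (h * gin x * wprod t1) w x'; first by rewrite /sep h2 eq_sym.
subst w.
(* Both crossings occur in the panel of [g], so the word between them represents an element of the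
   subgroup of the star. The first crossing letter can be moved past it and merged with the second,
   which saves one letter. *)
have tP : parabolic (star v) (wprod t1).
  have := panel_trans (panel_sym gP) zP; rewrite !mulgA mulVg mul1g.
  by apply: (iffLR (parabolicMl _ _)); apply: parabolic_gin; exact: star_id.
have [x'' ex''] := gin_star x tP.
exists (u1 ++ t1 ++ gin (x'' * x') :: t2); split.
- apply/word_cat; split=> //; apply/word_cat; split=> //; apply/word_cons; split=> //.
  exact: step_of_gin.
- have := congr1 size E2; rewrite !size_cat /= => E3.
  by rewrite -E3 -addnA ltn_add2l addSn.
rewrite -E1 -eu E2 !wprod_cat !wprod_cons gin_mul /h !mulgA.
by congr (_ * _ * _); rewrite -!mulgA -ex'' !mulgA.
Qed.

End GraphProductHalfspaces.

(** * Crossing panels, and cosets as vertices *)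

Section GraphProductCosets.
Variables (V : finType) (e : rel V) (F : V -> finGroupType).
Hypotheses (e_sym : symmetric e) (e_irr : irreflexive e).
Local Notation G := (graph_product e F).
Local Notation gin := (@graph_product_in V e F _).
Local Notation parabolic := (@parabolic V e F).
Local Notation star := (star e).
Local Notation coordinate := (@coordinate V e F).
Local Notation S := (@gp_letters V e F).
Local Notation HH := (@gp_halfspaces V e F).
Local Notation halfspace := (@halfspace V e F).
Local Notation nontrivial := (@nontrivial V F).
Local Notation X := (graph_product_complex e F).
Implicit Types (v w u : V) (g h p q y k : G) (c d L : {set V}) (A B x z : set G).

Let hs : halfspace_system S HH := gp_halfspace_system F e_sym e_irr.

(* Along a path from [y] to one of two panels that do not cross, the coordinate
   of the other panel has not changed when the first of them is reached. *)
Lemma panel_dichotomy g v a h w b :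
  (forall y, parabolic (star w) (h^-1 * y) -> coordinate v (g^-1 * y) = a) ->
  (forall y, parabolic (star v) (g^-1 * y) -> coordinate w (h^-1 * y) = b) ->
  forall y, coordinate v (g^-1 * y) = a \/ coordinate w (h^-1 * y) = b.
Proof.
move=> ha hb y; have [t ht et] := word_exists (hs_gen hs) (y^-1 * g).
have end_ : parabolic (star v) (g^-1 * (y * wprod t)).
  by rewrite et mulVKg mulVg; exact: parabolic1.
elim: t ht y end_ {et} => [|s t IH] ht y.
  by rewrite wprod_nil mulg1 => /hb; right.
move: ht => /word_cons[/step_gin[u [x ->]] ht]; rewrite wprod_cons (mulgA y).
have [/ha|nw] := pselect (parabolic (star w) (h^-1 * y)); first by left.
have [/hb|nv] := pselect (parabolic (star v) (g^-1 * y)); first by right.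
move=> /(IH ht); rewrite !mulgA.
have [->|[_ //]] := coordinate_gin e_sym e_irr v x (g^-1 * y).
by have [->|[_ //]] := coordinate_gin e_sym e_irr w x (h^-1 * y).
Qed.

(** A coordinate of label [w] changes only inside its own panel, along a letter of label [w]; a path
    inside the first panel has its labels in the star of [v]. *)
Lemma panel_cross v h y w k : parabolic (star v) (h^-1 * y) ->
  coordinate w (k^-1 * y) <> coordinate w (k^-1 * h) ->
  exists p, [/\ parabolic (star v) (h^-1 * p), parabolic (star w) (k^-1 * p) &
    w \in star v].
Proof.
move=> hy ne; have [t ht et] := gen_word hy.
have [|t1 [s [t2 [E h1 h2]]]] := first_change (w := t) (x := h)
    (f := fun y => coordinate w (k^-1 * y)).
  by rewrite et mulVKg; exact/eqP.
move: ht; rewrite E => /word_cat[ht1 /word_cons[/step_letters[u [x [uv Es]]] _]].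
move: h2; rewrite Es mulgA -h1.
have [->|[uw wP] _] := coordinate_gin e_sym e_irr w x (k^-1 * (h * wprod t1)).
  by rewrite eqxx.
exists (h * wprod t1); rewrite -uw; split=> //; last by rewrite uw.
by rewrite mulKg; exact: (word_gen ht1).
Qed.

(** Panels with distinct non-adjacent labels do not cross, so [panel_dichotomy] applies with both
    constants trivial. *)
Lemma coordinate_nonadjacent v w : v != w -> ~~ e v w -> forall y,
  coordinate v y = 1 \/ coordinate w y = 1.
Proof.
move=> vw nvw y.
have cst v' w' k : v' != w' -> ~~ e v' w' -> parabolic (star w') (1^-1 * k) ->
    coordinate v' (1^-1 * k) = 1.
  move=> ne ne' kP; apply: contrapT => h.
  have [|p [_ _]] := @panel_cross w' 1 k v' 1 kP.
    by rewrite mulVg (coordinate1 F e_sym e_irr).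
  by rewrite inE (negPf ne) e_sym (negPf ne').
have := @panel_dichotomy 1 v 1 1 w 1 _ _ y; rewrite invg1 mul1g; apply=> k kP.
  by have := cst v w k vw nvw; rewrite invg1; apply.
by have := cst w v k; rewrite invg1; apply; rewrite // 1?eq_sym // e_sym.
Qed.

Definition coset g c : set G := translate g (parabolic c).

Lemma cosetE g c h : coset g c h <-> parabolic c (g^-1 * h).
Proof. by rewrite /coset translateE. Qed.

Lemma coset_self g c : coset g c g.
Proof. by apply/cosetE; rewrite mulVg; exact: parabolic1. Qed.

Lemma coset_rebase g c h : coset g c h -> coset g c = coset h c.
Proof.
move=> /cosetE gh; apply/predeqP => y; rewrite !cosetE; split=> hy.
  by have := parabolicM (parabolicV gh) hy; rewrite invgM invgK mulgA mulgK.
by have := parabolicM gh hy; rewrite mulgA mulgK.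
Qed.

Lemma coset_gin g c v (x : F v) : v \in c -> coset g c (g * gin x).
Proof. by move=> vc; apply/cosetE; rewrite mulKg; exact: parabolic_gin. Qed.

Lemma cosetS g c d : c \subset d -> coset g c `<=` coset g d.
Proof. by move=> cd y /cosetE h; apply/cosetE; exact: parabolicS cd _ h. Qed.

Lemma vertex_coset z : vertex X z <-> exists g c, clique e c /\ z = coset g c.
Proof.
split=> [[g [c [c' [cc _ cc' E]]]]|[g [c [cc ->]]]].
  exists g, c; split=> //.
  have : [set z] (coset g c) by rewrite E; exists c.
  by move=> <-.
exists g, c, c; split=> //; apply/predeqP => A; split=> [->|[d [cd dc ->]]].
  by exists c.
by have -> : d = c by apply/eqP; rewrite finset.eqEsubset dc cd.
Qed.

Lemma cliqueP c : reflect (forall v w, v \in c -> w \in c -> v != w -> e v w) (clique e c).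
Proof.
apply: (iffP forall_inP) => [h v w vc wc vw|h v vc].
  by have /forall_inP/(_ w wc)/implyP := h v vc; apply.
by apply/forall_inP => w wc; apply/implyP; exact: h.
Qed.

Lemma clique_star c v : clique e c -> v \in c -> c \subset star v.
Proof.
move=> /cliqueP cc vc; apply/fintype.subsetP => w wc.
by rewrite inE; have [//|wv] := eqVneq w v; rewrite cc // eq_sym.
Qed.

Lemma cliqueS c d : c \subset d -> clique e d -> clique e c.
Proof.
by move=> /fintype.subsetP cd /cliqueP h; apply/cliqueP => v w /cd vd /cd wd; exact: h.
Qed.

(** For [v] in the clique [c], the whole coset lies in the panel of [h] of label [v]. A path in the
    coset leaves [A] along a letter of such a label, so [A] can be rebased at [h]. *)
Lemma coset_leaves A h c : clique e c -> HH A -> A h -> ~ (coset h c `<=` A) ->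
  exists v, [/\ v \in c, nontrivial v & A = halfspace h v].
Proof.
move=> cc HA hA /existsNP[y /not_implyP[/cosetE hy nyA]].
have [t ht et] := gen_word hy.
have [|t1 [s [t2 [E h1 h2]]]] := first_change (w := t) (x := h) (f := fun y => `[< A y >]).
  by rewrite et mulVKg (asboolT hA) (asboolF nyA).
move: ht; rewrite E => /word_cat[ht1 /word_cons[/step_letters[v [x [vc Es]]] _]].
rewrite Es in h2; exists v; have [g [w [nw EA]]] := HA.
have [|vw gP] := @sep_gin V e F e_sym e_irr g w (h * wprod t1) v x.
  by rewrite /sep -EA; rewrite -h1 eq_sym in h2.
subst w; split=> //; rewrite EA.
have tP : parabolic (star v) (wprod t1).
  exact: parabolicS (clique_star cc vc) _ (word_gen ht1).
apply: halfspace_rebase => //; last by rewrite -EA; exact: mem_set.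
by apply: panel_trans gP _; rewrite invgM mulgVK; exact: parabolicV.
Qed.

Lemma coset_not_sub h c v : v \in c -> nontrivial v -> ~ (coset h c `<=` halfspace h v).
Proof.
move=> vc [x x1] sub; have := sep_gin_self e_sym e_irr h x1.
by rewrite /sep halfspace_self // mem_set //; apply: sub; exact: coset_gin.
Qed.

Lemma coset_sub h c v : clique e c -> v \notin c -> nontrivial v -> coset h c `<=` halfspace h v.
Proof.
move=> cc vc nv; apply: contrapT => ns.
have [||w [wc nw E]] := coset_leaves cc _ _ ns; first by exists h, v.
  by apply: set_mem; exact: halfspace_self.
by have [vw _] := halfspace_eq e_sym e_irr nv E; rewrite vw wc in vc.
Qed.

(** A vertex counts as inside only with its whole coset: for a nontrivial [v] in [c], the vertex
    [g G_c] is outside all half-spaces of its panel of label [v]. The conjunct [HH A] gives a fixed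
    sign to sets that are not half-spaces, so that all sets can index walls. *)
Definition coset_sign z A : bool := `[< HH A /\ z `<=` A >].

Lemma coset_signP z A : HH A -> coset_sign z A <-> z `<=` A.
Proof. by move=> HA; split=> [/asboolP[]|h]; last exact/asboolP. Qed.

Lemma coset_sign_self h c v : clique e c -> nontrivial v ->
  coset_sign (coset h c) (halfspace h v) = (v \notin c).
Proof.
move=> cc nv; apply/asboolP/idP => [[_ sub]|vc].
  by apply/negP => vc; exact: coset_not_sub vc nv sub.
by split; [exists h, v|exact: coset_sub].
Qed.

Lemma clique_nonadjacent g v w z : vertex X z -> nontrivial v -> nontrivial w -> v != w ->
  ~~ e v w -> z `<=` halfspace g v \/ z `<=` halfspace g w.
Proof.
move=> /vertex_coset[h [c [cc ->]]] nv nw vw evw.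
have [|nsv] := pselect (coset h c `<=` halfspace g v); first by left.
have [|nsw] := pselect (coset h c `<=` halfspace g w); first by right.
have leave v' w' : nontrivial v' -> nontrivial w' -> v' != w' -> ~~ e v' w' ->
    ~ (coset h c `<=` halfspace g v') -> ~ (coset h c `<=` halfspace g w') -> w' \in c.
  move=> nv' nw' ne ne' /existsNP[y /not_implyP[hy ny]] ns.
  rewrite (coset_rebase hy) in ns.
  have yw : halfspace g w' y.
    apply/halfspaceP; have [E|//] := coordinate_nonadjacent ne ne' (g^-1 * y).
    by case: ny; apply/halfspaceP.
  have [|u [uc nu E]] := coset_leaves cc _ yw ns; first by exists g, w'.
  by have [-> _] := halfspace_eq e_sym e_irr nw' E.
have wc := leave v w nv nw vw evw nsv nsw.
have vc : v \in c.
  by apply: (leave w v) => //; [rewrite eq_sym|rewrite e_sym].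
have /fintype.subsetP/(_ w wc) := clique_star cc vc.
by rewrite inE eq_sym (negPf vw) (negPf evw).
Qed.

End GraphProductCosets.

(** * Paths to panels, and edges of the complex *)

Section GraphProductComplex.
Variables (V : finType) (e : rel V) (F : V -> finGroupType).
Hypotheses (e_sym : symmetric e) (e_irr : irreflexive e).
Local Notation G := (graph_product e F).
Local Notation gin := (@graph_product_in V e F _).
Local Notation parabolic := (@parabolic V e F).
Local Notation star := (star e).
Local Notation coordinate := (@coordinate V e F).
Local Notation S := (@gp_letters V e F).
Local Notation HH := (@gp_halfspaces V e F).
Local Notation halfspace := (@halfspace V e F).
Local Notation nontrivial := (@nontrivial V F).
Local Notation coset := (@coset V e F).
Local Notation coset_sign := (@coset_sign V e F).
Local Notation X := (graph_product_complex e F).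
Implicit Types (v w u : V) (g h p q y k : G) (c d L : {set V}) (A B x z : set G).

Let hs : halfspace_system S HH := gp_halfspace_system F e_sym e_irr.

(* The wall crossed by the first edge of a shortest path to a panel separates the
   starting point from everything behind the panel. *)
Lemma shortest_path_to_panel g v h w (x : F w) (t : seq G) : word S t ->
  (forall t', word S t' -> parabolic (star v) (g^-1 * (h * wprod t')) ->
    (size t < size t')%N) ->
  parabolic (star v) (g^-1 * (h * gin x * wprod t)) ->
  x <> 1 /\ forall y, coordinate v (g^-1 * y) = coordinate v (g^-1 * h) \/
    coordinate w ((h * gin x)^-1 * y) = 1.
Proof.
move=> ht hmin hend.
have x1 : x <> 1.
  move=> x1; have := hmin t ht; rewrite ltnn => h0.
  by move: hend; rewrite x1 gin1 mulg1 => /h0.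
split=> //; move h1E : (h * gin x) hend => h1; move y0E : (h1 * wprod t) => y0 hend.
have e0 : coordinate w (h1^-1 * y0) = 1.
  have gw : geodesic S ([:: gin x] ++ t).
    split; first by apply/word_cat; split=> //; apply/word_cons; split=> //; exact: step_of_gin.
    move=> t' ht' et'; apply: hmin => //.
    by rewrite et' /= wprod_cons (mulgA h) h1E y0E.
  have HB : HH (halfspace h1 w) by exists h1, w; split=> //; exists x.
  have := geodesic_sep hs (x := h) HB gw.
  rewrite wprod_cons wprod_nil mulg1 h1E y0E halfspace_self // !in_halfspaceE.
  rewrite -{1 3}h1E invgM mulgVK -gin_inv coordinate_of_gin //.
  have -> : (x^-1 == 1) = false by apply/eqP => /eqP; rewrite invg_eq1 => /eqP.
  by case: eqP => // _ /(_ erefl).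
(* If the two panels crossed, the first letter could be moved past the path and dropped, giving a
   path of length [size t] to the panel of [g]. *)
have hb y : parabolic (star v) (g^-1 * y) -> coordinate w (h1^-1 * y) = 1.
  move=> gy; apply: contrapT => ny.
  have [||p [y0p h1p wv]] := @panel_cross V e F e_sym e_irr v y0 y w h1.
  - exact: panel_trans (panel_sym hend) gy.
  - by rewrite e0.
  have [s hs'] := gin_star x^-1 h1p.
  suff : (size t < size t)%N by rewrite ltnn.
  apply: hmin => //.
  have -> : h * wprod t = p * (gin s * (p^-1 * y0)).
    have -> : wprod t = (h1^-1 * p) * (p^-1 * y0) by rewrite -y0E !mulgE.
    have -> : h = h1 * gin x^-1 by rewrite gin_inv -h1E mulgK.
    by rewrite -mulgA [gin x^-1 * _]mulgA hs' !mulgA mulgV mul1g.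
  rewrite mulgA; apply: parabolicM; first exact: panel_trans hend y0p.
  by apply: parabolicM; [exact: parabolic_gin|exact: panel_sym y0p].
apply: panel_dichotomy => // y h1y; apply: contrapT => ny.
have [||p [hp gp vw]] := @panel_cross V e F e_sym e_irr w h y v g.
- have -> : h^-1 * y = gin x * (h1^-1 * y) by rewrite -h1E !mulgE.
  by apply: parabolicM => //; apply: parabolic_gin; exact: star_id.
- exact: ny.
have hpx : coordinate w (h1^-1 * (p * gin x)) = 1.
  apply: hb; rewrite mulgA; apply: parabolicM => //; apply: parabolic_gin.
  by rewrite star_sym.
apply: x1; move: hpx; rewrite mulgA coordinateM_gin ?hb ?mul1g //.
rewrite -h1E invgM -mulgA; apply: parabolicM => //; apply: parabolicV.
by apply: parabolic_gin; exact: star_id.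
Qed.

Lemma vertex_nontrivial z : vertex X z ->
  exists g c, [/\ clique e c, forall v, v \in c -> nontrivial v & z = coset g c].
Proof.
move=> /vertex_coset[g [c [cc ->]]]; pose c' := finset (fun v => (v \in c) && `[< nontrivial v >]).
have c'c : c' \subset c by apply/fintype.subsetP => v; rewrite inE => /andP[].
exists g, c'; split.
- exact: cliqueS cc.
- by move=> v; rewrite inE => /andP[_ /asboolP].
apply/seteqP; split; last exact: cosetS.
move=> y /cosetE hy; apply/cosetE; move: (_ * y) hy; apply: smallest_sub.
  exact: subgroup_gen_subgroup.
move=> _ [v [x [vc ->]]]; have [->|x1] := eqVneq x 1; first by rewrite gin1; exact: parabolic1.
apply: parabolic_gin; rewrite inE vc; apply/asboolP; exists x; exact/eqP.
Qed.

(** By [coset_leaves], a half-space that contains [g] and cuts the larger coset is based at [g] with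
    a label in [v |: c]; if its label is in [c], it already cuts the smaller coset. *)
Lemma coset_step g c v : v \notin c -> clique e (v |: c) -> nontrivial v ->
  [/\ adjacent X (coset g c) (coset g (v |: c)),
    adjacent X (coset g (v |: c)) (coset g c),
    coset_sign (coset g c) (halfspace g v), ~~ coset_sign (coset g (v |: c)) (halfspace g v) &
    forall B, B != halfspace g v -> coset_sign (coset g (v |: c)) B = coset_sign (coset g c) B].
Proof.
move=> vc cvc nv; have ccv : c \subset v |: c by exact: finset.subsetUr.
have cc := cliqueS ccv cvc.
have s1 : coset_sign (coset g c) (halfspace g v) by rewrite coset_sign_self.
have s2 : ~~ coset_sign (coset g (v |: c)) (halfspace g v).
  by rewrite coset_sign_self // negbK !inE eqxx.
have ne : coset g c <> coset g (v |: c) by move=> E; move: s2; rewrite -E s1.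
have cube : X [set coset g c; coset g (v |: c)].
  exists g, c, (v |: c); split=> //; apply/predeqP => A; split=> [[->|->]|[d [cd dc ->]]].
  - by exists c.
  - by exists (v |: c).
  have [vd|vd] := boolP (v \in d); [right|left]; congr coset.
    by apply/eqP; rewrite finset.eqEsubset dc finset.subUset finset.sub1set vd.
  apply/eqP; rewrite finset.eqEsubset cd andbT; apply/fintype.subsetP => w wd.
  have /fintype.subsetP/(_ w wd) := dc; rewrite !inE => /orP[/eqP E|//].
  by rewrite -E wd in vd.
split=> //.
- by split; [exact/nesym|rewrite setUC].
move=> B /eqP nB; apply/asboolP/asboolP => -[HB sub]; split=> //.
  by apply: subset_trans sub; exact: cosetS.
apply: contrapT => nsub; apply: nB.
have [|w [wc nw E]] := coset_leaves e_sym e_irr cvc HB _ nsub.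
  by apply: sub; exact: coset_self.
move: wc; rewrite !inE E => /orP[/eqP->//|wc].
by case: (@coset_not_sub V e F e_sym e_irr g c w wc nw); rewrite -E.
Qed.

End GraphProductComplex.

(** * Moving towards a consistent choice of sides *)

Section GraphProductMedian.
Variables (V : finType) (e : rel V) (F : V -> finGroupType).
Hypotheses (e_sym : symmetric e) (e_irr : irreflexive e).
Local Notation G := (graph_product e F).
Local Notation gin := (@graph_product_in V e F _).
Local Notation parabolic := (@parabolic V e F).
Local Notation star := (star e).
Local Notation coordinate := (@coordinate V e F).
Local Notation S := (@gp_letters V e F).
Local Notation HH := (@gp_halfspaces V e F).
Local Notation halfspace := (@halfspace V e F).
Local Notation nontrivial := (@nontrivial V F).
Local Notation coset := (@coset V e F).
Local Notation coset_sign := (@coset_sign V e F).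
Local Notation X := (graph_product_complex e F).
Implicit Types (v w u : V) (g h p q y k : G) (c d L : {set V}) (A B x z : set G).

Let hs : halfspace_system S HH := gp_halfspace_system F e_sym e_irr.

Definition consistent (tau : set G -> bool) := forall A B, HH A -> HH B ->
  exists z, [/\ vertex X z, coset_sign z A = tau A & coset_sign z B = tau B].

Lemma coset_sign_nonhalf z A : ~ HH A -> coset_sign z A = false.
Proof. by move=> nA; apply/asboolP => -[]. Qed.

(** If [tau] enters a half-space cut by the coset, its label is removed from the clique. Otherwise a
    half-space of disagreement whose panel is nearest to the coset turns out to have a panel meeting
    the coset, and its label is added. *)
Lemma closer_vertex tau x A0 : vertex X x -> consistent tau ->
  HH A0 -> coset_sign x A0 != tau A0 ->
  exists z A, [/\ vertex X z, adjacent X x z, coset_sign x A != tau A,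
    coset_sign z A = tau A & forall B, B != A -> coset_sign z B = coset_sign x B].
Proof.
move=> vx cons HA0 sA0; have [g [c [cc cn Ex]]] := vertex_nontrivial vx.
have [[v [h [vc hx th]]]|down] := pselect (exists v h,
    [/\ v \in c, coset g c h & tau (halfspace h v)]).
  have cE : v |: (c :\ v)%SET = c by exact: finset.setD1K.
  have [|||a1 a2 s1 s2 s3] := @coset_step V e F e_sym e_irr h (c :\ v)%SET v.
  - by rewrite !inE eqxx.
  - by rewrite cE.
  - exact: cn.
  rewrite cE -(coset_rebase hx) -Ex in a2 s2 s3.
  exists (coset h (c :\ v)%SET), (halfspace h v); split=> //.
  - apply/vertex_coset; exists h, (c :\ v)%SET; split=> //.
    by apply: cliqueS cc; rewrite -{2}cE finset.subsetUr.
  - by rewrite (negPf s2) th.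
  - by rewrite s1 th.
  - by move=> B nB; rewrite s3.
have {}down v h : v \in c -> coset g c h -> tau (halfspace h v) = false.
  by move=> vc hx; apply/negP => th; apply: down; exists v, h.
have inside k v h : nontrivial v -> coset_sign x (halfspace k v) != tau (halfspace k v) ->
    coset g c h -> parabolic (star v) (k^-1 * h) ->
    v \notin c /\ coset_sign x (halfspace h v) != tau (halfspace h v).
  move=> nv sA hx kh; have hk := panel_sym kh.
  have vc : v \notin c.
    apply/negP => vc; pose y := coordinate v (h^-1 * k).
    have E : halfspace k v = halfspace (h * gin y) v.
      apply: halfspace_rebase; rewrite ?mulgA //.
        by apply: parabolicM => //; apply: parabolic_gin; exact: star_id.
      rewrite in_halfspaceE mulgA coordinateM_gin // /y -coordinate_mul //.
      by rewrite !mulgE coordinate1.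
    have hyx : coset g c (h * gin y) by rewrite (coset_rebase hx); exact: coset_gin.
    by move: sA; rewrite E (down _ _ vc hyx) Ex (coset_rebase hyx) coset_sign_self // vc.
  split=> //; rewrite {1}Ex (coset_rebase hx) coset_sign_self // vc.
  apply: contraTN isT => /eqP/esym th.
  have Hk : HH (halfspace k v) by exists k, v.
  have Hh : HH (halfspace h v) by exists h, v.
  have xh : x `<=` halfspace h v by rewrite Ex (coset_rebase hx); exact: coset_sub.
  have nkh : ~ halfspace k v h.
    move=> /mem_set/(halfspace_rebase e_sym e_irr kh) E; move: sA.
    by rewrite E th Ex (coset_rebase hx) coset_sign_self // vc.
  have xk : coset_sign x (halfspace k v) = false.
    apply/asboolP => -[_ sub]; apply: nkh; apply: sub; rewrite Ex.
    exact: hx.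
  have [z [vz zk zh]] := cons _ _ Hk Hh.
  have /(coset_signP z Hk) zk' : coset_sign z (halfspace k v).
    by rewrite zk; move: sA; rewrite xk; case: (tau _).
  have /(coset_signP z Hh) zh' : coset_sign z (halfspace h v) by rewrite zh th.
  have [y yz] : exists y, z y.
    by have [k' [d [_ ->]]] := iffLR (vertex_coset _) vz; exists k'; exact: coset_self.
  have /halfspaceP := zk' _ yz; have /halfspaceP yh := zh' _ yz.
  rewrite (panel_coordinate e_sym e_irr _ kh) yh mulg1 => E.
  by case: nkh; apply/halfspaceP.
(* [n] measures paths from the coset to the panel of a half-space on which [x] and [tau]
   disagree. *)
pose P n := `[< exists k v h (t : seq G), [/\ nontrivial v,
    coset_sign x (halfspace k v) != tau (halfspace k v), coset g c h &
    [/\ word S t, parabolic (star v) (k^-1 * (h * wprod t)) & size t = n]] >].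
have exP : exists n, P n.
  have [k [v [nv EA0]]] := HA0; have [t ht et] := word_exists (hs_gen hs) (g^-1 * k).
  exists (size t); apply/asboolP; exists k, v, g, t; split=> //.
  - by rewrite -EA0.
  - exact: coset_self.
  - by split=> //; rewrite et mulVKg mulVg; exact: parabolic1.
have [n /asboolP[k [v [h [t [nv sA hx [ht kt et]]]]]] nmin] := ex_minnP exP.
case: t ht kt et => [|s t] ht kt et.
  rewrite wprod_nil mulg1 in kt; have [vc sh] := inside k v h nv sA hx kt.
  have th : tau (halfspace h v) = false.
    by move: sh; rewrite Ex (coset_rebase hx) coset_sign_self // vc; case: (tau _).
  have Hh : HH (halfspace h v) by exists h, v.
  (* Were [v] not adjacent to a label [w] of [c], a vertex realizing [tau] on both half-spaces at
     [h] would be outside both, contrary to [clique_nonadjacent]. *)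
  have cvc : clique e (v |: c).
    have adj w : w \in c -> e v w.
      move=> wc; apply: contraT => nvw; have nw := cn w wc.
      have Hw : HH (halfspace h w) by exists h, w.
      have [z [vz zv zw]] := cons _ _ Hh Hw.
      have vw : v != w by apply: contraNneq vc => ->.
      case: (@clique_nonadjacent V e F e_sym e_irr h v w z vz nv nw vw nvw).
        by move=> /(coset_signP z Hh); rewrite zv th.
      by move=> /(coset_signP z Hw); rewrite zw (down w h wc hx).
    apply/cliqueP => w u; rewrite !inE => /orP[/eqP->|wc] /orP[/eqP->|uc]; rewrite ?eqxx //.
    - by move=> _; exact: adj.
    - by move=> _; rewrite e_sym; exact: adj.
    - by move/cliqueP: cc => cc'; exact: cc'.
  have [a1 a2 s1 s2 s3] := @coset_step V e F e_sym e_irr h c v vc cvc nv.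
  rewrite -(coset_rebase hx) -Ex in a1 a2 s1 s3.
  exists (coset h (v |: c)), (halfspace h v); split=> //.
  - by apply/vertex_coset; exists h, (v |: c).
  - by rewrite th (negPf s2).
move: ht => /word_cons[/step_gin[w [y Es]] ht]; rewrite {}Es in kt.
have small m : (m < n)%N -> ~ P m by move=> mn /nmin; rewrite leqNgt mn.
have hmin t' : word S t' -> parabolic (star v) (k^-1 * (h * wprod t')) ->
    (size t < size t')%N.
  move=> ht' kt'; rewrite -[(size t).+1]/(size (s :: t)) et; apply: nmin.
  by apply/asboolP; exists k, v, h, t'.
have kt1 : parabolic (star v) (k^-1 * (h * gin y * wprod t)).
  by move: kt; rewrite wprod_cons (mulgA h).
have [y1 geo] := shortest_path_to_panel e_sym e_irr ht hmin kt1.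
have nw : nontrivial w by exists y.
have wc : w \notin c.
  apply/negP => wc; apply: (small (size t)); first by rewrite -et.
  apply/asboolP; exists k, v, (h * gin y), t; split=> //.
  by rewrite (coset_rebase hx); exact: coset_gin.
have hout : ~ parabolic (star v) (k^-1 * h).
  move=> kh; have := hmin [::]; rewrite wprod_nil mulg1 => /(_ _ kh) h0.
  by have := h0 (@word_nil _ S).
have Hw : HH (halfspace h w) by exists h, w.
have Hk : HH (halfspace k v) by exists k, v.
have xw : coset_sign x (halfspace h w) by rewrite Ex (coset_rebase hx) coset_sign_self.
(* The first letter of the shortest path defines a half-space at [h] containing [x]. If [tau] is
   outside it, there is a disagreement at distance 0, contradicting minimality. *)
suff tw : tau (halfspace h w) = false.
  case: (small 0%N); first by rewrite -et.
  apply/asboolP; exists h, w, h, [::]; split=> //; first by rewrite xw tw.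
  by split=> //; rewrite wprod_nil mulg1 mulVg; exact: parabolic1.
have far q : coordinate v (k^-1 * q) <> coordinate v (k^-1 * h) -> ~ halfspace h w q.
  move=> nq /halfspaceP hq; have [//|] := geo q.
  have hP : parabolic (star w) ((h * gin y)^-1 * h).
    by rewrite invgM mulgVK -gin_inv; apply: parabolic_gin; exact: star_id.
  rewrite (panel_coordinate e_sym e_irr _ hP) hq mulg1 invgM mulgVK -gin_inv coordinate_of_gin //.
  by move=> E; apply: y1; rewrite -(invgK y) E invg1.
have [z [vz zk zw]] := cons _ _ Hk Hw.
apply/negP => tw; have /(coset_signP z Hw) zw' : coset_sign z (halfspace h w) by rewrite zw.
have [xk|/negP xk] := boolP (coset_sign x (halfspace k v)).
  have nz : ~ (z `<=` halfspace k v).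
    by move=> /(coset_signP z Hk); rewrite zk => tk; move: sA; rewrite xk tk.
  have /halfspaceP hk : halfspace k v h.
    by have /(coset_signP x Hk) := xk; apply; rewrite Ex.
  have [q /not_implyP[zq nq]] : exists q, ~ (z q -> halfspace k v q) by exact/existsNP.
  apply: (far q) (zw' q zq); rewrite hk => E.
  by apply: nq; apply/halfspaceP.
have /(coset_signP z Hk) zk' : coset_sign z (halfspace k v).
  by rewrite zk; move: sA xk; case: (coset_sign x _) => //; case: (tau _).
have [q zq] : exists q, z q.
  by have [k' [d [_ ->]]] := iffLR (vertex_coset _) vz; exists k'; exact: coset_self.
have /halfspaceP kq := zk' q zq.
have [kh|nkh] := pselect (halfspace k v h); last first.
  by apply: (far q) (zw' q zq); rewrite kq => E; apply: nkh; apply/halfspaceP.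
have nx : ~ (coset h c `<=` halfspace k v).
  by rewrite -(coset_rebase hx) -Ex => /(coset_signP x Hk).
have [u [uc nu E]] := coset_leaves e_sym e_irr cc Hk kh nx.
have [uv hk] := halfspace_eq e_sym e_irr nu (esym E).
exact: hout.
Qed.

End GraphProductMedian.

(** * The wall graph of the graph-product complex *)

Section GraphProductWalls.
Variables (V : finType) (e : rel V) (F : V -> finGroupType).
Hypotheses (e_sym : symmetric e) (e_irr : irreflexive e).
Local Notation G := (graph_product e F).
Local Notation gin := (@graph_product_in V e F _).
Local Notation parabolic := (@parabolic V e F).
Local Notation star := (star e).
Local Notation coordinate := (@coordinate V e F).
Local Notation S := (@gp_letters V e F).
Local Notation HH := (@gp_halfspaces V e F).
Local Notation halfspace := (@halfspace V e F).
Local Notation nontrivial := (@nontrivial V F).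
Local Notation coset := (@coset V e F).
Local Notation coset_sign := (@coset_sign V e F).
Local Notation X := (graph_product_complex e F).
Implicit Types (v w u : V) (g h p q y k : G) (c d L : {set V}) (A B x z : set G).

Let hs : halfspace_system S HH := gp_halfspace_system F e_sym e_irr.

Local Notation consistent := (@consistent V e F).

(** The first letter of a shortest path from [x] to a point [q] outside it has a label not in the
    clique, so its half-space contains [x]; the path leaves this half-space for good, so [q] is
    outside. *)
Lemma coset_sub_sign (x y : set G) : vertex X x -> vertex X y ->
  (forall A, coset_sign x A -> coset_sign y A) -> y `<=` x.
Proof.
move=> /vertex_coset[g [c [cc Ex]]] /vertex_coset[g' [c' [cc' Ey]]] sub q yq.
apply: contrapT => nq.
pose P n := `[< exists h (t : seq G), [/\ coset g c h, word S t, h * wprod t = q &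
  size t = n] >].
have exP : exists n, P n.
  have [t ht et] := word_exists (hs_gen hs) (g^-1 * q).
  exists (size t); apply/asboolP; exists g, t; split=> //; first exact: coset_self.
  by rewrite et mulVKg.
have [n /asboolP[h [t [hx ht eq et]]] nmin] := ex_minnP exP.
have {}nmin h' (t' : seq G) : coset g c h' -> word S t' -> h' * wprod t' = q ->
    (size t <= size t')%N.
  by move=> hx' ht' eq'; rewrite et; apply: nmin; apply/asboolP; exists h', t'.
case: t ht eq et nmin => [|s t] ht eq et nmin.
  by apply: nq; rewrite -eq wprod_nil mulg1 Ex.
have gw : geodesic S ([:: s] ++ t).
  by split=> // t' ht' et'; apply: (nmin h) => //; rewrite et'.
move: ht => /word_cons[/step_gin[w [a Es]] ht].
have eq' : h * gin a * wprod t = q by rewrite -eq wprod_cons Es mulgA.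
have nw : nontrivial w.
  exists a => a1; have := nmin h t hx ht; rewrite /= ltnn.
  by move: eq'; rewrite a1 gin1 mulg1 => eq' /(_ eq').
have wc : w \notin c.
  apply/negP => wc; have := nmin (h * gin a) t _ ht eq'; rewrite /= ltnn.
  by rewrite (coset_rebase hx) => /(_ (coset_gin _ _ wc)).
have HB : HH (halfspace h w) by exists h, w.
have /sub/(coset_signP y HB)/(_ q yq) : coset_sign x (halfspace h w).
  by rewrite Ex (coset_rebase hx) coset_sign_self.
move=> /mem_set qB; have := geodesic_sep hs (x := h) HB gw.
rewrite wprod_cons wprod_nil mulg1 Es eq' qB halfspace_self // => /(_ erefl) hB.
have : a <> 1.
  move=> a1; have := nmin h t hx ht; rewrite /= ltnn.
  by move: eq'; rewrite a1 gin1 mulg1 => eq' /(_ eq').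
by move=> /(sep_gin_self e_sym e_irr h); rewrite /sep hB halfspace_self.
Qed.

Lemma coset_sign_inj (x y : set G) : vertex X x -> vertex X y ->
  (forall A, coset_sign x A = coset_sign y A) -> x = y.
Proof.
by move=> vx vy exy; apply/seteqP; split; apply: coset_sub_sign => // A; rewrite exy.
Qed.

Lemma consistent_vertex tau x (l : seq (set G)) : vertex X x -> consistent tau ->
  (forall A, coset_sign x A != tau A -> A \in l) -> (forall A, tau A -> HH A) ->
  exists2 m, vertex X m & forall A, coset_sign m A = tau A.
Proof.
move=> + cons + tH; elim: {l}(size l) {-2}l (leqnn (size l)) x => [|n IH] l ln x vx hl.
  exists x => // A; apply/eqP; apply: contraT => /hl.
  by case: l ln {hl}.
have [[A [HA dA]]|same] := pselect (exists A, HH A /\ coset_sign x A != tau A); last first.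
  exists x => // A; apply/eqP; apply: contraT => dA; case: same; exists A; split=> //.
  apply: contrapT => nH; move: dA; rewrite coset_sign_nonhalf //.
  by case: (boolP (tau A)) => // /tH.
have [z [B [vz _ dB zB zC]]] := closer_vertex e_sym e_irr vx cons HA dA.
apply: (IH [seq C <- l | C != B] _ z vz) => [|C dC].
  rewrite -ltnS; apply: leq_trans ln; rewrite size_filter -[X in (_ < X)%N]count_predT.
  by apply: (@count_lt _ _ _ B) => //; [exact: hl|rewrite /= eqxx].
have CB : C != B by apply: contraNneq dC => ->; rewrite zB.
by rewrite mem_filter CB hl // -(zC C CB).
Qed.

Lemma coset_sign_fin (x y : set G) : vertex X x -> vertex X y ->
  exists l : seq (set G), forall A, coset_sign x A != coset_sign y A -> A \in l.
Proof.
move=> /vertex_coset[g [c [cc Ex]]] /vertex_coset[h [d [cd Ey]]].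
have [t ht et] := word_exists (hs_gen hs) (g^-1 * h).
have [C hC] := sep_bounded hs (size t).
have [|l _ hl] := hC g h; first by rewrite -et; exact: wlen_word.
exists (l ++ [seq halfspace g v | v <- enum V] ++ [seq halfspace h v | v <- enum V]) => A dA.
have HA : HH A by apply: contrapT => nA; move: dA; rewrite !coset_sign_nonhalf.
have [sgh|] := boolP (sep A g h); first by rewrite mem_cat hl.
rewrite negbK => /eqP gh; rewrite !mem_cat.
have leaf k b : clique e b -> A k -> ~~ coset_sign (coset k b) A ->
    A \in [seq halfspace k v | v <- enum V].
  move=> cb Ak nk; have [|v [_ _ ->]] := coset_leaves e_sym e_irr cb HA Ak.
    by move=> /(coset_signP _ HA); apply/negP.
  by apply: map_f; rewrite mem_enum.
have mem k b : coset_sign (coset k b) A -> A k.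
  by move=> /(coset_signP _ HA); apply; exact: coset_self.
have AgAh : A g <-> A h by split=> /mem_set h0; apply: set_mem; move: h0; rewrite gh.
move: dA; rewrite Ex Ey; case: (boolP (coset_sign (coset g c) A)) => [/mem/AgAh Ah|ng].
  by move=> dA; rewrite (leaf _ _ cd Ah) ?orbT //.
case: (boolP (coset_sign (coset h d) A)) => // /mem/AgAh Ag _.
by rewrite (leaf _ _ cc Ag) // orbT.
Qed.

(** A two-element cube need not come from cliques differing by one label, since trivial vertex
    groups make cosets coincide. A nontrivial new label gives a vertex of the cube other than the
    first one, hence equal to the second. *)
Lemma adjacent_coset (x y : set G) : adjacent X x y -> vertex X y /\
  exists A, forall B, coset_sign x B != coset_sign y B -> B = A.
Proof.
move=> [nxy [g [c [c' [cc cc' ccc' E]]]]].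
have inC z : [set x; y] z -> exists d, [/\ c \subset d, d \subset c' & z = coset g d].
  by rewrite E => -[d hd]; exists d.
have Cin d : c \subset d -> d \subset c' -> [set x; y] (coset g d).
  by move=> cd dc; rewrite E; exists d.
split.
  have [|d [_ dc' ->]] := inC y; first by right.
  by apply/vertex_coset; exists g, d; split=> //; exact: cliqueS cc'.
have key (q : set G) : q <> coset g c -> [set x; y] = [set coset g c; q] ->
    exists A, forall B, coset_sign (coset g c) B != coset_sign q B -> B = A.
  move=> ne E2; have [|d [cd dc' Eq]] := inC q; first by rewrite E2; right.
  have [[v [vd vc nv]]|no] := pselect (exists v, [/\ v \in d, v \notin c & nontrivial v]).
    have cvc' : v |: c \subset c'.
      by rewrite finset.subUset finset.sub1set ccc' (fintype.subsetP dc').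
    have cvc := cliqueS cvc' cc'.
    have [[nev _] _ _ _ s3] := @coset_step V e F e_sym e_irr g c v vc cvc nv.
    have qE : coset g (v |: c) = q.
      have := Cin (v |: c) (finset.subsetUr _ _) cvc'; rewrite E2 => -[/esym//|->//].
    exists (halfspace g v) => B; rewrite -qE => dB.
    by apply/eqP; apply: contraT => /s3 eB; rewrite eB eqxx in dB.
  case: ne; rewrite Eq; apply/seteqP; split; last exact: cosetS.
  move=> p /cosetE hp; apply/cosetE; move: (_ * p) hp; apply: smallest_sub.
    exact: subgroup_gen_subgroup.
  move=> _ [v [a [vd ->]]]; have [vc|vc] := boolP (v \in c); first exact: parabolic_gin.
  have [->|a1] := eqVneq a 1; first by rewrite gin1; exact: parabolic1.
  by case: no; exists v; split=> //; exists a; exact/eqP.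
have [gx|gy] : coset g c = x \/ coset g c = y.
  by have := Cin c (fintype.subxx _) ccc' => -[->|->]; [left|right].
  rewrite -gx in nxy *; have [A hA] := key y (nesym nxy) (congr1 (fun z => [set z; y]) (esym gx)).
  by exists A.
have nx : x <> coset g c by rewrite gy.
have ex : [set x; y] = [set coset g c; x] by rewrite gy setUC.
have [A hA] := key x nx ex.
by exists A => B; rewrite -gy eq_sym; exact: hA.
Qed.

Lemma gp_wall_graph : wall_graph X coset_sign.
Proof.
split.
- by move=> x y _; exact: adjacent_coset.
- move=> x y vx vy nxy.
  have [A dA] : exists A, coset_sign x A != coset_sign y A.
    apply: contrapT => h; apply: nxy; apply: coset_sign_inj => // A.
    by apply/eqP; apply: contraT => dA; case: h; exists A.
  have HA : HH A by apply: contrapT => nA; move: dA; rewrite !coset_sign_nonhalf.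
  have cons : consistent (coset_sign y) by move=> B C _ _; exists y.
  by have [z [B [vz az dB zB zC]]] := closer_vertex e_sym e_irr vx cons HA dA; exists z, B.
- exact: coset_sign_fin.
move=> x y z vx vy vz.
pose tau A := majority (coset_sign x A) (coset_sign y A) (coset_sign z A).
(* On any two half-spaces the majority agrees with a common one of [x], [y], [z]. *)
have cons : consistent tau.
  move=> A B _ _; rewrite /tau /majority.
  have [ax|ax] := eqVneq (coset_sign x A) (coset_sign y A);
    have [bx|bx] := eqVneq (coset_sign x B) (coset_sign y B).
  - by exists x.
  - have [bz|bz] := eqVneq (coset_sign x B) (coset_sign z B); first by exists x.
    exists y; split=> //; move: bx bz.
    by case: (coset_sign x B) (coset_sign y B) (coset_sign z B) => [] [] [].
  - have [az|az] := eqVneq (coset_sign x A) (coset_sign z A); first by exists x.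
    exists y; split=> //; move: ax az.
    by case: (coset_sign x A) (coset_sign y A) (coset_sign z A) => [] [] [].
  by exists z.
have [l1 h1] := coset_sign_fin vx vy; have [l2 h2] := coset_sign_fin vx vz.
have [||m vm hm] := @consistent_vertex tau x (l1 ++ l2) vx cons; last by exists m.
- move=> A; rewrite /tau /majority mem_cat; have := h1 A; have := h2 A.
  case: (coset_sign x A) (coset_sign y A) (coset_sign z A) => [] [] [] //= a b _;
  by rewrite ?(a isT) ?(b isT) ?orbT.
move=> A; rewrite /tau /majority; case: ifP => _ /asboolP[]//.
Qed.

End GraphProductWalls.

(** * Elements of finite order and rigidity of graph products *)

Section GraphProductRigidity.
Variables (V : finType) (e : rel V) (F : V -> finGroupType).
Hypotheses (e_sym : symmetric e) (e_irr : irreflexive e).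
Local Notation G := (graph_product e F).
Local Notation gin := (@graph_product_in V e F _).
Local Notation parabolic := (@parabolic V e F).
Local Notation star := (star e).
Local Notation coordinate := (@coordinate V e F).
Local Notation S := (@gp_letters V e F).
Local Notation HH := (@gp_halfspaces V e F).
Local Notation halfspace := (@halfspace V e F).
Local Notation nontrivial := (@nontrivial V F).
Local Notation coset := (@coset V e F).
Local Notation coset_sign := (@coset_sign V e F).
Local Notation X := (graph_product_complex e F).
Implicit Types (v w u : V) (g h p q y k : G) (c d L : {set V}) (A B x z : set G).

Let hs : halfspace_system S HH := gp_halfspace_system F e_sym e_irr.

(* The wall of [halfspace g v] has the label [v], and walls with the same label
   do not cross. *)
Lemma same_label_nested g h v q q' : halfspace g v q -> halfspace h v q ->
  ~ halfspace g v q' -> ~ halfspace h v q' ->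
  halfspace g v `<=` halfspace h v \/ halfspace h v `<=` halfspace g v.
Proof.
move=> /halfspaceP gq /halfspaceP hq ngq nhq.
have [gh|ngh] := pselect (parabolic (star v) (g^-1 * h)).
  left=> y /halfspaceP gy; apply/halfspaceP.
  have := panel_coordinate e_sym e_irr q gh; rewrite gq hq mulg1 => E.
  by have := panel_coordinate e_sym e_irr y gh; rewrite -E mul1g gy.
have cst k l y : ~ parabolic (star v) (k^-1 * l) -> parabolic (star v) (l^-1 * y) ->
    coordinate v (k^-1 * y) = coordinate v (k^-1 * l).
  move=> nkl ly; apply: contrapT => ne.
  have [p [lp kp _]] := panel_cross e_sym e_irr ly ne.
  exact: nkl (panel_trans kp (panel_sym lp)).
have nhg : ~ parabolic (star v) (h^-1 * g) by move=> /panel_sym.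
have dich := @panel_dichotomy V e F e_sym e_irr g v (coordinate v (g^-1 * h)) h v
  (coordinate v (h^-1 * g)) (fun y => cst g h y ngh) (fun y => cst h g y nhg).
have [a1|a1] := pselect (coordinate v (g^-1 * h) = 1); last first.
  have b1 : coordinate v (h^-1 * g) = 1.
    by case: (dich q) => [E|<- //]; case: a1; rewrite -E.
  left=> y /halfspaceP gy; apply/halfspaceP.
  by case: (dich y) => [E|->//]; case: a1; rewrite -E.
have [b1|b1] := pselect (coordinate v (h^-1 * g) = 1).
  by case: (dich q') => E; [case: ngq|case: nhq]; apply/halfspaceP; rewrite E.
right=> y /halfspaceP hy; apply/halfspaceP.
by case: (dich y) => [->//|E]; case: b1; rewrite -E.
Qed.

Lemma translate_exp_sub (g : G) A n : translate g A `<=` A -> translate (g ^+ n) A `<=` A.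
Proof.
move=> sub; elim: n => [|n IH]; first by rewrite expg0 translate1.
rewrite expgS -translateM => y; rewrite translateE => /IH h; apply: sub.
by rewrite translateE.
Qed.

Lemma finite_order_translate (g : G) A n : g ^+ n.+1 = 1 -> translate g A `<=` A ->
  translate g A = A.
Proof.
move=> gn sub; apply/seteqP; split=> // y Ay; rewrite translateE.
apply: (translate_exp_sub sub (n := n)); rewrite translateE mulgA -invgM.
by rewrite -expgS gn invg1 mul1g.
Qed.

(** An inclusion between [A] and its translate propagates through the powers of [g], which return to
    the identity and force equality. *)
Lemma nested_translate (g : G) A n : g ^+ n.+1 = 1 ->
  A `<=` translate g A \/ translate g A `<=` A -> translate g A = A.
Proof.
move=> gn [sub|]; last exact: finite_order_translate gn.
have gVn : g^-1 ^+ n.+1 = 1 by rewrite expVgn gn invg1.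
have /(finite_order_translate gVn) E : translate g^-1 A `<=` A.
  by move=> y; rewrite translateE invgK => /sub; rewrite translateE mulKg.
by rewrite -{1}E translateVK.
Qed.

Lemma gp_rigid_wall (phi : {multiplicative G -> G}) v (f : F v) : f <> 1 ->
  rigid_wall S HH phi (halfspace 1 v) (gin f).
Proof.
move=> f1; have phiM : {morph phi : x y / x * y} by exact: gmulfM.
have coord1 y : (y \in halfspace 1 v) = (coordinate v y == 1).
  by rewrite in_halfspaceE invg1 mul1g.
have Pf (x : F v) : parabolic (star v) (gin x).
  by apply: parabolic_gin; exact: star_id.
split.
- exists 1%N => h _ /step_gin[w [x ->]] /(sep_gin e_sym e_irr)[_].
  rewrite invg1 mul1g => /(gin_star f)[f' E].
  by rewrite -mulgA E mulKg; apply: wlen_step; exact: step_of_gin.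
(* Left multiplication by [gin f] moves a point out of the half-space. From a point outside, the
   path to its translate reaches the panel with unchanged coordinate, and one more letter enters the
   half-space. *)
- move=> D; exists (D + 1)%N => y hy.
  have fy : coordinate v (gin f * y) = f * coordinate v y.
    by rewrite coordinate_mul // coordinate_of_gin.
  have [y1|ny1] := eqVneq (coordinate v y) 1.
    exists (gin f * y); first by rewrite mulgA; apply: wlen_mono hy; exact: leq_addr.
    by move/eqP/negPf: f1 => f1; rewrite /sep !coord1 fy y1 mulg1 eqxx f1.
  case: hy => t tD [ht et].
  have [|t1 [s [t2 [E h1 h2]]]] := first_change (w := t) (x := y) (f := coordinate v).
    rewrite /wprod -et !mulgA mulgV mul1g fy; apply/eqP => E; apply: f1.
    by apply: (mulIg (coordinate v y)); rewrite mul1g.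
  move: ht tD; rewrite E => /word_cat[ht1 /word_cons[/step_gin[w [x Es]] _]].
  rewrite size_cat => tD; set y' := y * wprod t1 in h1 h2.
  move: h2; rewrite Es -h1; have [->|[_ y'P] _] := coordinate_gin e_sym e_irr v x y'.
    by rewrite eqxx.
  exists (y' * gin (coordinate v y)^-1).
    rewrite /y' mulgA mulKg; apply: wlenM; last by apply: wlen_step; exact: step_of_gin.
    by apply: wlen_mono (wlen_word ht1); rewrite (leq_trans _ tD) // leq_addr.
  rewrite /sep !coord1 coordinateM_gin // h1 mulgV eqxx.
  by rewrite (negPf ny1).
move=> D K; have [C hC] := sep_bounded hs D.
set g := phi (gin f).
have [n gn] : exists n, g ^+ n.+1 = 1.
  exists #[f].-1; rewrite prednK ?order_gt0 // /g.
  have -> i : phi (gin f) ^+ i = phi (gin (f ^+ i)).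
    by elim: i => [|i IH]; [rewrite !expg0 gin1 (morph_mul1 phiM)|rewrite !expgS IH gin_mul phiM].
  by rewrite expg_order gin1 (morph_mul1 phiM).
(* [C] for the half-spaces separating [q] from [g * q], again for [q'], then [K] for the exceptions
   of the interval and [K] for their translates by [g]. *)
exists (C + (C + (K + K)))%N => q q' p hq hq' [l lK hl].
have [|l1 s1 h1] := hC q (g * q); first by rewrite mulgA.
have [|l2 s2 h2] := hC q' (g * q'); first by rewrite mulgA.
suff : word_length_le S (size (l1 ++ l2 ++ l ++ [seq translate g B | B <- l]))
    (p^-1 * (g * p)).
  rewrite mulgA; apply: wlen_mono; rewrite !size_cat size_map !leq_add //.
apply: (wlen_of_sep hs) => A HA sA; apply: contraT.
rewrite !mem_cat !negb_or => /and4P[nl1 nl2 nl nlg].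
pose A' := translate g^-1 A.
have HA' : HH A' by exact: (hs_inv hs).
have memA' y : (y \in A') = (g * y \in A) by rewrite translate_mem invgK.
have eq1 : (q \in A) = (q \in A').
  by rewrite memA'; apply/eqP; apply: contraNT nl1; exact: h1.
have eq2 : (q' \in A) = (q' \in A').
  by rewrite memA'; apply/eqP; apply: contraNT nl2; exact: h2.
have nlA' : A' \notin l.
  by apply: contraNN nlg => A'l; rewrite -(translateVK g A) map_f.
have sA' : (p \in A) != (p \in A') by rewrite memA'.
have hp1 : (q \in A) = (q' \in A) -> (p \in A) = (q \in A).
  move=> E; apply/eqP; rewrite eq_sym; apply: contraNT nl => h0; exact: hl HA E h0.
have hp2 : (q \in A) = (q' \in A) -> (p \in A') = (q \in A').
  move=> E; apply/eqP; rewrite eq_sym; apply: contraNT nlA'; apply: hl => //.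
  by rewrite -eq1 -eq2.
have E : translate g^-1 A = A; last by move: sA'; rewrite /A' E eqxx.
have gVn : g^-1 ^+ n.+1 = 1 by rewrite expVgn gn invg1.
have [k [w [nw EA]]] := HA.
have EA' : A' = halfspace (g^-1 * k) w by rewrite /A' EA translate_gp_halfspace.
(* This serves when [A] separates [q] from [q']: the two half-spaces have the same label, a common
   point and a common outside point, so they are nested, and finite order makes them equal. When [A]
   does not separate them, [p] is on the side of [q] for both. *)
have nested y y' : y \in A -> y \in A' -> y' \notin A -> y' \notin A' -> translate g^-1 A = A.
  rewrite EA' EA => /set_mem ya /set_mem ya' /negP nya /negP nya'.
  rewrite -EA; apply: (nested_translate gVn); rewrite -/A' EA' EA.
  apply: (same_label_nested (q' := y') ya ya') => h; [apply: nya|apply: nya']; exact: mem_set.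
have [qA|qA] := boolP (q \in A); have [q'A|q'A] := boolP (q' \in A).
- by move: sA'; rewrite hp1 ?hp2 ?qA ?q'A // -eq1 qA.
- by apply: (nested q q'); rewrite -?eq1 -?eq2.
- by apply: (nested q' q); rewrite -?eq1 -?eq2.
by move: sA'; rewrite hp1 ?hp2 ?(negPf qA) ?(negPf q'A) // -eq1 (negPf qA).
Qed.

Theorem graph_product_fixed (x0 : set G) mu : vertex X x0 ->
  cubical_coarse_median X (@translate G) x0 mu -> fixed_by_Out mu.
Proof.
move=> vv hmu phi psi phiK psiK.
have act_vertex g x : vertex X x -> vertex X (translate g x).
  move=> /vertex_coset[h [c [cc ->]]]; apply/vertex_coset; exists (g * h), c.
  by rewrite /coset translateM.
(* This vertex is the singleton of [1], so a half-space of [G] is the set of [g] whose translate of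
   it has positive sign. *)
have v1 : vertex X (coset 1 finset.set0).
  apply/vertex_coset; exists 1, finset.set0; split=> //.
  by apply/cliqueP => v w; rewrite !inE.
have [||K hK] := coarse_median_near_interval (gp_wall_graph F e_sym e_irr)
  act_vertex (HH := HH) (iact := @translate G) _ _ v1 vv hmu.
- move=> g x y A vx vy dA; exists (translate g^-1 A); last by rewrite translateVK.
  have tr z : coset_sign (translate g z) A = coset_sign z (translate g^-1 A).
    apply/asboolP/asboolP => -[HA sub]; split.
    + exact: (hs_inv hs).
    + by move=> y' zy'; rewrite translateE invgK; apply: sub; exists y'.
    + by rewrite -(translateVK g A); exact: (hs_inv hs).
    + by move=> _ [y' /sub + <-]; rewrite translateE invgK.
  by rewrite -!tr.
- move=> B HB; exists B, true => g.
  rewrite eqb_id; apply/idP/asboolP => [/set_mem gB|[_ sub]].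
    split=> // y [y' /cosetE hy' <-].
    suff -> : y' = 1 by rewrite mulg1.
    move: hy'; rewrite invg1 mul1g.
    by elim/(@parabolic_ind V e F finset.set0) => // w a h; rewrite inE.
  apply: mem_set; apply: sub; exists 1; last by rewrite mulg1.
  exact: coset_self.
pose f v : F v := odflt 1 [pick x : F v | x != 1].
have hf v : nontrivial v -> f v <> 1.
  rewrite /f; case: pickP => [x /eqP //|no [x /eqP]].
  by rewrite no.
pose Q := [seq (halfspace 1 v, gin (f v)) | v <- enum V & `[< nontrivial v >]].
apply: (rigid_walls_fixed hs phiK psiK hK (Q := Q)).
  move=> A [g [v [nv ->]]]; exists (halfspace 1 v, gin (f v)).
    by apply: map_f; rewrite mem_filter mem_enum andbT; apply/asboolP.
  by exists g; rewrite translate_gp_halfspace mulg1.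
move=> _ /mapP[v + ->]; rewrite mem_filter => /andP[/asboolP nv _].
by apply: gp_rigid_wall; exact: hf.
Qed.

End GraphProductRigidity.

Theorem theoremD :
  (forall (V : finType) (e : rel V) (F : V -> finGroupType)
      (e_sym : symmetric e) (e_irr : irreflexive e)
      (v : set (graph_product e F))
      (mu : graph_product e F -> graph_product e F -> graph_product e F ->
            graph_product e F),
    vertex (graph_product_complex e F) v ->
    cubical_coarse_median (graph_product_complex e F)
      (@translate (graph_product e F)) v mu ->
    fixed_by_Out mu)
  /\
  (forall (W : groupType) (S : set W)
      (v : side_choice W) (mu : W -> W -> W -> W),
    coxeter_system S ->
    finite_set S ->
    cocompact (niblo_reeves_complex S) (@niblo_reeves_act W) ->
    vertex (niblo_reeves_complex S) v ->
    cubical_coarse_median (niblo_reeves_complex S) (@niblo_reeves_act W) v mu ->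
    fixed_by_Out mu).
Proof.
split=> [V e F e_sym e_irr v mu|W S v mu cox finS hcc].
  exact: graph_product_fixed.
exact: niblo_reeves_fixed.
Qed.
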